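(* If $\mathfrak g$ is a non-twisted affine Kac–Moody superalgebra which is not an affine Kac–Moody algebra, not $B(m|n)^{(1)}$ and not $D(2|1,a)^{(1)}$, then any admissible level for $\mathfrak g$ is principal admissible.
   Context: Non-twisted affine superalgebras. Under the stated exclusions $\mathfrak g=\dot{\mathfrak g}^{(1)}$, where $\dot{\mathfrak g}$ is one of $A(m|n)=\mathfrak{sl}(m+1|n+1)$ ($m>n\ge 0$), $A(n|n)=\mathfrak{gl}(n+1|n+1)$ ($n\ge1$), $D(m|n)=\mathfrak{osp}(2m|2n)$ ($m,n\ge1$, $(m,n)\neq(2,1)$), $F(4)$, $G(3)$, with root system $\dot\Delta$. $\mathfrak g=\dot{\mathfrak g}[t,t^{-1}]\oplus\mathbb CK\oplus\mathbb Cd$, $[at^i,bt^j]=[a,b]t^{i+j}+i\delta_{i,-j}(a,b)K$, $K$ central, $d=t\frac{d}{dt}$; for $\dot{\mathfrak g}=\mathfrak{gl}(n|n)$ the loop algebra is replaced by the quotient of $\mathfrak{gl}(n|n)+\sum_j\mathfrak{sl}(n|n)t^j$ by the elements $I_{2n}t^s$, $s\ne0$. The invariant form $(\cdot,\cdot)$ on $\dot{\mathfrak g}$ is normalised so that roots of maximal square length satisfy $(\alpha,\alpha)=2$ and half the eigenvalue $h^\vee$ of the Casimir operator on the adjoint representation is $\ge0$; if $h^\vee=0$: for $D(n+1|n)$ the roots of $D_{n+1}$ have square length $2$, and for $A(n|n)$ the roots $\varepsilon_i-\varepsilon_j$ have square length $2$. It extends to $\mathfrak g$ by $(at^i,bt^j)=\delta_{i,-j}(a,b)$,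 $(K,d)=1$, $(d,d)=0$. $\mathfrak h$ is the Cartan subalgebra, $\Delta=\Delta_{\bar0}\sqcup\Delta_{\bar1}$ the roots, $\delta$ the minimal positive imaginary root, $\Sigma\supset\dot\Sigma$ bases of $\Delta\supset\dot\Delta$, $\Lambda_0\in\mathfrak h^*$ with $(\Lambda_0,\delta)=1$, $(\Lambda_0,\dot\Delta)=(\Lambda_0,\Lambda_0)=0$. $\rho$: $2(\rho,\alpha)=(\alpha,\alpha)$ for $\alpha\in\Sigma$. $L(\lambda)$ is the irreducible highest weight module. Real roots. $\mathrm{Sp}$ is the set of bases obtained from $\Sigma$ by chains of odd reflexions (for an isotropic $\beta\in\Sigma$: replace $\beta$ by $-\beta$, each $\alpha\in\Sigma\setminus\{\beta\}$ with $(\alpha,\beta)\neq0$ by $\alpha+\beta$, keep the others). $\Sigma_{pr}$ is the set of even roots $\alpha$ with $\alpha$ or $\alpha/2$ in some $\Sigma_1\in\mathrm{Sp}$; $W$ is generated by the reflections $s_\alpha$, $\alpha\in\Sigma_{pr}$; $\overline\Delta^{re}=\{w\alpha:w\in W,\alpha\in\Sigma_1\in\mathrm{Sp}\}$; $\Delta^{re}=\{\gamma\in\Delta:\gamma\text{ or }\gamma/2\in\overline\Delta^{re}\}$. For $\mu\in\mathfrak h^*$, $\overline R_\mu$ is the set of $\alpha\in\overline\Delta^{re}$ with $2(\mu,\alpha)=j(\alpha,\alpha)$, $j\in\mathbb Z$, $j$ odd if $2\alpha\in\Delta$; $\Delta_\mu$ is the minimal subset of $\Delta^{re}$ with: $\overline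 R_\mu\subset\Delta_\mu$; $s_\alpha\beta\in\Delta_\mu$ if $\alpha,\beta\in\Delta_\mu$, $(\alpha,\alpha)\ne0$; $\Delta_\mu\cap\{\alpha\pm\beta\}=\Delta^{re}\cap\{\alpha\pm\beta\}$ if $\alpha,\beta\in\Delta_\mu$, $(\alpha,\alpha)=0\neq(\alpha,\beta)$; $2\alpha\in\Delta_\mu$ if $\alpha\in\Delta_\mu$, $2\alpha\in\Delta^{re}$. Admissible level. $\pi^\#=\{\alpha\in\Sigma_{pr}:(\alpha,\alpha)>0\}$, $\Delta^\#=\{\alpha\in\Delta_{\bar0}:(\alpha,\alpha)>0\}$. $\mathfrak g_{\pi^\#}$ is the subalgebra generated by $\mathfrak h$ and $\mathfrak g_{\pm\alpha}$, $\alpha\in\pi^\#$, with Weyl denominator $D_{\pi^\#}=\prod_{\alpha\in\Delta(\mathfrak g_{\pi^\#})\cap\Delta^+}(1-e^{-\alpha})^{\dim(\mathfrak g_{\pi^\#})_\alpha}$ and $\rho_{\pi^\#}$ with $2(\rho_{\pi^\#},\alpha)=(\alpha,\alpha)$ for $\alpha\in\pi^\#$. $\lambda$ is admissible if $(\lambda+\rho,\delta)\neq0$, $\mathbb Q(\Delta_{\lambda+\rho}\cap\Delta^\#)=\mathbb Q\Delta^\#$, and $s_\alpha(D_{\pi^\#}e^{\rho_{\pi^\#}}\mathrm{ch}L(\lambda))=-D_{\pi^\#}e^{\rho_{\pi^\#}}\mathrm{ch}L(\lambda)$ for all $\alpha\in\Delta_{\lambda+\rho}\cap\Delta^\#$,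 where $s_\alpha\sum x_\nu e^\nu:=\sum x_\nu e^{s_\alpha\nu}$. The level $k$ is admissible if $k\Lambda_0$ is admissible; it is principal admissible if moreover $\Delta_{k\Lambda_0+\rho}$ is isometric to $\Delta^{re}$, i.e. there is a linear map from the span of $\Delta_{k\Lambda_0+\rho}$ to the span of $\Delta^{re}$ preserving the bilinear forms and restricting to a bijection $\Delta_{k\Lambda_0+\rho}\to\Delta^{re}$. *)

(* Defs.v *)
From HB Require Import structures.
From mathcomp Require Import all_boot all_order all_algebra.
From mathcomp Require Import finmap.
From mathcomp Require Import boolp classical_sets functions cardinality fsbigop.
From mathcomp Require Import reals complex.
Set Implicit Arguments.
Unset Strict Implicit.
Unset Printing Implicit Defensive.
Import Order.TTheory GRing.Theory Num.Theory.
Local Open Scope classical_set_scope.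
Local Open Scope ring_scope.

(* The ground field is an arbitrary [C : numClosedFieldType]; [0 < z] in [C]
   means that z is real and positive.  Parities are booleans, [true] being
   odd. *)

Section LinearAlgebra.
Variables (C : numClosedFieldType) (V : lmodType C).
Implicit Types (S : set V) (n : nat).

Definition subspace S :=
  S 0 /\ forall (a : C) u v, S u -> S v -> S (a *: u + v).

Definition basis_of_set S n (u : 'I_n -> V) :=
  [/\ forall i, S (u i),
      forall c : 'I_n -> C, \sum_i c i *: u i = 0 -> forall i, c i = 0 &
      forall v, S v -> exists c : 'I_n -> C, v = \sum_i c i *: u i].

(* Dimension of a subspace; 0 by convention if it is infinite. *)
Definition dimset S : nat :=
  xget 0%N [set n | exists u : 'I_n -> V, basis_of_set S u].

Definition z2graded (part : bool -> set V) :=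
  [/\ forall b, subspace (part b),
      forall v, exists v0 v1,
        [/\ part false v0, part true v1 & v = v0 + v1] &
      forall v, part false v -> part true v -> v = 0].

Definition graded_subspace (part : bool -> set V) S :=
  subspace S /\
  forall v0 v1, part false v0 -> part true v1 -> S (v0 + v1) -> S v0 /\ S v1.

Definition natcone S : set V :=
  [set v | exists s : seq V, (forall u, u \in s -> S u) /\ v = \sum_(u <- s) u].

Definition Cspan S : set V :=
  [set v | exists (s : seq V) (c : V -> C),
    (forall u, u \in s -> S u) /\ v = \sum_(u <- s) c u *: u].

Definition Qspan S : set V :=
  [set v | exists (s : seq V) (c : V -> rat),
    (forall u, u \in s -> S u) /\ v = \sum_(u <- s) ratr (c u) *: u].

End LinearAlgebra.

Record lieSuperalgebra (C : numClosedFieldType) := LieSuperalgebra {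
  lsa_car :> lmodType C;
  lsa_part : bool -> set lsa_car;
  lsa_br : lsa_car -> lsa_car -> lsa_car;
  lsa_gradedP : z2graded lsa_part;
  lsa_linearl : forall y, linear (fun x => lsa_br x y);
  lsa_linearr : forall x, linear (lsa_br x);
  lsa_br_part : forall a b x y, lsa_part a x -> lsa_part b y ->
    lsa_part (a (+) b) (lsa_br x y);
  lsa_skew : forall a b x y, lsa_part a x -> lsa_part b y ->
    lsa_br x y = - ((-1) ^+ (a && b) *: lsa_br y x);
  lsa_jacobi : forall a b x y z, lsa_part a x -> lsa_part b y ->
    lsa_br x (lsa_br y z) =
    lsa_br (lsa_br x y) z + (-1) ^+ (a && b) *: lsa_br y (lsa_br x z) }.

Notation "\[ x , y \]" := (lsa_br x y) (at level 0, x, y at level 100).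

Definition simple_lsa (C : numClosedFieldType) (g : lieSuperalgebra C) :=
  (exists x y : g, \[x, y\] <> 0) /\
  forall S : set g, graded_subspace (@lsa_part C g) S ->
    (forall x y, S y -> S \[x, y\]) -> S = [set 0] \/ S = setT.

Definition gen_subalgebra (C : numClosedFieldType) (g : lieSuperalgebra C)
    (A : set g) : set g :=
  [set x | forall S : set g, subspace S ->
    (forall y z, S y -> S z -> S \[y, z\]) -> A `<=` S -> S x].

Record superModule (C : numClosedFieldType) (g : lieSuperalgebra C) :=
  SuperModule {
  sm_car :> lmodType C;
  sm_part : bool -> set sm_car;
  sm_act : g -> sm_car -> sm_car;
  sm_gradedP : z2graded sm_part;
  sm_linearl : forall v, linear (fun x => sm_act x v);
  sm_linearr : forall x, linear (sm_act x);
  sm_act_part : forall a b x v, lsa_part a x -> sm_part b v ->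
    sm_part (a (+) b) (sm_act x v);
  sm_act_br : forall a b x y v, lsa_part a x -> lsa_part b y ->
    sm_act \[x, y\] v =
    sm_act x (sm_act y v) - (-1) ^+ (a && b) *: sm_act y (sm_act x v) }.

Definition irreducible (C : numClosedFieldType) (g : lieSuperalgebra C)
    (V : superModule g) :=
  (exists v : V, v <> 0) /\
  forall S : set V, graded_subspace (@sm_part C g V) S ->
    (forall x v, S v -> S (sm_act x v)) -> S = [set 0] \/ S = setT.

(* [io : H -> g] is a (linear injective) parametrisation of a Cartan
   subalgebra by a finite-dimensional space [H], so that weights live in the
   dual space 'Hom(H, C^o). *)
Section Weights.
Variables (C : numClosedFieldType) (g : lieSuperalgebra C).
Variables (H : vectType C) (io : H -> g).
Local Notation Hs := 'Hom(H, C^o).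

Definition root_space (alpha : Hs) : set g :=
  [set x | forall h, \[io h, x\] = (alpha h : C) *: x].

Definition roots_of_parity (b : bool) : set Hs :=
  [set alpha | alpha <> 0 /\
    exists x, [/\ x <> 0, lsa_part b x & root_space alpha x]].

Definition roots : set Hs :=
  [set alpha | alpha <> 0 /\ exists x, x <> 0 /\ root_space alpha x].

Definition weight_space (V : superModule g) (nu : Hs) : set V :=
  [set v | forall h, sm_act (io h) v = (nu h : C) *: v].

Definition is_base (S : set Hs) :=
  [/\ S `<=` roots,
      forall s : seq Hs, uniq s -> (forall alpha, alpha \in s -> S alpha) ->
        free s &
      forall alpha, roots alpha -> natcone S alpha \/ natcone S (- alpha)].

Definition positive_roots (S : set Hs) : set Hs := roots `&` natcone S.

(* [V] is the irreducible highest weight module L(lambda) (up to isomorphism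
   and parity change) for the base [S]. *)
Definition is_L (S : set Hs) (lambda : Hs) (V : superModule g) :=
  irreducible V /\
  exists v : V, [/\ v <> 0, exists b, sm_part b v,
    @weight_space V lambda v &
    forall alpha x, positive_roots S alpha -> root_space alpha x ->
      sm_act x v = 0].

Definition ch (V : superModule g) (nu : Hs) : nat := dimset (@weight_space V nu).

End Weights.

Section DualForm.
Variables (C : numClosedFieldType) (H : vectType C) (B : H -> H -> C).
Local Notation Hs := 'Hom(H, C^o).

(* The element of [H] representing [lambda] through the nondegenerate
   symmetric bilinear form [B], and the form induced on the dual. *)
Definition riesz (lambda : Hs) : H :=
  xget 0 [set u | forall h, B u h = lambda h].

Definition dform (lambda mu : Hs) : C := B (riesz lambda) (riesz mu).

Definition refl (alpha lambda : Hs) : Hs :=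
  lambda - (2 * dform lambda alpha / dform alpha alpha) *: alpha.

Definition is_rho (S : set Hs) (rho : Hs) :=
  forall alpha, S alpha -> 2 * dform rho alpha = dform alpha alpha.

Definition isometric (X Y : set Hs) :=
  exists f : 'Hom(Hs, Hs),
    [/\ forall u, Cspan X u -> Cspan Y (f u),
        forall u v, Cspan X u -> Cspan X v -> dform (f u) (f v) = dform u v &
        set_bij X Y f].

End DualForm.

(* Lie superalgebra with a Cartan subalgebra and a nondegenerate even
   supersymmetric invariant form. *)
Record quadLSA (C : numClosedFieldType) := QuadLSA {
  q_lsa :> lieSuperalgebra C;
  q_H : vectType C;
  q_io : q_H -> q_lsa;
  q_form : q_lsa -> q_lsa -> C;
  q_io_linear : linear q_io;
  q_io_inj : injective q_io;
  q_io_even : forall h, lsa_part false (q_io h);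
  q_cartan : forall x, (forall h, \[q_io h, x\] = 0) <-> exists h, x = q_io h;
  q_diag : forall x, exists (n : nat) (y : 'I_n -> q_lsa)
      (alpha : 'I_n -> 'Hom(q_H, C^o)),
    (forall i, root_space q_io (alpha i) (y i)) /\ x = \sum_i y i;
  q_form_linear : forall x, linear (q_form x : q_lsa -> C^o);
  q_form_even : forall b x y, lsa_part b x -> lsa_part (~~ b) y ->
    q_form x y = 0;
  q_form_sym : forall a x y, lsa_part a x -> lsa_part a y ->
    q_form x y = (-1) ^+ a * q_form y x;
  q_form_inv : forall x y z, q_form \[x, y\] z = q_form x \[y, z\];
  q_form_nondeg : forall x, (forall y, q_form x y = 0) -> x = 0 }.

Section Finite.
Variables (C : numClosedFieldType) (gd : quadLSA C).
Local Notation Hs := 'Hom(q_H gd, C^o).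

Definition q_hform (h h' : q_H gd) : C := q_form (q_io h) (q_io h').
Definition q_roots : set Hs := roots (@q_io C gd).
Definition q_sqlen (alpha : Hs) : C := dform q_hform alpha alpha.

(* [hv] is half an eigenvalue of the Casimir operator on the adjoint
   representation.  The eigenvalue is unique: for simple algebras the operator
   is scalar, and for gl(n|n) it is nilpotent. *)
Definition half_casimir (hv : C) :=
  exists (n : nat) (u u' : 'I_n -> gd),
    [/\ basis_of_set setT u,
        forall i j, q_form (u i) (u' j) = (i == j)%:R &
        exists x : gd, x <> 0 /\
          \sum_i \[u' i, \[u i, x\]\] = (2 * hv) *: x].

(* [tie] is the set of roots whose square length is prescribed to be 2 when
   half the Casimir eigenvalue vanishes. *)
Definition normalised (tie : set Hs) :=
  [/\ forall alpha, q_roots alpha -> q_sqlen alpha <= 2,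
      exists2 alpha, q_roots alpha & q_sqlen alpha = 2 &
      exists hv, [/\ half_casimir hv, 0 <= hv &
        hv = 0 -> forall alpha, tie alpha -> q_sqlen alpha = 2]].

Definition mx_part p q (b : bool) (M : 'M[C]_(p + q)) : Prop :=
  if b then ulsubmx M = 0 /\ drsubmx M = 0
  else ursubmx M = 0 /\ dlsubmx M = 0.

Definition strace p q (M : 'M[C]_(p + q)) : C :=
  \tr (ulsubmx M) - \tr (drsubmx M).

Definition sl_set p q : set 'M[C]_(p + q) := [set M | strace M = 0].

Definition osp_sym m : 'M[C]_(m + m) := block_mx 0 1%:M 1%:M 0.
Definition osp_skew n : 'M[C]_(n + n) := block_mx 0 1%:M (- 1%:M) 0.

(* Matrices M with (Mx,y) + (-1)^(|M||x|) (x,My) = 0 on homogeneous vectors,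
   for the form with Gram matrix diag(osp_sym m, osp_skew n), split into
   blocks. *)
Definition osp_set m n : set 'M[C]_((m + m) + (n + n)) :=
  [set M |
    [/\ (ulsubmx M)^T *m osp_sym m + osp_sym m *m ulsubmx M = 0,
        (drsubmx M)^T *m osp_skew n + osp_skew n *m drsubmx M = 0 &
        (ursubmx M)^T *m osp_sym m = osp_skew n *m dlsubmx M]].

(* [phi] identifies [gd] with the Lie superalgebra of matrices [X] (with the
   supercommutator), its Cartan subalgebra being the diagonal matrices. *)
Definition matrix_model p q (X : set 'M[C]_(p + q))
    (phi : gd -> 'M[C]_(p + q)) :=
  [/\ linear phi /\ injective phi,
      range phi = X,
      forall b x, lsa_part b x <-> mx_part b (phi x),
      forall a b x y, lsa_part a x -> lsa_part b y ->
        phi \[x, y\] = phi x *m phi y - (-1) ^+ (a && b) *: (phi y *m phi x) &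
      forall x, (exists h, x = q_io h) <-> is_diag_mx (phi x)].

(* Roots of the upper left block, i.e. the e_i - e_j for gl, and the roots of
   the factor D_m for osp(2m|2n). *)
Definition ul_roots p q (phi : gd -> 'M[C]_(p + q)) : set Hs :=
  [set alpha | q_roots alpha /\
    forall x, root_space (@q_io C gd) alpha x ->
      phi x = block_mx (ulsubmx (phi x)) 0 0 0].

(* The exceptional algebras F(4) and G(3) are the simple finite-dimensional
   Lie superalgebras, with a nondegenerate even invariant form, having the
   following root systems. *)
Definition is_F4 :=
  [/\ simple_lsa gd,
      exists (n : nat) (u : 'I_n -> gd), basis_of_set setT u &
      exists (e : 'I_3 -> Hs) (d : Hs),
      [/\ basis_of fullv [:: e 0; e 1; e 2%:R; d],
          roots_of_parity (@q_io C gd) false =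
            [set alpha |
              [\/ exists i j (a b : bool), i != j /\
                    alpha = (-1) ^+ a *: e i + (-1) ^+ b *: e j,
                  exists i (a : bool), alpha = (-1) ^+ a *: e i |
                  exists a : bool, alpha = (-1) ^+ a *: d]] &
          roots_of_parity (@q_io C gd) true =
            [set alpha | exists (a : 'I_3 -> bool) (b : bool),
              alpha =
                2^-1 *: (\sum_i (-1) ^+ a i *: e i + (-1) ^+ b *: d)]]].

Definition is_G3 :=
  [/\ simple_lsa gd,
      exists (n : nat) (u : 'I_n -> gd), basis_of_set setT u &
      exists (e : 'I_3 -> Hs) (d : Hs),
      [/\ \sum_i e i = 0 /\ basis_of fullv [:: e 0; e 1; d],
          roots_of_parity (@q_io C gd) false =
            [set alpha |
              [\/ exists i j, i != j /\ alpha = e i - e j,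
                  exists i (a : bool), alpha = (-1) ^+ a *: e i |
                  exists a : bool, alpha = (-1) ^+ a *: (2 *: d)]] &
          roots_of_parity (@q_io C gd) true =
            [set alpha |
              (exists i (a b : bool),
                alpha = (-1) ^+ a *: e i + (-1) ^+ b *: d) \/
              (exists a : bool, alpha = (-1) ^+ a *: d)]]].

(* [gd] is one of the listed finite-dimensional superalgebras with its
   normalised form.  For s <> 0 the degree s part of the loop algebra is
   (D / N) t^s; D and N are everything and 0, except for gl(n|n), where they
   are sl(n|n) and the scalar matrices. *)
Inductive nontwisted : set gd -> set gd -> Prop :=
| NonTwistedA m n (phi : gd -> 'M[C]_(m.+1 + n.+1)) of (n < m)%N &
    matrix_model (sl_set (p := m.+1) (q := n.+1)) phi &
    normalised (ul_roots phi) : nontwisted setT [set 0]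
| NonTwistedAA n (phi : gd -> 'M[C]_(n.+1 + n.+1)) (c : C) of (0 < n)%N &
    matrix_model setT phi &
    (forall x y, q_form x y = c * strace (phi x *m phi y)) &
    normalised (ul_roots phi) :
    nontwisted [set x | sl_set (phi x)] [set x | is_scalar_mx (phi x)]
| NonTwistedD m n (phi : gd -> 'M[C]_((m + m) + (n + n))) of
    (0 < m)%N & (0 < n)%N & (m, n) <> (2, 1)%N &
    matrix_model (osp_set (m := m) (n := n)) phi &
    normalised (ul_roots phi) : nontwisted setT [set 0]
| NonTwistedF4 of is_F4 & normalised set0 : nontwisted setT [set 0]
| NonTwistedG3 of is_G3 & normalised set0 : nontwisted setT [set 0].

End Finite.

Definition loop_dom (C : numClosedFieldType) (gd : quadLSA C) (D : set gd)
    (j : int) : set gd := if j == 0 then setT else D.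
Definition loop_ker (C : numClosedFieldType) (gd : quadLSA C) (N : set gd)
    (j : int) : set gd := if j == 0 then [set 0] else N.

(* Identification of [g] with the affinisation
   gd + sum_(j <> 0) (D / N) t^j + C K + C d, where [af_t j a] is a t^j (it is
   only meaningful for [a] in [loop_dom D j]). *)
Record affinisation (C : numClosedFieldType) (gd : quadLSA C) (D N : set gd)
    (g : lieSuperalgebra C) := Affinisation {
  af_t : int -> gd -> g;
  af_K : g;
  af_d : g;
  af_linear : forall j (c : C) a b, loop_dom D j a -> loop_dom D j b ->
    af_t j (c *: a + b) = c *: af_t j a + af_t j b;
  af_part : forall j b a, loop_dom D j a -> lsa_part b a ->
    lsa_part b (af_t j a);
  af_K_even : lsa_part false af_K;
  af_d_even : lsa_part false af_d;
  af_span : forall x, exists (s : seq int) (a : int -> gd) (c b : C),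
    (forall j, loop_dom D j (a j)) /\
    x = \sum_(j <- s) af_t j (a j) + c *: af_K + b *: af_d;
  af_free : forall (s : seq int) (a : int -> gd) (c b : C),
    uniq s -> (forall j, loop_dom D j (a j)) ->
    \sum_(j <- s) af_t j (a j) + c *: af_K + b *: af_d = 0 <->
    [/\ c = 0, b = 0 & forall j, j \in s -> loop_ker N j (a j)];
  af_br : forall i j a b, loop_dom D i a -> loop_dom D j b ->
    \[af_t i a, af_t j b\] =
    af_t (i + j) \[a, b\] +
    (if i + j == 0 then i%:~R * q_form a b else 0) *: af_K;
  af_br_K : forall x, \[af_K, x\] = 0;
  af_br_d : forall j a, loop_dom D j a ->
    \[af_d, af_t j a\] = j%:~R *: af_t j a }.

Section Affine.
Variables (C : numClosedFieldType) (gd : quadLSA C) (D N : set gd).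
Variables (g : lieSuperalgebra C) (af : affinisation D N g).

(* The triple (h, c, b) stands for h + c K + b d. *)
Definition aff_H : vectType C := (q_H gd * C^o * C^o)%type.
Local Notation Hs := 'Hom(aff_H, C^o).

Definition aff_io (h : aff_H) : g :=
  af_t af 0 (q_io h.1.1) + (h.1.2 : C) *: af_K af + (h.2 : C) *: af_d af.

Definition aff_hform (h h' : aff_H) : C :=
  q_hform h.1.1 h'.1.1 + (h.1.2 * h'.2 + h.2 * h'.1.2).

Local Notation form := (dform aff_hform).
Local Notation s_ := (refl aff_hform).

Definition aff_roots : set Hs := roots aff_io.
Definition even_roots : set Hs := roots_of_parity aff_io false.

Definition delta : Hs := linfun (fun h : aff_H => h.2).

Definition ext_weight (alpha : 'Hom(q_H gd, C^o)) : Hs :=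
  linfun (fun h : aff_H => alpha h.1.1).

Lemma deltaE h : delta h = h.2.
Proof.
pose f (h : aff_H) : C^o := h.2.
have lin_f : linear f by [].
pose F := GRing.isLinear.Build _ _ _ _ f lin_f.
pose fL : {linear aff_H -> C^o} := HB.pack f F.
exact: (lfunE fL h).
Qed.

Lemma ext_weightE alpha h : ext_weight alpha h = alpha h.1.1.
Proof.
pose f (h : aff_H) : C^o := alpha h.1.1.
have lin_f : linear f by move=> a u v; rewrite /f linearP.
pose F := GRing.isLinear.Build _ _ _ _ f lin_f.
pose fL : {linear aff_H -> C^o} := HB.pack f F.
exact: (lfunE fL h).
Qed.

Definition is_Lambda0 (L0 : Hs) :=
  [/\ form L0 delta = 1,
      forall alpha, q_roots alpha -> form L0 (ext_weight alpha) = 0 &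
      form L0 L0 = 0].

Definition odd_reflexion (beta : Hs) (S : set Hs) : set Hs :=
  [set gamma |
    [\/ gamma = - beta,
        exists alpha, [/\ S alpha, alpha <> beta, form alpha beta <> 0 &
          gamma = alpha + beta] |
        [/\ S gamma, gamma <> beta & form gamma beta = 0]]].

Section Base.
Variable S : set Hs.

Inductive Sp : set Hs -> Prop :=
| Sp_base : Sp S
| Sp_step S1 beta of Sp S1 & S1 beta & form beta beta = 0 :
    Sp (odd_reflexion beta S1).

Definition principal_roots : set Hs :=
  [set alpha | even_roots alpha /\
    exists S1, Sp S1 /\ (S1 alpha \/ S1 (2^-1 *: alpha))].

Inductive weyl : (Hs -> Hs) -> Prop :=
| weyl_id : weyl id
| weyl_refl alpha w of principal_roots alpha & weyl w : weyl (s_ alpha \o w).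

Definition re_bar : set Hs :=
  [set gamma | exists w S1 alpha,
    [/\ weyl w, Sp S1, S1 alpha & gamma = w alpha]].

Definition real_roots : set Hs :=
  [set gamma | aff_roots gamma /\ (re_bar gamma \/ re_bar (2^-1 *: gamma))].

Definition R_bar (mu : Hs) : set Hs :=
  [set alpha | re_bar alpha /\ exists j : int,
    2 * form mu alpha = j%:~R * form alpha alpha /\
    (aff_roots (2 *: alpha) -> ~~ (2 %| j)%Z)].

Definition real_closed_set (mu : Hs) (X : set Hs) :=
  [/\ X `<=` real_roots /\ R_bar mu `<=` X,
      forall alpha beta, X alpha -> X beta -> form alpha alpha <> 0 ->
        X (s_ alpha beta),
      forall alpha beta, X alpha -> X beta -> form alpha alpha = 0 ->
        form alpha beta <> 0 ->
        X `&` [set alpha + beta; alpha - beta] =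
        real_roots `&` [set alpha + beta; alpha - beta] &
      forall alpha, X alpha -> real_roots (2 *: alpha) -> X (2 *: alpha)].

(* The conditions above are stable under intersection, so this is the smallest
   set satisfying them. *)
Definition Delta_ (mu : Hs) : set Hs :=
  [set alpha | forall X, real_closed_set mu X -> X alpha].

Definition pi_sharp : set Hs :=
  [set alpha | principal_roots alpha /\ 0 < form alpha alpha].

Definition Delta_sharp : set Hs :=
  [set alpha | even_roots alpha /\ 0 < form alpha alpha].

Definition g_sharp : set g :=
  gen_subalgebra [set x | (exists h, x = aff_io h) \/
    exists2 alpha, pi_sharp alpha &
      root_space aff_io alpha x \/ root_space aff_io (- alpha) x].

Definition mult_sharp (alpha : Hs) : nat :=
  dimset (g_sharp `&` root_space aff_io alpha).

Definition positive_roots_sharp : set Hs :=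
  [set alpha | positive_roots aff_io S alpha /\
    exists x, [/\ x <> 0, g_sharp x & root_space aff_io alpha x]].

(* Coefficient of e^nu in the (infinite) product of the
   (1 - e^(-alpha))^(mult_sharp alpha) = sum_j (-1)^j C(mult, j) e^(-j alpha):
   the sum runs over the choices f of an exponent j = f alpha for each alpha,
   almost all zero, and is finite. *)
Definition weyl_denominator (nu : Hs) : int :=
  \sum_(f \in [set f : {fsfun Hs -> nat with 0%N} |
      (forall alpha, alpha \in finsupp f -> positive_roots_sharp alpha) /\
      nu = - (\sum_(alpha <- finsupp f) alpha *+ f alpha)])
    \prod_(alpha <- finsupp f)
      ((-1) ^+ f alpha * ('C(mult_sharp alpha, f alpha))%:Z).

(* Coefficient of e^nu in D e^rhos ch V; the sum has finite support. *)
Definition denominator_ch (rhos : Hs) (V : superModule g) (nu : Hs) : int :=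
  \sum_(mu \in [set: Hs])
    weyl_denominator mu * (ch aff_io V (nu - rhos - mu))%:Z.

Variables (rho rhos : Hs).

Definition admissible (lambda : Hs) :=
  [/\ form (lambda + rho) delta <> 0,
      Qspan (Delta_ (lambda + rho) `&` Delta_sharp) = Qspan Delta_sharp &
      exists V : superModule g, is_L aff_io S lambda V /\
        forall alpha, (Delta_ (lambda + rho) `&` Delta_sharp) alpha ->
          forall nu, denominator_ch rhos V (s_ alpha nu) =
                     - denominator_ch rhos V nu].

Definition admissible_level (L0 : Hs) (k : C) := admissible (k *: L0).

Definition principal_admissible_level (L0 : Hs) (k : C) :=
  admissible_level L0 k /\
  isometric aff_hform (Delta_ (k *: L0 + rho)) real_roots.

End Base.
End Affine.

(* Main.v *)
(* If [gamma] is a root of the finite algebra and [m] an integer, then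
   [gamma + m delta] is a real root: odd reflections followed by even simple
   reflections reach every finite root, and the affine simple root
   [delta - theta] adds the reflections in [delta - a] for the long roots [a].
   Conversely a real root has this form.  For [mu = k Lambda_0 + rho] the finite
   simple roots lie in [R_mu], hence [Delta_mu] contains the finite root system.
   Let [T(gamma)] be the set of [m] such that [gamma + m delta] is in [Delta_mu].
   It does not change under adding an isotropic root nor under reflections, hence
   is the same for all [gamma], and is a subgroup [p Z].  As [delta] is a rational
   combination of [Delta_mu], [p] is not [0], and multiplying [delta] by [1 / p]
   gives the isometry.  The finite root systems enter only through the list of
   properties [supersystem], which is checked on integral models. *)
Require Import Defs.
From HB Require Import structures.
From mathcomp Require Import all_boot all_order all_algebra.
From mathcomp Require Import boolp classical_sets functions reals complex.
From mathcomp Require Import zify ring lra.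
Set Implicit Arguments.
Unset Strict Implicit.
Unset Printing Implicit Defensive.
Import Order.TTheory GRing.Theory Num.Theory.
Local Open Scope classical_set_scope.
Local Open Scope ring_scope.

(** * Supersystems and their bases *)

(** Odd reflections generate no group acting on the weights, so bases are compared by an induction
    along chains. Given a functional, reflect in a simple root on which it is negative, changing the
    base if that root is isotropic and the functional otherwise, until the functional is nonnegative
    on the base. Started from minus the height, the chain meets every positive root; started from
    the coroot functional of a long root, it makes that root dominant. To recognise it then as the
    root subtracted from [delta] in the affine simple root, bases carry the uniqueness of the
    locally highest root, which both kinds of reflections preserve. That real roots have no other
    form needs more: an odd reflection of an affine base must never produce an imaginary root. This
    is why positive affine roots are split with the imaginary roots included. The form on the roots
    is not prescribed by the models. It is forced up to a scalar: two roots are orthogonal if their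
    sum and difference are neither roots nor zero, and an odd root is isotropic if its double is not
    an even root. For D(2|1) this fails, since its root set carries a family of forms with a
    parameter. *)

Section Base.
Variables (R : numDomainType) (V : zmodType) (f : V -> V -> R) (D : set V).
Variable N : nat.
Implicit Types (b : 'I_N -> V) (x y z : V).

Definition lin_indep b :=
  forall k : 'I_N -> int, \sum_i b i *~ k i = 0 -> forall i, k i = 0.

Definition Pos b x := exists k : 'I_N -> nat, x = \sum_i b i *+ k i.

(** [D] omits the zero weight of the adjoint representation, hence the clause [x + b j <> 0]: no
    [x + b j] is a weight. *)
Definition locally_highest b x :=
  D x /\ forall j, ~ D (x + b j) /\ x + b j <> 0.

(** The decomposition clause lets positivity for another base be proved by induction on the
    height. *)
Definition root_base b :=
  [/\ lin_indep b, forall i, D (b i),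
      forall x, D x -> Pos b x \/ Pos b (- x) &
      forall x, D x -> Pos b x -> (exists i, x = b i) \/
        exists y z, [/\ D y, D z, Pos b y, Pos b z & x = y + z]].

(** Uniqueness plays the part of irreducibility: it identifies a dominant long root with the root
    [th] in the affine simple root [delta - th]. *)
Definition good_base b := root_base b /\
  forall x y, locally_highest b x -> locally_highest b y -> x = y.

Definition odd_refl b i : 'I_N -> V :=
  fun j => if j == i then - b i
           else if f (b j) (b i) == 0 then b j else b j + b i.

End Base.

Section Supersystem.
Variables (R : numDomainType) (V : zmodType) (f : V -> V -> R) (D : set V).

(** Length is no guide for an indefinite form, so long roots are described by Cartan integers: apart
    from [a] and [- a], every root has integer -1, 0 or 1 against [a]. *)
Definition long_root (a : V) :=
  [/\ D a, f a a <> 0 & forall x, D x -> [\/ x = a, x = - a |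
    exists2 c : int, -1 <= c <= 1 & 2 * f x a = c%:~R * f a a]].

(* What is needed of a finite root system [D] with its form [f]; [b] stands for
   an isotropic root.  [ss_conn] makes every invariant attached to the roots
   constant, and [ss_long] provides the affine reflections in [delta - a]. *)
Record supersystem : Prop := Supersystem {
  ss_fin : exists s : seq V, forall x, D x -> x \in s;
  ss_opp : forall x, D x -> D (- x);
  ss_neq0 : forall x, D x -> x <> 0;
  ss_mul : forall x n, (1 < n)%N -> D x -> D (x *+ n) -> n = 2%N /\ f x x <> 0;
  ss_refl : forall a x, D a -> f a a <> 0 -> D x ->
    exists2 c : int, 2 * f x a = c%:~R * f a a & D (x - a *~ c);
  ss_nonorth : forall b, D b -> f b b = 0 -> exists2 x, D x & f x b <> 0;
  ss_iso : forall b x, D b -> f b b = 0 -> D x -> f x b <> 0 ->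
    D (x + b) \/ D (x - b);
  ss_iso_orth : forall b x, D b -> f b b = 0 -> D x -> D (x + b) -> f x b <> 0;
  ss_iso_string : forall b x, D b -> f b b = 0 -> D x -> D (x + b) ->
    ~ D (x + b + b);
  ss_iso_split : forall b x y, D b -> f b b = 0 -> D x -> D y -> D (x + y) ->
    D (x + y + b) ->
    (D (x + b) \/ x + b = 0) \/ (D (y + b) \/ y + b = 0);
  ss_long : forall x, D x -> long_root x \/
    exists2 a, long_root a & 2 * f x a = f a a \/ 2 * f x a = - f a a;
  ss_conn : forall T : V -> Prop,
    (forall x b, D x -> D b -> f b b = 0 -> D (x + b) -> T x -> T (x + b)) ->
    (forall x a c, D x -> D a -> f a a <> 0 -> 2 * f x a = c%:~R * f a a ->
      T x -> T (x - a *~ c)) ->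
    forall x y, D x -> D y -> T x -> T y;
  ss_exists_iso : exists2 b, D b & f b b = 0;
  ss_std : exists N (b : 'I_N -> V), good_base D b }.

End Supersystem.

Section PosTheory.
Variables (V : zmodType) (N : nat) (b : 'I_N -> V).
Implicit Types x y : V.

Lemma sum_mulz (k : 'I_N -> nat) :
  \sum_i b i *+ k i = \sum_i b i *~ (k i)%:Z.
Proof. by apply: eq_bigr => i _; rewrite -pmulrn. Qed.

Lemma PosD x y : Pos b x -> Pos b y -> Pos b (x + y).
Proof.
move=> [k ->] [l ->]; exists (fun i => (k i + l i)%N).
by rewrite -big_split; apply: eq_bigr => i _; rewrite mulrnDr.
Qed.

Lemma Pos0 : Pos b 0.
Proof. by exists (fun=> 0%N); rewrite big1. Qed.

Lemma Pos_base i : Pos b (b i).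
Proof.
exists (fun j => (j == i) : nat).
by rewrite (bigD1 i) //= eqxx big1 ?addr0 // => j /negbTE ->.
Qed.

Hypothesis fb : lin_indep b.

Lemma lin_indep_inj (k l : 'I_N -> int) :
  \sum_i b i *~ k i = \sum_i b i *~ l i -> k =1 l.
Proof.
move=> /eqP; rewrite -subr_eq0 -sumrB => /eqP E i.
apply/eqP; rewrite -subr_eq0; apply/eqP.
apply: (fb (k := fun i => k i - l i)); rewrite -[RHS]E.
by apply: eq_bigr => j _; rewrite mulrzBr.
Qed.

Lemma lin_indep_inj_nat (k l : 'I_N -> nat) :
  \sum_i b i *+ k i = \sum_i b i *+ l i -> k =1 l.
Proof.
by rewrite !sum_mulz => /lin_indep_inj E i; have [] := E i.
Qed.

Lemma Pos_anti x : Pos b x -> Pos b (- x) -> x = 0.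
Proof.
move=> [k ->] [l E].
have E0 : \sum_i b i *+ (k i + l i) = \sum_i b i *+ 0.
  under eq_bigr do rewrite mulrnDr.
  by rewrite big_split /= -E subrr big1.
have H := lin_indep_inj_nat (l := fun=> 0%N) E0.
by rewrite big1 // => i _; have := H i; case: (k i).
Qed.

Lemma base_inj : injective b.
Proof.
move=> i j E; have := @lin_indep_inj_nat (fun l => (l == i) : nat)
  (fun l => (l == j) : nat).
rewrite (bigD1 i) //= eqxx big1 ?addr0 => [|l /negbTE -> //].
rewrite (bigD1 j) //= eqxx [X in _ = _ + X]big1 ?addr0 => [|l /negbTE -> //].
by move=> /(_ E) /(_ i); rewrite eqxx; case: eqP.
Qed.

Lemma base_diff i j : i != j -> Pos b (b i - b j) -> False.
Proof.
move=> ij [k E]; have := @lin_indep_inj_nat (fun l => (l == i) : nat)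
  (fun l => (k l + (l == j))%N).
rewrite (bigD1 i) //= eqxx big1 ?addr0 => [|l /negbTE -> //].
under eq_bigr do rewrite mulrnDr.
rewrite big_split /= -E [X in _ = _ + X](bigD1 j) //= eqxx.
rewrite [X in _ = _ + (_ + X)]big1 => [|l /negbTE -> //].
rewrite addr0 subrK => /(_ erefl) /(_ j).
by rewrite eqxx eq_sym (negbTE ij); lia.
Qed.

Lemma base_neq0 i : b i <> 0.
Proof.
move=> E; have := fb (k := fun j => ((j == i) : nat)%:Z).
rewrite (bigD1 i) //= eqxx E mul0rz big1 ?addr0.
  by move=> /(_ erefl) /(_ i); rewrite eqxx.
by move=> j /negbTE ->.
Qed.

End PosTheory.

Section Reflections.
Variables (C : numFieldType) (V : lmodType C) (f : V -> V -> C) (D : set V).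
Hypothesis f_linear : forall y, linear (f^~ y : V -> C^o).
Hypothesis f_sym : forall x y, f x y = f y x.
Hypothesis ssD : supersystem f D.
Variable N : nat.
Implicit Types (b : 'I_N -> V) (x y z : V).

Lemma fDl x y z : f (x + y) z = f x z + f y z.
Proof. by have := f_linear z 1 x y; rewrite !scale1r. Qed.
Lemma f0l z : f 0 z = 0.
Proof. by apply: (addrI (f 0 z)); rewrite -fDl !addr0. Qed.
Lemma fZl a x z : f (a *: x) z = a * f x z.
Proof. by have := f_linear z a x 0; rewrite !addr0 f0l addr0. Qed.
Lemma fNl x z : f (- x) z = - f x z.
Proof. by rewrite -scaleN1r fZl mulN1r. Qed.

Lemma fDr x y z : f z (x + y) = f z x + f z y.
Proof. by rewrite f_sym fDl !(f_sym z). Qed.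
Lemma fZr a x z : f z (a *: x) = a * f z x.
Proof. by rewrite f_sym fZl (f_sym z). Qed.
Lemma fNr x z : f z (- x) = - f z x.
Proof. by rewrite f_sym fNl (f_sym z). Qed.

Definition fE := (fDl, fDr, fNl, fNr, fZl, fZr).

Definition sref a x := x - (2 * f x a / f a a) *: a.

Lemma srefD a x y : sref a (x + y) = sref a x + sref a y.
Proof.
by rewrite /sref fDl mulrDr mulrDl scalerDl opprD addrACA.
Qed.
Lemma srefZ a c x : sref a (c *: x) = c *: sref a x.
Proof. by rewrite /sref fZl scalerBr scalerA mulrCA !mulrA. Qed.
Lemma srefN a x : sref a (- x) = - sref a x.
Proof. by rewrite -!scaleN1r srefZ. Qed.
Lemma sref0 a : sref a 0 = 0.
Proof. by rewrite -[0](scale0r 0) srefZ !scale0r. Qed.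
Lemma srefMn a x n : sref a (x *+ n) = sref a x *+ n.
Proof. by rewrite -!scaler_nat srefZ. Qed.
Lemma sref_sum a I (r : seq I) (F : I -> V) :
  sref a (\sum_(i <- r) F i) = \sum_(i <- r) sref a (F i).
Proof. by apply: (big_morph (sref a)) => [x y|]; rewrite ?srefD ?sref0. Qed.

Section OneReflection.
Variable a : V.
Hypothesis a0 : f a a <> 0.

Lemma sref_id : sref a a = - a.
Proof.
by rewrite /sref mulfK; [rewrite scaler_nat mulr2n opprD addNKr|apply/eqP].
Qed.

Lemma srefK : involutive (sref a).
Proof.
by move=> x; rewrite {2}/sref srefD srefN srefZ sref_id scalerN opprK subrK.
Qed.

Lemma f_sref x y : f (sref a x) (sref a y) = f x y.
Proof.
rewrite /sref !fE (f_sym a y) !mulrA; field; exact/eqP.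
Qed.

Lemma sref_conj x y : sref (sref a x) y = sref a (sref x (sref a y)).
Proof.
have -> : sref x (sref a y) = sref a y - (2 * f (sref a y) x / f x x) *: x by [].
rewrite srefD srefN srefZ srefK {1}/sref f_sref.
by rewrite -{2}[y]srefK f_sref.
Qed.

Lemma D_sref x : D a -> D x -> D (sref a x).
Proof.
move=> Da Dx; have [c E H] := ss_refl ssD Da a0 Dx.
by rewrite /sref E mulfK ?scaler_int //; apply/eqP.
Qed.

End OneReflection.
End Reflections.

(** * Odd reflections of bases *)

Section OddReflection.
Variables (C : numFieldType) (V : lmodType C) (f : V -> V -> C) (D : set V).
Hypothesis f_linear : forall y, linear (f^~ y : V -> C^o).
Hypothesis f_sym : forall x y, f x y = f y x.
Variables (N : nat) (b : 'I_N -> V) (i : 'I_N).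

(* In the last case both summands avoid [b i], the only positive root that
   turns negative under the odd reflection. *)
Definition odd_split := forall x, D x -> Pos b x -> x <> b i ->
  [\/ exists2 j, j != i & x = b j,
      exists2 j, f (b j) (b i) <> 0 & x = b j + b i |
      exists y z, [/\ D y, D z, Pos b y /\ Pos b z, x = y + z
                    & y <> b i /\ z <> b i]].

Hypothesis gb : root_base D b.
Hypothesis iso : f (b i) (b i) = 0.
Local Notation fE := (fE f_linear f_sym).
Local Notation b' := (odd_refl f b i).

Let fb : lin_indep b. Proof. by case: gb. Qed.
Let Db j : D (b j). Proof. by case: gb. Qed.

Lemma odd_refl_i : b' i = - b i.
Proof. by rewrite /odd_refl eqxx. Qed.

Lemma odd_refl_orth j : j != i -> f (b j) (b i) = 0 -> b' j = b j.
Proof. by rewrite /odd_refl => /negbTE -> ->; rewrite eqxx. Qed.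

Lemma odd_refl_nonorth j : f (b j) (b i) <> 0 -> b' j = b j + b i.
Proof.
rewrite /odd_refl => H; case: eqP => [E|_]; first by rewrite E iso in H.
by case: eqP.
Qed.

Lemma f_odd_refl j : f (b' j) (b i) = f (b j) (b i).
Proof.
rewrite /odd_refl; case: eqP => [->|_]; first by rewrite fE iso oppr0.
by case: eqP => // _; rewrite fE iso addr0.
Qed.

Lemma odd_reflK : odd_refl f b' i = b.
Proof.
apply: funext => j; rewrite {1}/odd_refl; case: eqP => [->|/eqP ji].
  by rewrite odd_refl_i opprK.
rewrite odd_refl_i fE f_odd_refl oppr_eq0; case: eqP => [E|E].
  exact: odd_refl_orth.
by rewrite odd_refl_nonorth // addrK.
Qed.

Lemma lin_indep_odd_refl : lin_indep b'.
Proof.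
move=> k E.
(* Each [b' j] with [b j] not orthogonal to [b i] contributes its coefficient to [b i]; these
   contributions add up to [s]. *)
pose s := \sum_(j | f (b j) (b i) != 0) k j.
have : \sum_j b j *~ (if j == i then s - k i else k j) = 0.
  rewrite -[RHS]E (bigD1 i) //= eqxx [RHS](bigD1 i) //= odd_refl_i.
  suff -> : \sum_(j | j != i) b' j *~ k j =
     b i *~ s + \sum_(j | j != i) b j *~ (if j == i then s - k i else k j).
    by rewrite mulNrz mulrzBr addrA [- _ + _]addrC.
  have -> : \sum_(j | j != i) b' j *~ k j =
     \sum_(j | j != i) (b j *~ k j + b i *~ (if f (b j) (b i) != 0 then k j else 0)).
    apply: eq_bigr => j ji; rewrite /odd_refl (negbTE ji).
    by case: eqP => _ /=; rewrite ?mulr0z ?addr0 // mulrzDl.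
  rewrite big_split /= addrC; congr (_ + _).
    rewrite /s (raddf_sum (intmul (b i))) /= [in RHS]big_mkcond [in LHS]big_mkcond /=.
    apply: eq_bigr => j _; case: eqP => [->|_] /=; first by rewrite iso eqxx.
    by case: eqP; rewrite //= mulr0z.
  by apply: eq_bigr => j /negbTE ->.
move=> /fb H.
have Hj j : j != i -> k j = 0 by move=> ji; have := H j; rewrite (negbTE ji).
move=> j; have [->|/Hj//] := eqVneq j i.
have := H i; rewrite eqxx /s big1 ?sub0r => [/eqP|l fl]; first by rewrite oppr_eq0 => /eqP.
by apply: Hj; apply: contra fl => /eqP ->; rewrite iso.
Qed.

Hypothesis D0 : forall x, D x -> x <> 0.
Hypothesis DN : forall x, D x -> D (- x).
Hypothesis D_add : forall j, f (b j) (b i) <> 0 -> D (b j + b i).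
Hypothesis split_i : odd_split.

(** Induction on the height for [b], starting from the simple roots and the sums [b j + b i]. *)
Lemma Pos_odd_refl x : D x -> Pos b x -> x <> b i -> Pos b' x.
Proof.
move=> Dx Px; move: Px (Px) Dx => [k Ek].
have [n] := ubnP (\sum_j k j)%N.
elim: n => // n IH in x k Ek *; rewrite ltnS => kn Px Dx xi.
have Pi : Pos b' (b' i) by exact: Pos_base.
case: (split_i Dx Px xi) => [[j ji ->]|[j fj ->]|].
- have [fj|fj] := EM (f (b j) (b i) = 0).
    by rewrite -(odd_refl_orth ji fj); exact: Pos_base.
  rewrite -[b j](addrK (b i)) -odd_refl_i -(odd_refl_nonorth fj).
  by apply: PosD => //; exact: Pos_base.
- by rewrite -(odd_refl_nonorth fj); exact: Pos_base.
move=> [y [z [Dy Dz [Py Pz] E [yi zi]]]].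
move: (Py) (Pz) => [l El] [m Em].
(* Roots have positive height, so both summands are lower than [x]. *)
have ht (l' : 'I_N -> nat) y' : D y' -> y' = \sum_j b j *+ l' j ->
    (0 < \sum_j l' j)%N.
  move=> Dy' El'; rewrite lt0n; apply/negP => /eqP s0; apply: (D0 Dy').
  rewrite El' big1 // => j _.
  by move: s0 => /eqP; rewrite sum_nat_eq0 => /forallP/(_ j)/eqP ->.
have kE : (\sum_j k j = \sum_j l j + \sum_j m j)%N.
  rewrite -big_split /=; apply: eq_bigr => j _.
  apply: (lin_indep_inj_nat fb (l := fun j => (l j + m j)%N)).
  by under [RHS]eq_bigr do rewrite mulrnDr; rewrite big_split /= -El -Em -Ek.
have := ht _ _ Dy El; have := ht _ _ Dz Em => mp lp.
rewrite E; apply: PosD.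
- by apply: (IH y l) => //; lia.
- by apply: (IH z m) => //; lia.
Qed.

Lemma D_odd_refl j : D (b' j).
Proof.
rewrite /odd_refl; case: (j =P i) => [_|_]; first exact: DN.
by case: eqP => // /D_add.
Qed.

(** [D] need not be a supersystem here: the result serves the finite roots and also the infinite set
    of affine roots, imaginary ones included. *)
Lemma root_base_odd_refl : root_base D b'.
Proof.
have [_ _ cov dec] := gb.
have fb' := lin_indep_odd_refl.
have Ei : b' i = - b i by exact: odd_refl_i.
have dec' x : D x -> Pos b' x -> (exists j, x = b' j) \/
    exists y z, [/\ D y, D z, Pos b' y, Pos b' z & x = y + z].
  move=> Dx P'x; have [xi|xi] := EM (x = - b i); first by left; exists i; rewrite Ei.
  have Pi : Pos b' (- b i) by rewrite -Ei; exact: Pos_base.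
  have Px : Pos b x.
    case: (cov _ Dx) => // PNx; case: (D0 Dx); apply: (Pos_anti fb' P'x).
    apply: Pos_odd_refl => //; first exact: DN.
    by move=> E; apply: xi; rewrite -E opprK.
  have xi' : x <> b i.
    by move=> E; apply: (D0 Dx); apply: (Pos_anti fb' P'x); rewrite E.
  case: (split_i Dx Px xi') => [[j ji Ej]|[j fj Ej]|].
  - have [fj|fj] := EM (f (b j) (b i) = 0).
      by left; exists j; rewrite odd_refl_orth.
    right; exists (b' j), (b' i); split; try exact: Pos_base; try exact: D_odd_refl.
    by rewrite Ei odd_refl_nonorth // addrK.
  - by left; exists j; rewrite odd_refl_nonorth.
  move=> [y [z [Dy Dz [Py Pz] E [yi zi]]]].
  by right; exists y, z; split => //; apply: Pos_odd_refl.
split=> // [|x Dx]; first exact: D_odd_refl.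
have Pi : Pos b' (- b i) by rewrite -Ei; exact: Pos_base.
case: (cov _ Dx) => P.
  have [xi|xi] := EM (x = b i); first by right; rewrite xi.
  by left; exact: Pos_odd_refl.
have [xi|xi] := EM (- x = b i); first by left; rewrite -[x]opprK xi.
by right; apply: Pos_odd_refl => //; exact: DN.
Qed.

End OddReflection.

Section OddReflectionSupersystem.
Variables (C : numFieldType) (V : lmodType C) (f : V -> V -> C) (D : set V).
Hypothesis f_linear : forall y, linear (f^~ y : V -> C^o).
Hypothesis f_sym : forall x y, f x y = f y x.
Hypothesis ssD : supersystem f D.
Variables (N : nat) (b : 'I_N -> V) (i : 'I_N).
Hypothesis gb : root_base D b.
Hypothesis iso : f (b i) (b i) = 0.
Local Notation fE := (fE f_linear f_sym).
Local Notation b' := (odd_refl f b i).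

Let fb : lin_indep b. Proof. by case: gb. Qed.
Let Db j : D (b j). Proof. by case: gb. Qed.
Let D0 x : D x -> x <> 0. Proof. exact: (ss_neq0 ssD). Qed.
Let DN x : D x -> D (- x). Proof. exact: (ss_opp ssD). Qed.

Let notDdiff j k : j != k -> ~ D (b j - b k).
Proof.
move=> jk Djk; have [_ _ cov _] := gb.
case: (cov _ Djk) => [/(base_diff fb jk)//|]; rewrite opprB.
by apply: (base_diff fb); rewrite eq_sym.
Qed.

(** A difference of distinct simple roots is never a root, so [ss_iso] leaves only the sum. *)
Lemma supersystem_add j : f (b j) (b i) <> 0 -> D (b j + b i).
Proof.
move=> fj; have [//|] := ss_iso ssD (Db i) iso (Db j) fj.
case: (eqVneq j i) => [ji|ji /(notDdiff ji) //]; by rewrite ji iso in fj.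
Qed.

(** Only [x = y + b i] needs work. If [y] is not simple, write [y = u + v]; then [ss_iso_split]
    absorbs [b i] into one summand, and [ss_iso_string] prevents the other from being [b i]. *)
Lemma Pos_odd_split : odd_split f D b i.
Proof.
move=> x.
have [_ _ cov dec] := gb.
have key y : D x -> D y -> Pos b y -> y <> b i -> x = y + b i ->
  (exists2 j, f (b j) (b i) <> 0 & x = b j + b i) \/
  exists u v, [/\ D u, D v, Pos b u /\ Pos b v, x = u + v & u <> b i /\ v <> b i].
  move=> Dx Dy Py yi E; have Dyb : D (y + b i) by rewrite -E.
  have fy := ss_iso_orth ssD (Db i) iso Dy Dyb.
  case: (dec _ Dy Py) => [[j Ej]|[u [v [Du Dv Pu Pv Ey]]]].
    by left; exists j; rewrite -Ej.
  have aux u' v' : D u' -> D v' -> Pos b u' -> Pos b v' -> y = u' + v' ->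
      D (u' + b i) \/ u' + b i = 0 -> exists u v,
      [/\ D u, D v, Pos b u /\ Pos b v, x = u + v & u <> b i /\ v <> b i].
    move: u' v' => {Du Dv Pu Pv Ey}u {}v Du Dv Pu Pv Ey [Du'|u0]; last first.
      have [] := D0 Du; apply: (Pos_anti fb Pu).
      suff -> : - u = b i by exact: Pos_base.
      by rewrite -[LHS]addr0 -u0 addKr.
    exists (u + b i), v; split => //.
    - by split=> //; apply: PosD => //; exact: Pos_base.
    - by rewrite E Ey addrAC.
    - split; first by move/(canRL (addrK _)); rewrite subrr => /(D0 Du).
      move=> vi; apply: (ss_iso_string ssD (Db i) iso Du _ _).
        by rewrite -vi -Ey.
      by rewrite -{1}vi -Ey -E.
  right; have := ss_iso_split ssD (Db i) iso Du Dv; rewrite -Ey => /(_ Dy Dyb).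
  case=> H; first exact: (aux u v).
  by apply: (aux v u) => //; rewrite addrC.
move=> Dx Px xi; case: (dec _ Dx Px) => [[j E]|[y [z [Dy Dz Py Pz E]]]].
  apply: Or31; exists j => //; apply/eqP => ji; by rewrite ji in E.
have [zi|zi] := EM (z = b i).
  have [yi|yi] := EM (y = b i).
    (* The case [x = b i + b i] is void: the double of an isotropic root is not a root. *)
    have := @ss_mul _ _ _ _ ssD (b i) 2 isT (Db i).
    by rewrite mulr2n -{2}zi -{1}yi -E => /(_ Dx) [_ /(_ iso)].
  by rewrite zi in E; case: (key y) => // ?; [apply: Or32|apply: Or33].
have [yi|yi] := EM (y = b i).
  by rewrite yi addrC in E; case: (key z) => // ?; [apply: Or32|apply: Or33].
by apply: Or33; exists y, z.
Qed.

Let D_b' j : D (b' j).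
Proof. exact: (D_odd_refl gb DN supersystem_add). Qed.

(** This is the highest weight of the adjoint representation for the reflected base: lowering by
    [b i] kills the old highest weight vector exactly if its weight is orthogonal to [b i]. *)
Definition highest_odd x := if f x (b i) == 0 then x else x - b i.

Lemma locally_highest_odd x :
  locally_highest D b x -> locally_highest D b' (highest_odd x).
Proof.
move=> [Dx Hx]; rewrite /highest_odd.
have notD2 y : D y -> D (y + b i) -> ~ D (y + b i + b i).
  exact: (ss_iso_string ssD (Db i) iso).
have isoN : f (- b i) (- b i) = 0 by rewrite !fE iso !oppr0.
have fNi y : f y (- b i) <> 0 <-> f y (b i) <> 0.
  by rewrite fE; split=> H E; apply: H; rewrite ?E ?oppr0 //; apply: oppr_inj;
    rewrite E oppr0.
case: eqP => fx.
  split=> // j; have [ji|ji] := eqVneq j i.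
    rewrite {}ji odd_refl_i; split.
      move=> Dxi; have := ss_iso_orth ssD (Db i) iso Dxi.
      by rewrite subrK => /(_ Dx); rewrite fE fE iso subr0.
    (* If [x = b i], some simple root [b l] is not orthogonal to [b i], and then [x + b l] is a
       root, although [x] is locally highest. *)
    move/eqP; rewrite subr_eq0 => /eqP xi; have [y Dy fy] := ss_nonorth ssD (Db i) iso.
    have [l fl] : exists j, f (b j) (b i) <> 0.
      apply: contrapT => /forallNP H; apply: fy.
      have P0 z : Pos b z -> f z (b i) = 0.
        move=> [k ->]; elim/big_rec: _ => [|m u _ IH]; first exact: f0l.
        rewrite fE // IH addr0 -scaler_nat fE.
        by have /contrapT -> := H m; rewrite mulr0.
      have [_ _ cov _] := gb; case: (cov _ Dy) => /P0 //.
      by rewrite fE => /eqP; rewrite oppr_eq0 => /eqP.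
    have [[]] := Hx l; rewrite xi addrC -(odd_refl_nonorth iso fl); exact: D_b'.
  have [fj|fj] := EM (f (b j) (b i) = 0); first by rewrite odd_refl_orth.
  rewrite odd_refl_nonorth //; have := D_b' j; rewrite odd_refl_nonorth // => Dj.
  have fu : f (x + (b j + b i)) (b i) <> 0 by rewrite !fE fx iso add0r addr0.
  split; last by move=> u0; rewrite u0 f0l in fu.
  move=> Du; case: (ss_iso ssD (Db i) iso Du fu); last first.
    by rewrite addrA addrK; have [] := Hx j.
  (* Neither summand can absorb [b i]: [x] because it is locally highest, [b j + b i] because
     strings along an isotropic root have at most two members. *)
  move=> Du'; have := ss_iso_split ssD (Db i) iso Dx Dj Du Du'.
  case; first by have [H1 H2] := Hx i; case.
  case; first exact: notD2.
  move=> E; have := @lin_indep_inj_nat _ _ _ fb (fun l => (l == j) + (l == i) *2)%N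
    (fun=> 0%N).
  rewrite [RHS]big1 //; under eq_bigr do rewrite mulrnDr mulrnA mulr2n.
  rewrite big_split /= (bigD1 j) //= eqxx big1 ?addr0 => [|l /negbTE -> //].
  rewrite (bigD1 i) //= eqxx big1 ?addr0 => [|l /negbTE -> ]; last by rewrite !mulr0n addr0.
  by rewrite addrA E => /(_ erefl) /(_ j); rewrite eqxx.
have Dxi : D (x - b i).
  by case: (ss_iso ssD (Db i) iso Dx fx) => //; have [] := Hx i.
split=> // j; have [ji|ji] := eqVneq j i.
  rewrite {}ji odd_refl_i; split.
    by move=> H; have := notD2 _ H; rewrite !subrK => /(_ Dxi).
  move/(congr1 (f^~ (b i))); rewrite f0l // !fE iso !subr0 => /eqP.
  by move/eqP.
have [fj|fj] := EM (f (b j) (b i) = 0); last first.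
  by rewrite odd_refl_nonorth // addrACA addNr addr0; exact: Hx.
rewrite odd_refl_orth //.
have fz : f (x - b i + b j) (b i) <> 0 by rewrite !fE iso fj subr0 addr0.
split; last by move=> z0; rewrite z0 f0l in fz.
move=> Dz; have [H1 H2] := Hx j.
case: (ss_iso ssD (Db i) iso Dz fz); first by rewrite addrAC subrK.
move=> Dz'; case: (ss_iso_split ssD (DN (Db i)) isoN Dxi (Db j) Dz Dz').
  case; first by move=> H; have := notD2 _ H; rewrite !subrK => /(_ Dxi).
  move/(congr1 (f^~ (b i))); rewrite f0l // !fE iso !subr0 => /eqP.
  by move/eqP.
case; first exact: notDdiff.
by move/eqP; rewrite subr_eq0 => /eqP /(base_inj fb) /eqP; rewrite (negbTE ji).
Qed.

End OddReflectionSupersystem.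

Section PosOddRefl.
Variables (C : numFieldType) (V : lmodType C) (f : V -> V -> C) (D : set V).
Hypothesis ssD : supersystem f D.
Variables (N : nat) (b : 'I_N -> V) (i : 'I_N).
Hypothesis gb : root_base D b.
Hypothesis iso : f (b i) (b i) = 0.

Lemma Pos_odd_refl_ss x : D x -> Pos b x -> x <> b i -> Pos (odd_refl f b i) x.
Proof. exact: (Pos_odd_refl gb iso (ss_neq0 ssD) (Pos_odd_split ssD gb iso)). Qed.

End PosOddRefl.

Lemma scalar_linear (C : numFieldType) (V : lmodType C) (h : V -> C) :
  linear (h : V -> C^o) ->
  (forall x y, h (x + y) = h x + h y) /\ (forall a x, h (a *: x) = a * h x).
Proof.
move=> hl; have hD x y : h (x + y) = h x + h y.
  by have := hl 1 x y; rewrite !scale1r.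
split=> // a x; have h0 : h 0 = 0 by apply: (addrI (h 0)); rewrite -hD !addr0.
by have := hl a x 0; rewrite !addr0 h0 addr0.
Qed.

(** * Chains of reflections between bases *)

Section GoodBases.
Variables (C : numFieldType) (V : lmodType C) (f : V -> V -> C) (D : set V).
Hypothesis f_linear : forall y, linear (f^~ y : V -> C^o).
Hypothesis f_sym : forall x y, f x y = f y x.
Hypothesis ssD : supersystem f D.
Local Notation fE := (fE f_linear f_sym).
Local Notation s_ := (sref f).

Section Odd.
Variables (N : nat) (b : 'I_N -> V) (i : 'I_N).
Hypothesis gb : good_base D b.
Hypothesis iso : f (b i) (b i) = 0.
Local Notation b' := (odd_refl f b i).

(** The odd reflection in [b' i = - b i] leads back to [b] and carries locally highest roots for
    [b'] to the unique one for [b]. No information is lost, because a shift by the isotropic [b i]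
    does not change the product with [b i]. *)
Lemma good_odd_refl : good_base D b'.
Proof.
have [rb uh] := gb.
have D0 x : D x -> x <> 0 by exact: (ss_neq0 ssD).
have DN x : D x -> D (- x) by exact: (ss_opp ssD).
have Ei : b' i = - b i by exact: odd_refl_i.
have iso' : f (b' i) (b' i) = 0 by rewrite Ei !fE iso !oppr0.
have E'' : odd_refl f b' i = b by exact: (odd_reflK f_linear f_sym iso).
have rb' : root_base D b'.
  apply: (root_base_odd_refl rb iso D0 DN); last exact: (Pos_odd_split ssD rb iso).
  exact: (supersystem_add ssD rb iso).
split=> // x y Hx Hy.
have := locally_highest_odd f_linear f_sym ssD rb' iso' Hx.
have := locally_highest_odd f_linear f_sym ssD rb' iso' Hy.
rewrite E'' => Hy' Hx'; have := uh _ _ Hx' Hy'.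
rewrite /highest_odd Ei !fE !oppr_eq0 !opprK.
case: eqP => fx; case: eqP => fy //.
- by move=> E; case: fy; rewrite E !fE iso addr0 in fx.
- by move=> E; case: fx; rewrite -E !fE iso addr0 in fy.
- by move/addIr.
Qed.

End Odd.

Section Even.
Variables (N : nat) (b : 'I_N -> V).

Lemma good_sref a : D a -> f a a <> 0 -> good_base D b ->
  good_base D (fun i => s_ a (b i)).
Proof.
move=> Da a0 [[fb Db cov dec] uh].
have sK : involutive (s_ a) by exact: (srefK f_linear).
have sD x : D x -> D (s_ a x) by exact: (D_sref ssD).
have sN x : s_ a (- x) = - s_ a x by exact: srefN.
have sPos x : Pos (fun i => s_ a (b i)) (s_ a x) <-> Pos b x.
  split=> -[k E]; exists k; last first.
    by rewrite E (sref_sum f_linear); apply: eq_bigr => i _; rewrite srefMn.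
  rewrite -[x]sK E (sref_sum f_linear); apply: eq_bigr => i _.
  by rewrite srefMn // sK.
have sLH x : locally_highest D (fun i => s_ a (b i)) x ->
    locally_highest D b (s_ a x).
  move=> [Dx Hx]; split; first exact: sD.
  move=> j; have [H1 H2] := Hx j.
  have E : s_ a x + b j = s_ a (x + s_ a (b j)) by rewrite srefD // sK.
  rewrite E; split; first by move=> /sD; rewrite sK.
  by move/(congr1 (s_ a)); rewrite sK sref0.
split; last first.
  by move=> x y /sLH Hx /sLH Hy; rewrite -[x]sK -[y]sK (uh _ _ Hx Hy).
split.
- move=> k E; apply: fb; rewrite -[LHS]sK.
  suff -> : s_ a (\sum_i b i *~ k i) = 0 by exact: sref0.
  rewrite (sref_sum f_linear) -[RHS]E; apply: eq_bigr => i _.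
  by rewrite -!scaler_int srefZ.
- by move=> i; exact: sD.
- move=> x Dx; rewrite -[x]sK -sN.
  by case: (cov _ (sD _ Dx)) => P; [left|right]; apply/sPos.
- move=> x Dx; rewrite -{1}[x]sK => /sPos Px.
  case: (dec _ (sD _ Dx) Px) => [[i E]|[y [z [Dy Dz Py Pz E]]]].
    by left; exists i; rewrite -E sK.
  right; exists (s_ a y), (s_ a z).
  by split; [exact: sD|exact: sD|exact/sPos|exact/sPos|rewrite -srefD // -E sK].
Qed.

Hypothesis gb : good_base D b.
Variable i : 'I_N.
Hypothesis niso : f (b i) (b i) <> 0.

(** The reflection changes only the coefficient of [b i]. A negative image would make all other
    coefficients vanish, so [x] would be a multiple of [b i]. *)
Lemma Pos_sref x : D x -> Pos b x -> x <> b i -> x <> b i *+ 2 ->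
  Pos b (s_ (b i) x).
Proof.
have [[fb Db cov dec] uh] := gb.
move=> Dx [k E] x1 x2.
have Dsx : D (s_ (b i) x) by exact: (D_sref ssD).
case: (cov _ Dsx) => // -[l El].
have [c Ec _] := ss_refl ssD (Db i) niso Dx.
have Esx : s_ (b i) x = x - b i *~ c.
  by rewrite /sref Ec mulfK ?scaler_int //; apply/eqP.
have K j : j != i -> k j = 0%N.
  move=> ji.
  have := @lin_indep_inj _ _ _ fb (fun j => (k j)%:Z - (if j == i then c else 0))
    (fun j => - (l j)%:Z).
  have -> : \sum_j b j *~ ((k j)%:Z - (if j == i then c else 0)) = s_ (b i) x.
    under eq_bigr do rewrite mulrzBr.
    rewrite sumrB -sum_mulz -E Esx; congr (_ - _).
    rewrite (bigD1 i) //= eqxx big1 ?addr0 // => m /negbTE ->.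
    by rewrite mulr0z.
  under [in X in (_ = X -> _)]eq_bigr do rewrite mulrNz.
  rewrite sumrN -sum_mulz -El opprK => /(_ erefl) /(_ j).
  by rewrite (negbTE ji); lia.
have Ex : x = b i *+ k i.
  rewrite E (bigD1 i) //= big1 ?addr0 // => j /K ->; by rewrite mulr0n.
case: (ltnP 1 (k i)) => ki.
  have := ss_mul ssD ki (Db i); rewrite -Ex => /(_ Dx) [k2 _].
  by case: x2; rewrite Ex k2.
case: (k i) ki Ex => [|[|//]] _ Ex; last by case: x1; rewrite Ex.
by case: (ss_neq0 ssD Dx); rewrite Ex.
Qed.

End Even.

(* Each step of the induction makes the finite set of positive roots on which
   [h] is negative smaller. *)
Lemma chain_ind (N : nat) (K : ('I_N -> V) -> (V -> C) -> Prop) :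
  (forall b (h : V -> C), good_base D b -> linear (h : V -> C^o) ->
    (forall i, 0 <= h (b i)) -> K b h) ->
  (forall b (h : V -> C) i, good_base D b -> linear (h : V -> C^o) ->
    f (b i) (b i) = 0 -> h (b i) < 0 -> K (odd_refl f b i) h -> K b h) ->
  (forall b (h : V -> C) i, good_base D b -> linear (h : V -> C^o) ->
    f (b i) (b i) <> 0 -> h (b i) < 0 ->
    K b (fun x => h (s_ (b i) x)) -> K b h) ->
  forall b (h : V -> C), good_base D b -> linear (h : V -> C^o) ->
    (forall x, D x -> h x \is Num.real) -> K b h.
Proof.
move=> Kbase Kodd Keven b h gb hl hr.
have [s0 Hs0] := ss_fin ssD.
have : forall x, D x -> Pos b x -> h x < 0 -> x \in s0 by move=> x /Hs0.
have [n] := ubnP (size s0); elim: n => // n IH in s0 b h gb hl hr {Hs0} *.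
rewrite ltnS => sn Hs.
have [[fb Db cov dec] uh] := gb.
have [[i hi]|/forallNP H] := EM (exists i, h (b i) < 0); last first.
  apply: Kbase => // i.
  by rewrite real_leNgt ?real0 ?hr //; apply/negP/H.
have is0 : b i \in s0 by apply: Hs => //; exact: Pos_base.
have [hD hZ] := scalar_linear hl.
have hN x : h (- x) = - h x by rewrite -scaleN1r hZ mulN1r.
pose s1 := [seq x <- s0 | x != b i].
have ss1 : (size s1 < n)%N.
  rewrite size_filter; apply: leq_trans sn.
  by rewrite -(count_predC (pred1 (b i)) s0) -[X in (X < _)%N]add0n ltn_add2r -has_count
    has_pred1.
have hNi : 0 < h (- b i) by rewrite hN oppr_gt0.
have [iso|niso] := EM (f (b i) (b i) = 0).
  apply: (Kodd _ _ i) => //; apply: (IH s1) => //; first exact: good_odd_refl.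
  move=> x Dx P'x hx.
  have xi : x <> b i.
    move=> E; have [[fb' _ _ _] _] := good_odd_refl gb iso.
    apply: (ss_neq0 ssD Dx); apply: (Pos_anti fb' P'x).
    by rewrite E -(odd_refl_i f b i); exact: Pos_base.
  rewrite mem_filter; apply/andP; split; first exact/eqP.
  apply: Hs => //; case: (cov _ Dx) => // PNx.
  have [E|E] := EM (- x = b i).
    by move: hNi; rewrite -E opprK => /(lt_trans hx); rewrite ltxx.
  have [[fb' _ _ _] _] := good_odd_refl gb iso.
  case: (ss_neq0 ssD Dx); apply: (Pos_anti fb' P'x).
  by apply: (Pos_odd_refl_ss ssD (proj1 gb) iso) => //; exact: (ss_opp ssD).
(* The remaining list is moved along by the reflection, which permutes the positive roots other than
   [b i] and its double. *)
apply: (Keven _ _ i) => //; apply: (IH [seq s_ (b i) x | x <- s1]) => //.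
- by move=> c x y; rewrite srefD // srefZ // hl.
- by move=> x Dx; apply: hr; exact: (D_sref ssD).
- by rewrite size_map.
have sK : involutive (s_ (b i)) by exact: (srefK f_linear).
move=> x Dx Px hx; apply/mapP; exists (s_ (b i) x); last by rewrite sK.
have sx : Pos b (s_ (b i) x).
  apply: Pos_sref => // E; move: hx; rewrite E ?srefMn // sref_id //.
    by move/(lt_trans hNi); rewrite ltxx.
  have hM y m : h (y *+ m) = h y *+ m by rewrite -scaler_nat hZ mulr_natl.
  by rewrite hM pmulrn_llt0 // => /(lt_trans hNi); rewrite ltxx.
rewrite mem_filter; apply/andP; split; last by apply: Hs => //; exact: (D_sref ssD).
apply/eqP => /(congr1 (s_ (b i))); rewrite sK sref_id // => E.
by apply: (ss_neq0 ssD Dx); apply: (Pos_anti fb Px); rewrite E opprK; exact: Pos_base.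
Qed.
End GoodBases.

Section BaseIsGood.
Variables (C : numClosedFieldType) (V : lmodType C).
Variables (f : V -> V -> C) (D : set V).
Hypothesis f_linear : forall y, linear (f^~ y : V -> C^o).
Hypothesis f_sym : forall x y, f x y = f y x.
Hypothesis ssD : supersystem f D.
Local Notation s_ := (sref f).

Lemma natcone_height (S : set V) (h : V -> C) x : linear (h : V -> C^o) ->
  (forall u, S u -> h u = 1) -> natcone S x -> D x ->
  exists n, h x = n.+1%:R.
Proof.
move=> hl hS [s [sS E]] Dx; have [hD hZ] := scalar_linear hl.
have h0 : h 0 = 0 by rewrite -[0](scale0r 0) hZ mul0r.
have hs : h x = (size s)%:R.
  rewrite E {E}; elim: s sS => [|u s IH] sS; first by rewrite big_nil.
  have Su : S u by apply: sS; exact: mem_head.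
  rewrite big_cons hD (hS u Su) IH /=; first by rewrite [in RHS]mulrS.
  by move=> v vs; apply: sS; rewrite inE vs orbT.
case: s {sS} hs E => [|u s] hs E; last by exists (size s).
by case: (ss_neq0 ssD Dx); rewrite E big_nil.
Qed.

(** The good base of [ss_std] is reflected until the height [h] of [S] is nonnegative on it; then it
    is [S]. At an even step [S] is reflected together with [h], and the base stays. *)
Lemma base_is_good (S : set V) (h : V -> C) : S `<=` D ->
  (forall x, D x -> natcone S x \/ natcone S (- x)) ->
  linear (h : V -> C^o) -> (forall u, S u -> h u = 1) ->
  exists N (b : 'I_N -> V), good_base D b /\ S = range b.
Proof.
move=> SD cS hl hS; have [N [b0 gb0]] := ss_std ssD; exists N.
have hr x : D x -> h x \is Num.real.
  move=> Dx; have [hD hZ] := scalar_linear hl.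
  case: (cS _ Dx) => P; first by have [n ->] := natcone_height hl hS P Dx; apply: realn.
  have [n E] := natcone_height hl hS P (ss_opp ssD Dx).
  by rewrite -[x]opprK -[- - x]scaleN1r hZ mulN1r realN E realn.
pose K (b : 'I_N -> V) (h : V -> C) := forall S : set V, S `<=` D ->
  (forall x, D x -> natcone S x \/ natcone S (- x)) ->
  (forall u, S u -> h u = 1) ->
  exists b : 'I_N -> V, good_base D b /\ S = range b.
suff : K b0 h by apply.
apply: (chain_ind f_linear f_sym ssD (K := K)) => // {h hl hS hr S SD cS b0 gb0}.
(* Now [Pos b] and the cone of [S] agree on roots. An element of [S] has height 1 and cannot be a
   sum of two positive roots, so it belongs to [b]. *)
- move=> b h gb hl hb S SD cS hS; exists b; split=> //.
  have [[fb Db cov dec] _] := gb.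
  have [hD hZ] := scalar_linear hl.
  have hN x : h (- x) = - h x by rewrite -scaleN1r hZ mulN1r.
  have hP x : Pos b x -> 0 <= h x.
    move=> [k ->]; elim/big_rec: _ => [|i y _ IH].
      by rewrite -(scale0r 0) hZ mul0r.
    by rewrite hD addr_ge0 // -scaler_nat hZ mulr_ge0 ?ler0n.
  have hC x : D x -> natcone S x -> 0 < h x.
    by move=> Dx nx; have [n ->] := natcone_height hl hS nx Dx; rewrite ltr0n.
  have PC x : D x -> Pos b x -> natcone S x.
    move=> Dx Px; case: (cS _ Dx) => // /(hC _ (ss_opp ssD Dx)).
    by rewrite hN oppr_gt0 => /(le_lt_trans (hP _ Px)); rewrite ltxx.
  have CP x : D x -> natcone S x -> Pos b x.
    move=> Dx nx; case: (cov _ Dx) => // /hP.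
    by rewrite hN oppr_ge0 => /(lt_le_trans (hC _ Dx nx)); rewrite ltxx.
  have SC u : S u -> natcone S u.
    move=> Su; exists [:: u]; rewrite big_seq1; split=> // v.
    by rewrite inE => /eqP ->.
  have Sb u : S u -> exists j, u = b j.
    move=> Su; have Du := SD _ Su.
    case: (dec _ Du (CP _ Du (SC _ Su))) => // -[y [z [Dy Dz Py Pz E]]].
    have [n En] := natcone_height hl hS (PC _ Dy Py) Dy.
    have [m Em] := natcone_height hl hS (PC _ Dz Pz) Dz.
    have := hS _ Su; rewrite E hD En Em -natrD => /eqP.
    by rewrite (eqr_nat _ _ 1) addSn addnS.
  apply/seteqP; split=> [u /Sb [j ->]|u [i _ <-]]; first by exists j.
  (* Conversely [b i] is a sum of elements of [S], all of which are simple for [b], so it is one of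
     them. *)
  have [s [sS E]] := PC _ (Db i) (Pos_base b i).
  case: s sS E => [|v s] sS E.
    by rewrite big_nil in E; case: (ss_neq0 ssD (Db i)).
  have [j Ej] := Sb _ (sS _ (mem_head _ _)).
  suff -> : i = j by rewrite -Ej; apply: sS; exact: mem_head.
  apply/eqP; apply: contrapT => /negP ij; apply: (base_diff fb ij).
  rewrite E big_cons Ej addrC addKr.
  have : {in s, forall w, Pos b w}.
    move=> w ws; have [|l ->] := Sb w; last exact: Pos_base.
    by apply: sS; rewrite inE ?vs ?ws orbT.
  elim: {E sS} s => [|w s IH] H; first by rewrite big_nil; exact: Pos0.
  rewrite big_cons; apply: PosD; first by apply: H; exact: mem_head.
  by apply: IH => z zs; apply: H; rewrite inE zs orbT.
move=> b h i gb hl niso hi KE S SD cS hS.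
have [[fb Db cov dec] _] := gb.
have sK : involutive (s_ (b i)) by exact: (srefK f_linear).
have sD x : D x -> D (s_ (b i) x) by exact: (D_sref ssD).
have sC x : natcone S x -> natcone (s_ (b i) @` S) (s_ (b i) x).
  move=> [s [sS ->]]; exists (map (s_ (b i)) s); split.
    by move=> v /mapP [u us ->]; exists u => //; exact: sS.
  by rewrite big_map (sref_sum f_linear).
case: (KE (s_ (b i) @` S)).
- by move=> x [u Su <-]; apply: sD; exact: SD.
- move=> x Dx; rewrite -[x]sK -srefN //.
  by case: (cS _ (sD _ Dx)) => /sC; [left|right].
- by move=> u [v Sv <-]; rewrite sK hS.
move=> b' [gb' E]; exists (fun j => s_ (b i) (b' j)); split.
  exact: good_sref.
apply/seteqP; split=> [u Su|_ [j _ <-]].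
  have : (s_ (b i) @` S) (s_ (b i) u) by exists u.
  by rewrite E => -[j _ Ej]; exists j => //; rewrite Ej sK.
have : range b' (b' j) by exists j.
by rewrite -E => -[u Su <-]; rewrite sK.
Qed.

End BaseIsGood.

(** * Superalgebras with an invariant form *)

Section Riesz.
Variables (C : numClosedFieldType) (H : vectType C) (B : H -> H -> C).
Hypothesis B_linear : forall x, linear (B x : H -> C^o).
Hypothesis B_sym : forall x y, B x y = B y x.
Hypothesis B_nondeg : forall x, (forall y, B x y = 0) -> x = 0.
Local Notation Hs := 'Hom(H, C^o).
Implicit Types l m : Hs.

Let BDr x y z : B x (y + z) = B x y + B x z.
Proof. by have := B_linear x 1 y z; rewrite !scale1r. Qed.
Let B0r x : B x 0 = 0.
Proof. by apply: (addrI (B x 0)); rewrite -BDr !addr0. Qed.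
Let BZr a x y : B x (a *: y) = a * B x y.
Proof. by have := B_linear x a y 0; rewrite !addr0 B0r addr0. Qed.

Lemma form_inj x y : (forall z, B x z = B y z) -> x = y.
Proof.
move=> E; apply/eqP; rewrite -subr_eq0; apply/eqP; apply: B_nondeg => z.
by rewrite B_sym BDr -scaleN1r BZr mulN1r ![B z _]B_sym E subrr.
Qed.

(** Nondegeneracy makes the map to the dual injective, and both spaces have the same dimension. *)
Lemma riesz_exists (l : Hs) : exists u, forall h, B u h = l h.
Proof.
pose flin u : {linear H -> C^o} :=
  HB.pack (B u : H -> C^o) (GRing.isLinear.Build _ _ _ _ (B u : H -> C^o) (B_linear u)).
pose F (u : H) : Hs := linfun (flin u).
have FE u h : F u h = B u h by rewrite /F lfunE.
have linF : linear F.
  move=> a u v; apply/lfunP => h; rewrite add_lfunE scale_lfunE !FE.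
  by rewrite B_sym BDr BZr ![B h _]B_sym.
pose Fl : {linear H -> Hs} := HB.pack F (GRing.isLinear.Build _ _ _ _ F linF).
pose T := linfun Fl.
have TE u : T u = F u by rewrite /T lfunE.
have kT : (lker T == 0)%VS.
  apply/lker0P => u v; rewrite !TE => E; apply: form_inj => z.
  by rewrite -!FE E.
have imT : (limg T = fullv)%VS.
  apply/eqP; rewrite eqEdim subvf /= limg_dim_eq; last by rewrite (eqP kT) capv0.
  by rewrite !dimvf /dim /= muln1.
have : l \in limg T by rewrite imT memvf.
by move=> /memv_imgP [u _ ->]; exists u => h; rewrite TE FE.
Qed.

Lemma rieszE l h : B (riesz B l) h = l h.
Proof.
have [u Hu] := riesz_exists l; rewrite /riesz.
by case: xgetP => [v _ /= ->//|/(_ u)].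
Qed.

Lemma riesz_unique l u : (forall h, B u h = l h) -> riesz B l = u.
Proof. by move=> E; apply: form_inj => z; rewrite rieszE E. Qed.

Lemma dformE l m : dform B l m = l (riesz B m).
Proof. by rewrite /dform rieszE. Qed.

Lemma dform_sym l m : dform B l m = dform B m l.
Proof. exact: B_sym. Qed.

Lemma dform_linear m : linear ((dform B)^~ m : Hs -> C^o).
Proof. by move=> a x y; rewrite !dformE add_lfunE scale_lfunE. Qed.

Lemma reflE a : refl B a = sref (dform B) a.
Proof. by []. Qed.

End Riesz.

Section Bracket.
Variables (C : numClosedFieldType) (g : lieSuperalgebra C).
Implicit Types x y z : g.

Lemma brDl x y z : \[x + y, z\] = \[x, z\] + \[y, z\].
Proof. by have := lsa_linearl z 1 x y; rewrite !scale1r. Qed.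
Lemma br0l z : \[0, z\] = 0 :> g.
Proof. by apply: (addrI \[0, z\]); rewrite -brDl !addr0. Qed.
Lemma brZl a x z : \[a *: x, z\] = a *: \[x, z\].
Proof. by have := lsa_linearl z a x 0; rewrite !addr0 br0l addr0. Qed.

Lemma brDr z x y : \[z, x + y\] = \[z, x\] + \[z, y\].
Proof. by have := lsa_linearr z 1 x y; rewrite !scale1r. Qed.
Lemma br0r z : \[z, 0\] = 0 :> g.
Proof. by apply: (addrI \[z, 0\]); rewrite -brDr !addr0. Qed.
Lemma brZr z a x : \[z, a *: x\] = a *: \[z, x\].
Proof. by have := lsa_linearr z a x 0; rewrite !addr0 br0r addr0. Qed.

Lemma partD a x y : lsa_part a x -> lsa_part a y -> lsa_part a (x + y).
Proof.
have [/(_ a) [_ H] _ _] := lsa_gradedP g.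
by move=> px py; have := H 1 _ _ px py; rewrite scale1r.
Qed.
Lemma part0 a : lsa_part a (0 : g).
Proof. by have [/(_ a) [H _] _ _] := lsa_gradedP g. Qed.
Lemma partZ a c x : lsa_part a x -> lsa_part a (c *: x).
Proof.
have [/(_ a) [H0 H] _ _] := lsa_gradedP g.
by move=> px; have := H c _ _ px H0; rewrite addr0.
Qed.
Lemma part_decomp x : exists x0 x1,
  [/\ lsa_part false x0, lsa_part true x1 & x = x0 + x1].
Proof. by have [_ H _] := lsa_gradedP g. Qed.
Lemma part_direct (x0 x1 y0 y1 : g) : lsa_part false x0 -> lsa_part true x1 ->
  lsa_part false y0 -> lsa_part true y1 -> x0 + x1 = y0 + y1 ->
  x0 = y0 /\ x1 = y1.
Proof.
have [_ _ H] := lsa_gradedP g; move=> p0 p1 q0 q1 E.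
have E' : x0 - y0 = y1 - x1.
  by apply/eqP; rewrite subr_eq addrAC eq_sym subr_eq addrC E addrC.
have /H : lsa_part false (x0 - y0) by rewrite -scaleN1r; apply/partD/partZ.
have P1 : lsa_part true (x0 - y0) by rewrite E' -scaleN1r; apply/partD/partZ.
move=> /(_ P1) Z; split; apply/eqP; rewrite -subr_eq0; first exact/eqP.
by rewrite -opprB -E' Z oppr0.
Qed.

Lemma br_even_skew x y : lsa_part false x -> \[x, y\] = - \[y, x\].
Proof.
move=> px; have [y0 [y1 [p0 p1 ->]]] := part_decomp y.
rewrite brDr brDl (lsa_skew px p0) (lsa_skew px p1) /= !scale1r.
by rewrite opprD.
Qed.

Lemma br_even_jacobi x y z : lsa_part false x ->
  \[x, \[y, z\]\] = \[\[x, y\], z\] + \[y, \[x, z\]\].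
Proof.
move=> px; have [y0 [y1 [p0 p1 ->]]] := part_decomp y.
rewrite !(brDl, brDr) (lsa_jacobi z px p0) (lsa_jacobi z px p1) /= !scale1r.
by rewrite addrACA.
Qed.

End Bracket.

Section Finite.
Variables (C : numClosedFieldType) (gd : quadLSA C).
Local Notation Hs := 'Hom(q_H gd, C^o).
Local Notation io := (@q_io _ gd).
Local Notation B := (@q_hform _ gd).
Local Notation form := (dform B).
Local Notation Rt := (@q_roots _ gd).
Implicit Types (x y z : gd) (h : q_H gd) (a : Hs).

Lemma q_formDr x y z : q_form x (y + z) = q_form x y + q_form x z.
Proof. by have := q_form_linear x 1 y z; rewrite !scale1r. Qed.
Lemma q_form0r x : q_form x 0 = 0.
Proof. by apply: (addrI (q_form x 0)); rewrite -q_formDr !addr0. Qed.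
Lemma q_formZr c x y : q_form x (c *: y) = c * q_form x y.
Proof. by have := q_form_linear x c y 0; rewrite !addr0 q_form0r addr0. Qed.
Lemma q_form_sumr x n (y : 'I_n -> gd) :
  q_form x (\sum_i y i) = \sum_i q_form x (y i).
Proof. by apply: (big_morph (q_form x)) => [? ?|]; rewrite ?q_formDr ?q_form0r. Qed.

(* Only for homogeneous [x] is the form known to be linear on the left. *)
Lemma q_formZl b c x y : lsa_part b x -> q_form (c *: x) y = c * q_form x y.
Proof.
move=> px; have [y0 [y1 [p0 p1 ->]]] := part_decomp y.
have pcx := partZ c px.
rewrite !q_formDr; case: b px pcx => px pcx.
  rewrite (q_form_even px p0) (q_form_even pcx p0) !add0r.
  by rewrite (q_form_sym px p1) (q_form_sym pcx p1) q_formZr mulrCA.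
rewrite (q_form_even px p1) (q_form_even pcx p1) !addr0.
by rewrite (q_form_sym px p0) (q_form_sym pcx p0) q_formZr mulrCA.
Qed.

Lemma io_even h : lsa_part false (io h). Proof. exact: q_io_even. Qed.

Lemma io_skew h y : \[io h, y\] = - \[y, io h\].
Proof. exact: (br_even_skew _ (io_even h)). Qed.
Lemma io_jacobi h y z :
  \[io h, \[y, z\]\] = \[\[io h, y\], z\] + \[y, \[io h, z\]\].
Proof. exact: (br_even_jacobi _ _ (io_even h)). Qed.

Lemma ioD h h' : io (h + h') = io h + io h'.
Proof. by have := @q_io_linear _ gd 1 h h'; rewrite !scale1r. Qed.
Lemma io0 : io 0 = 0.
Proof. by apply: (addrI (io 0)); rewrite -ioD !addr0. Qed.
Lemma ioZ c h : io (c *: h) = c *: io h.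
Proof. by have := @q_io_linear _ gd c h 0; rewrite !addr0 io0 addr0. Qed.

Lemma io_comm h h' : \[io h, io h'\] = 0.
Proof. by have [_ H] := @q_cartan _ gd (io h'); apply: H; exists h'. Qed.

Lemma hform_linear h : linear (B h : q_H gd -> C^o).
Proof.
by move=> c x y; rewrite /q_hform ioD ioZ q_formDr q_formZr.
Qed.

Lemma hform_sym h h' : B h h' = B h' h.
Proof. by rewrite /q_hform (q_form_sym (io_even h) (io_even h')) mul1r. Qed.

(** Invariance under a Cartan element [h] gives [(a h + a' h) * q_form x y = 0]. *)
Lemma weight_form b x y a a' : lsa_part b x -> root_space io a x ->
  root_space io a' y -> q_form x y <> 0 -> a' = - a.
Proof.
move=> px rx ry f0; apply/lfunP => h; rewrite opp_lfunE.
have := q_form_inv x (io h) y; rewrite ry q_formZr.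
rewrite -[\[x, _\]]opprK -io_skew rx -scaleNr.
by rewrite (q_formZl _ _ px) => /(mulIf (introN eqP f0)).
Qed.

Lemma root_space0 x : root_space io 0 x <-> exists h, x = io h.
Proof.
rewrite -q_cartan; split=> H h; have := H h.
  by rewrite lfunE /= scale0r.
by move=> ->; rewrite lfunE /= scale0r.
Qed.

(** The Cartan subalgebra is the zero weight space, which is orthogonal to all other weight spaces,
    and weight vectors span [gd]. *)
Lemma hform_nondeg h : (forall h', B h h' = 0) -> h = 0.
Proof.
move=> H; apply: (@q_io_inj _ gd); rewrite io0; apply: q_form_nondeg => y.
have [n [u [a [ru ->]]]] := q_diag y; rewrite q_form_sumr big1 // => i _.
apply: contrapT => f0.
have r0 : root_space io 0 (io h) by apply/root_space0; exists h.
have ai := weight_form (io_even h) r0 (ru i) f0; rewrite oppr0 in ai.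
 have := ru i; rewrite ai => /root_space0 [h' E].
by apply: f0; rewrite E; exact: H.
Qed.

Lemma qrieszE a h : B (riesz B a) h = a h.
Proof. exact: (rieszE hform_linear hform_sym hform_nondeg). Qed.
Lemma qformE a a' : form a a' = a (riesz B a').
Proof. exact: (dformE hform_linear hform_sym hform_nondeg). Qed.
Lemma qform_linear a : linear (form^~ a : Hs -> C^o).
Proof. exact: (dform_linear hform_linear hform_sym hform_nondeg). Qed.
Lemma qform_sym a a' : form a a' = form a' a.
Proof. exact: (dform_sym hform_sym). Qed.

Lemma root_homog a x : root_space io a x -> x <> 0 ->
  exists b y, [/\ lsa_part b y, root_space io a y & y <> 0].
Proof.
move=> rx x0; have [y0 [y1 [p0 p1 E]]] := part_decomp x.
have R h : \[io h, y0\] = a h *: y0 /\ \[io h, y1\] = a h *: y1.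
  apply: part_direct; try exact: partZ.
  - by have := lsa_br_part (io_even h) p0.
  - by have := lsa_br_part (io_even h) p1.
  by rewrite -scalerDr -brDr -E.
have [y00|y00] := EM (y0 = 0); last first.
  by exists false, y0; split=> // h; have [] := R h.
exists true, y1; split=> // [h|y10]; first by have [] := R h.
by apply: x0; rewrite E y00 y10 addr0.
Qed.

Lemma q_rootsP a : Rt a <-> exists b, roots_of_parity io b a.
Proof.
split=> [[a0 [x [x0 rx]]]|[b [a0 [x [x0 px rx]]]]].
  have [b [y [py ry y0]]] := root_homog rx x0.
  by exists b; split=> //; exists y.
by split=> //; exists x.
Qed.

Lemma root_pair b a x : lsa_part b x -> root_space io a x -> x <> 0 ->
  exists y, [/\ lsa_part b y, root_space io (- a) y & q_form x y <> 0].
Proof.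
move=> px rx x0.
have [y0 f0] : exists y, q_form x y <> 0.
  by apply: contrapT => /forallNP H; apply/x0/q_form_nondeg => y; exact: (contrapT (H _)).
have [n [u [c [ru Ey]]]] := q_diag y0.
have [i fi] : exists i, q_form x (u i) <> 0.
  apply: contrapT => /forallNP H; apply: f0; rewrite Ey q_form_sumr big1 // => i _.
  exact: (contrapT (H _)).
have ci := weight_form px rx (ru i) fi.
have ry := ru i; rewrite ci in ry.
have [y [y' [p0 p1 E]]] := part_decomp (u i).
have R h : \[io h, y\] = (- a) h *: y /\ \[io h, y'\] = (- a) h *: y'.
  apply: part_direct; try exact: partZ.
  - by have := lsa_br_part (io_even h) p0.
  - by have := lsa_br_part (io_even h) p1.
  by rewrite -scalerDr -brDr -E.
move: fi; rewrite E q_formDr; case: b px => px.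
  rewrite (q_form_even px p0) add0r => f1; exists y'; split=> // h.
  by have [] := R h.
rewrite (q_form_even px p1) addr0 => f1; exists y; split=> // h.
by have [] := R h.
Qed.

Lemma root_br b a x y : lsa_part b x -> root_space io a x ->
  root_space io (- a) y -> \[x, y\] = io (q_form x y *: riesz B a).
Proof.
move=> px rx ry.
have [h1 E1] : exists h, \[x, y\] = io h.
  apply/q_cartan => h; rewrite io_jacobi rx ry brZl brZr.
  by rewrite opp_lfunE scaleNr subrr.
rewrite E1; congr io; apply: (form_inj hform_linear hform_sym hform_nondeg) => h.
rewrite {1}/q_hform -E1 q_form_inv -[\[y, _\]]opprK -io_skew.
rewrite ry -scaleNr q_formZr opp_lfunE opprK.
rewrite /q_hform ioZ (q_formZl _ _ (io_even _)) -/(B _ _).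
by rewrite qrieszE mulrC.
Qed.

(** Take [x], [y] of weights [a], [- a] with nonzero product and [z] of weight [a']. Both [[x, z]]
    and [[y, z]] vanish for lack of weights, so by the Jacobi identity [[x, y]], a nonzero multiple
    of the vector representing [a], kills [z]. Together with [odd_root_isotropic] this determines
    the form on the models. *)
Lemma root_orth a a' : Rt a -> Rt a' -> ~ Rt (a + a') -> a + a' <> 0 ->
  ~ Rt (a' - a) -> a' - a <> 0 -> form a a' = 0.
Proof.
move=> [a0 [x0 [x00 rx0]]] [a'0 [z [z0 rz]]] R1 N1 R2 N2.
have [b [x [px rx xn0]]] := root_homog rx0 x00.
have [y [py ry f0]] := root_pair px rx xn0.
have wt (u v : gd) c d : root_space io c u -> root_space io d v ->
    root_space io (c + d) \[u, v\].
  by move=> ru rv h; rewrite io_jacobi ru rv brZl brZr add_lfunE scalerDl.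
have xz : \[x, z\] = 0.
  by apply: contrapT => n0; apply: R1; split=> //; exists \[x, z\]; split=> //; exact: wt.
have yz : \[y, z\] = 0.
  apply: contrapT => n0; apply: R2; split=> //; exists \[y, z\]; split=> //.
  by rewrite addrC; exact: wt.
have := lsa_jacobi z px py; rewrite yz xz !br0r scaler0 addr0.
rewrite (root_br px rx ry) => /esym; rewrite rz => /eqP.
rewrite scaler_eq0 => /orP [|/eqP//].
rewrite linearZ /= qform_sym qformE => /eqP/eqP; rewrite mulf_eq0.
by case/orP => /eqP.
Qed.

(** The even vector [[x, x]] has weight [a + a] and must vanish. The Jacobi identity for the odd [x]
    then gives [2 [x, [x, y]] = 0], so the vector representing [a] commutes with [x]. *)
Lemma odd_root_isotropic a : roots_of_parity io true a ->
  ~ roots_of_parity io false (a + a) -> form a a = 0.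
Proof.
move=> [a0 [x [x0 px rx]]] R1.
have [y [py ry f0]] := root_pair px rx x0.
have xx : \[x, x\] = 0.
  apply: contrapT => n0; apply: R1; split.
    by rewrite -mulr2n -scaler_nat => /eqP; rewrite scaler_eq0 pnatr_eq0 => /eqP.
  exists \[x, x\]; split=> [//||h]; first by have := lsa_br_part px px.
  by rewrite io_jacobi rx brZl brZr add_lfunE scalerDl.
have := lsa_jacobi y px px; rewrite xx br0l add0r /= expr1 scaleN1r => /eqP.
rewrite -addr_eq0 -mulr2n -scaler_nat scaler_eq0 pnatr_eq0 /= => /eqP.
rewrite (root_br px rx ry) => E.
have : \[io (q_form x y *: riesz B a), x\] = 0 by rewrite io_skew E oppr0.
rewrite rx => /eqP; rewrite scaler_eq0 => /orP [|/eqP//].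
rewrite linearZ /= qformE => /eqP/eqP; rewrite mulf_eq0.
by case/orP => /eqP.
Qed.

End Finite.

Section WeightsFinite.
Variables (C : numClosedFieldType) (gd : quadLSA C).
Local Notation io := (@q_io _ gd).
Local Notation Rt := (@q_roots _ gd).

Lemma root_spaceN a : Rt a -> Rt (- a).
Proof.
move=> [a0 [x0 [x00 rx0]]]; have [b [x [px rx xn0]]] := root_homog rx0 x00.
have [y [py ry f0]] := root_pair px rx xn0; split.
  by move=> /eqP; rewrite oppr_eq0 => /eqP.
by exists y; split=> // y0; apply: f0; rewrite y0 q_form0r.
Qed.

(** [q_form_nondeg] concerns the left argument; supersymmetry of homogeneous components carries it
    over to the right one. *)
Lemma form_right_nondeg (x : gd) :
  (forall b a y, lsa_part b y -> root_space io a y -> q_form y x = 0) -> x = 0.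
Proof.
move=> H; have [x0 [x1 [p0 p1 E]]] := part_decomp x.
have key b u : lsa_part b u -> (forall a y, lsa_part b y ->
    root_space io a y -> q_form y u = 0) -> u = 0.
  move=> pu Hu; apply: q_form_nondeg => y.
  have [n [v [a [rv ->]]]] := q_diag y; rewrite q_form_sumr big1 // => i _.
  have [y0 [y1 [q0 q1 Ei]]] := part_decomp (v i).
  have R h : \[io h, y0\] = a i h *: y0 /\ \[io h, y1\] = a i h *: y1.
    apply: part_direct; try exact: partZ.
    - by have := lsa_br_part (io_even h) q0.
    - by have := lsa_br_part (io_even h) q1.
    by rewrite -scalerDr -brDr -Ei; exact: rv.
  rewrite Ei q_formDr; case: b pu Hu => pu Hu.
    rewrite (q_form_even pu q0) add0r (q_form_sym pu q1) (Hu (a i)) ?mulr0 //.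
    by move=> h; case: (R h).
  rewrite (q_form_even pu q1) addr0 (q_form_sym pu q0) (Hu (a i)) ?mulr0 //.
  by move=> h; case: (R h).
have x00 : x0 = 0.
  apply: (key false) => // a y py ry; have := H _ _ _ py ry.
  by rewrite E q_formDr (q_form_even py p1) addr0.
have x10 : x1 = 0.
  apply: (key true) => // a y py ry; have := H _ _ _ py ry.
  by rewrite E q_formDr (q_form_even py p0) add0r.
by rewrite E x00 x10 addr0.
Qed.

(* A weight of the quotient of [gd] by a subspace of the Cartan subalgebra. *)
Lemma quotient_weight (M : set gd) (l : 'Hom(q_H gd, C^o)) (x : gd) :
  (forall u, M u -> exists h, u = io h) ->
  (forall (c : C) u, M u -> M (c *: u)) -> ~ M x ->
  (forall h, M (\[io h, x\] - (l h : C) *: x)) -> Rt l \/ l = 0.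
Proof.
move=> Mio Mz Mx Hx; apply: contrapT => /not_orP [Rl l0].
(* Weight [- l] does not occur because [l] is assumed not to be a root. For any other nonzero weight
   the error term lies in the Cartan subalgebra and is orthogonal to [y]. *)
have key b m y : lsa_part b y -> root_space io (- m) y -> m <> 0 -> q_form y x = 0.
  move=> py ry m0.
  have [lm|] := EM (l = m).
    have [->|y0] := EM (y = 0).
      by rewrite -(scale0r 0) (q_formZl _ _ (part0 _ false)) mul0r.
    case: Rl; rewrite lm -[m]opprK; apply: root_spaceN; split; last by exists y.
    by move=> /eqP; rewrite oppr_eq0 => /eqP.
  move=> lm; apply: contrapT => f0; apply: lm; apply/lfunP => h.
  have [h' E] := Mio _ (Hx h).
  have : q_form y (io h') = 0.
    apply: contrapT => f1; apply: m0.
    have r0 : root_space io 0 (io h') by apply/root_space0; exists h'.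
    by have := weight_form py ry r0 f1; rewrite opprK.
  rewrite -E -scaleNr q_formDr q_formZr -q_form_inv -[\[y, _\]]opprK -io_skew.
  rewrite ry opp_lfunE scaleNr opprK (q_formZl _ _ py) -mulrDl => /eqP.
  by rewrite mulf_eq0 subr_eq0 => /orP [/eqP ->|/eqP].
(* Hence [x] commutes with the Cartan subalgebra, and the weight relation alone puts a nonzero
   multiple of [x] into [M]. *)
have xc h : \[io h, x\] = 0.
  apply: form_right_nondeg => b a y py ry.
  rewrite -q_form_inv -[\[y, _\]]opprK -io_skew ry -scaleNr (q_formZl _ _ py).
  have [->|a0] := EM (a = 0); first by rewrite lfunE /= oppr0 mul0r.
  rewrite (key b (- a)) ?mulr0 ?opprK //.
  by move=> /eqP; rewrite oppr_eq0 => /eqP.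
have [h lh] : exists h, l h <> 0.
  by apply: contrapT => /forallNP H; apply: l0; apply/lfunP => h; rewrite lfunE /=;
    exact: (contrapT (H h)).
apply: Mx; have := Mz (- (l h)^-1) _ (Hx h).
by rewrite xc sub0r scalerN -scaleNr opprK scalerA mulVf ?scale1r //; apply/eqP.
Qed.

End WeightsFinite.

(* The properties of [D] and [N] on which the real roots depend. *)
Record loop_data (C : numClosedFieldType) (gd : quadLSA C) (D N : set gd) := {
  ld_sub : subspace D;
  ld_io : forall h x, D x -> D \[q_io h, x\];
  ld_root : forall a x, a <> 0 -> root_space (@q_io _ gd) a x -> D x;
  ld_ker : forall u, N u -> exists h, u = q_io h;
  ld_kerZ : forall (c : C) u, N u -> N (c *: u) }.

(** * Real roots of the affinisation *)

Lemma scale_regularE (C : numClosedFieldType) (c : C) (x : C^o) :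
  c *: x = c * (x : C).
Proof. by []. Qed.

Section AffineForm.
Variables (C : numClosedFieldType) (gd : quadLSA C).
Local Notation Hs := 'Hom(aff_H gd, C^o).
Local Notation AB := (@aff_hform _ gd).
Local Notation aform := (dform AB).
Local Notation form := (dform (@q_hform _ gd)).
Local Notation E := (@ext_weight _ gd).
Local Notation dl := (delta gd).

Lemma aff_hform_linear h : linear (AB h : aff_H gd -> C^o).
Proof.
move=> c x y; rewrite /aff_hform /= (hform_linear h.1.1 c x.1.1 y.1.1).
by rewrite !scale_regularE /=; ring.
Qed.

Lemma aff_hform_sym h h' : AB h h' = AB h' h.
Proof. by rewrite /aff_hform hform_sym; congr (_ + _); ring. Qed.

Lemma aff_hform_nondeg h : (forall h', AB h h' = 0) -> h = 0.
Proof.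
move=> H; case: h H => [[h c] b] H.
have hf0 x : q_hform x (0 : q_H gd) = 0 by rewrite /q_hform io0 q_form0r.
have Eb : b = 0.
  by have := H (0, 1, 0); rewrite /aff_hform /= hf0 mulr0 mulr1 !add0r.
have Ec : c = 0.
  by have := H (0, 0, 1); rewrite /aff_hform /= hf0 mulr0 mulr1 addr0 add0r.
have Eh : h = 0.
  apply: hform_nondeg => h'; have := H (h', 0, 0).
  by rewrite /aff_hform /= !mulr0 !addr0.
by rewrite Eb Ec Eh.
Qed.

Lemma aform_linear a : linear (aform^~ a : Hs -> C^o).
Proof. exact: (dform_linear aff_hform_linear aff_hform_sym aff_hform_nondeg). Qed.
Lemma aform_sym a a' : aform a a' = aform a' a.
Proof. exact: (dform_sym aff_hform_sym). Qed.

Lemma ext_linear (c : C) a a' : E (c *: a + a') = c *: E a + E a'.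
Proof.
by apply/lfunP => h; rewrite add_lfunE scale_lfunE !ext_weightE add_lfunE scale_lfunE.
Qed.
Lemma extD a a' : E (a + a') = E a + E a'.
Proof. by have := ext_linear 1 a a'; rewrite !scale1r. Qed.
Lemma ext0 : E 0 = 0.
Proof. by apply: (addrI (E 0)); rewrite -extD !addr0. Qed.
Lemma extZ (c : C) a : E (c *: a) = c *: E a.
Proof. by have := ext_linear c a 0; rewrite !addr0 ext0 addr0. Qed.
Lemma extN a : E (- a) = - E a.
Proof. by rewrite -scaleN1r extZ scaleN1r. Qed.
Lemma extB a a' : E (a - a') = E a - E a'.
Proof. by rewrite extD extN. Qed.
Lemma ext_inj : injective E.
Proof.
move=> a a' H; apply/lfunP => h.
by have /lfunP/(_ (h, 0, 0)) := H; rewrite !ext_weightE.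
Qed.

Lemma aform_ext a a' (c c' : C) :
  aform (E a + c *: dl) (E a' + c' *: dl) = form a a'.
Proof.
(* The elements K and d are dual to each other, so [delta] is represented by K. *)
have R b (d : C) : riesz AB (E b + d *: dl) = (riesz (@q_hform _ gd) b, d, 0).
  apply: (riesz_unique aff_hform_linear aff_hform_sym aff_hform_nondeg).
  move=> h; rewrite add_lfunE scale_lfunE ext_weightE deltaE /aff_hform /=.
  by rewrite qrieszE mul0r addr0.
by rewrite /dform !R /aff_hform /= mulr0 mul0r !addr0.
Qed.

Lemma aform_extE a a' : aform (E a) (E a') = form a a'.
Proof. by have := aform_ext a a' 0 0; rewrite !scale0r !addr0. Qed.

Lemma aform_delta a (c : C) : aform dl (E a + c *: dl) = 0.
Proof.
have := aform_ext 0 a 1 c; rewrite ext0 add0r scale1r => ->.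
by apply: f0l; exact: qform_linear.
Qed.

Lemma ext_d a (c : C) : (E a + c *: dl) (0, 0, 1) = c.
Proof.
by rewrite add_lfunE scale_lfunE ext_weightE deltaE /= linear0 add0r scale_regularE mulr1.
Qed.

Lemma ext_eq a a' (c c' : C) : E a + c *: dl = E a' + c' *: dl ->
  a = a' /\ c = c'.
Proof.
move=> H; have Ec : c = c' by rewrite -(ext_d a c) H ext_d.
by split=> //; apply: ext_inj; move: H; rewrite Ec => /addIr.
Qed.

End AffineForm.

(** * Weights of the affinisation *)

Section AffineRoots.
Variables (C : numClosedFieldType) (gd : quadLSA C) (D N : set gd).
Variables (g : lieSuperalgebra C) (af : affinisation D N g).
Hypothesis ld : loop_data D N.
Local Notation Hs := 'Hom(aff_H gd, C^o).
Local Notation io := (@q_io _ gd).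
Local Notation Rt := (@q_roots _ gd).
Local Notation E := (@ext_weight _ gd).
Local Notation dl := (delta gd).
Local Notation LD := (loop_dom D).
Local Notation LK := (loop_ker N).
Local Notation tt_ := (af_t af).
Implicit Types (j n : int) (x y : gd).

Let LDsub j : subspace (LD j).
Proof. by rewrite /loop_dom; case: eqP => _; [split|exact: (ld_sub ld)]. Qed.

Let LDD j x y : LD j x -> LD j y -> LD j (x + y).
Proof. by move=> Hx Hy; have := (LDsub j).2 1 _ _ Hx Hy; rewrite scale1r. Qed.
Let LDz j : LD j 0. Proof. exact: (LDsub j).1. Qed.
Let LDZ j (c : C) x : LD j x -> LD j (c *: x).
Proof. by move=> Hx; have := (LDsub j).2 c _ _ Hx (LDz j); rewrite addr0. Qed.
Let LDio j h x : LD j x -> LD j \[io h, x\].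
Proof. by rewrite /loop_dom; case: eqP => // _; exact: (ld_io ld). Qed.
Let LKio j x : LK j x -> exists h, x = io h.
Proof.
rewrite /loop_ker; case: eqP => _ => [/= ->|]; last exact: (ld_ker ld).
by exists 0; rewrite io0.
Qed.
Let LKZ j (c : C) x : LK j x -> LK j (c *: x).
Proof.
rewrite /loop_ker; case: eqP => _ => [/= ->|]; last exact: (ld_kerZ ld).
by rewrite scaler0.
Qed.

Let tD j x y : LD j x -> LD j y -> tt_ j (x + y) = tt_ j x + tt_ j y.
Proof. by move=> Hx Hy; have := af_linear af 1 Hx Hy; rewrite !scale1r. Qed.
Let t0 j : tt_ j 0 = 0.
Proof. by apply: (addrI (tt_ j 0)); rewrite -tD // !addr0. Qed.
Let tZ j (c : C) x : LD j x -> tt_ j (c *: x) = c *: tt_ j x.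
Proof. by move=> Hx; have := af_linear af c Hx (LDz j); rewrite !addr0 t0 addr0. Qed.

Let tB j x y : LD j x -> LD j y -> tt_ j (x - y) = tt_ j x - tt_ j y.
Proof.
by move=> Hx Hy; rewrite -[- y]scaleN1r (tD Hx (LDZ _ Hy)) (tZ _ Hy) scaleN1r.
Qed.

Lemma aff_io_h h : aff_io af (h, 0, 0) = tt_ 0 (io h).
Proof. by rewrite /aff_io /= !scale0r !addr0. Qed.
Lemma aff_io_K : aff_io af (0, 1, 0) = af_K af.
Proof. by rewrite /aff_io /= io0 t0 scale0r scale1r addr0 add0r. Qed.
Lemma aff_io_d : aff_io af (0, 0, 1) = af_d af.
Proof. by rewrite /aff_io /= io0 t0 scale0r scale1r !add0r. Qed.

Lemma br_d_K : \[af_d af, af_K af\] = 0.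
Proof. by rewrite (br_even_skew _ (af_d_even af)) af_br_K oppr0. Qed.

Lemma br_d_d : \[af_d af, af_d af\] = 0.
Proof.
have := br_even_skew (af_d af) (af_d_even af) => /eqP.
by rewrite -addr_eq0 -mulr2n -scaler_nat scaler_eq0 pnatr_eq0 => /eqP.
Qed.

Lemma br_h_t h j x : LD j x -> \[tt_ 0 (io h), tt_ j x\] = tt_ j \[io h, x\].
Proof.
move=> Hx; rewrite af_br // add0r; case: eqP => _; last by rewrite scale0r addr0.
by rewrite mul0r scale0r addr0.
Qed.

Lemma br_h_K h : \[tt_ 0 (io h), af_K af\] = 0.
Proof.
have p : lsa_part false (tt_ 0 (io h)) by apply: af_part => //; exact: io_even.
by rewrite (br_even_skew _ p) af_br_K oppr0.
Qed.

Lemma br_h_d h : \[tt_ 0 (io h), af_d af\] = 0.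
Proof.
have p : lsa_part false (tt_ 0 (io h)) by apply: af_part => //; exact: io_even.
by rewrite (br_even_skew _ p) af_br_d // scale0r oppr0.
Qed.

Lemma af_span_uniq (x : g) : exists (s : seq int) (a : int -> gd) (c b : C),
  [/\ uniq s, forall j, LD j (a j) &
     x = \sum_(j <- s) tt_ j (a j) + c *: af_K af + b *: af_d af].
Proof.
have [s [a [c [b [Ha ->]]]]] := af_span af x.
(* Repeated degrees are merged, and [count_mem j s] records how often degree [j] occurred. *)
exists (undup s), (fun j => (count_mem j s)%:R *: a j), c, b.
split; [exact: undup_uniq|by move=> j; exact: LDZ|do 2 congr (_ + _)].
rewrite -big_undup_iterop_count; apply: eq_bigr => j _.
rewrite tZ // scaler_nat.
by elim: (count_mem j s) => [|[|m] IH] //; rewrite iteropS /= mulrS -IH.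
Qed.

Lemma br_suml (y : g) (s : seq int) (F : int -> g) :
  \[y, \sum_(j <- s) F j\] = \sum_(j <- s) \[y, F j\].
Proof. by apply: (big_morph (lsa_br y)) => [? ?|]; rewrite ?brDr ?br0r. Qed.

(** Expand a root vector by degrees and compare its brackets with d and with the finite Cartan
    subalgebra. A degree [j] with nonzero class gives [w] the value [j] on d, and [quotient_weight]
    identifies the finite part. *)
Lemma aff_roots_ext (w : Hs) : aff_roots af w ->
  exists a n, w = E a + n%:~R *: dl /\ (Rt a \/ a = 0).
Proof.
move=> [w0 [X [X0 rX]]].
have [s [a [c [b [us Ha EX]]]]] := af_span_uniq X.
pose wh h : C := w (h, 0, 0).
pose wd : C := w (0, 0, 1).
have wK : w (0, 1, 0) = 0.
  have := rX (0, 1, 0); rewrite aff_io_K af_br_K => /esym/eqP.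
  by rewrite scaler_eq0 => /orP [/eqP//|/eqP].
have whl : linear (wh : q_H gd -> C^o).
  move=> k u v; rewrite /wh -linearP; congr (w _).
  by congr (_, _, _) => /=; rewrite scale_regularE mulr0 addr0.
pose whL : {linear q_H gd -> C^o} :=
  HB.pack (wh : q_H gd -> C^o) (GRing.isLinear.Build _ _ _ _ (wh : q_H gd -> C^o) whl).
pose l : 'Hom(q_H gd, C^o) := linfun whL.
have lE h : l h = wh h by rewrite /l lfunE.
have wE : w = E l + wd *: dl.
  apply/lfunP => -[[h k] m]; rewrite add_lfunE scale_lfunE ext_weightE deltaE /= lE.
  have -> : (h, k, m) = (h, 0, 0) + (k *: ((0, 1, 0) : aff_H gd) + m *: ((0, 0,
    1) : aff_H gd)).
    congr (_, _, _) => /=; rewrite ?scaler0 ?addr0 ?add0r //; exact: (esym (mulr1 _)).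
  by rewrite !linearD !linearZ /= wK -/wd !scale_regularE mulr0 add0r mulrC.
have Hd : [/\ wd * c = 0, wd * b = 0 & forall j, j \in s -> LK j ((wd - j%:~R) *: a j)].
  have Hj j : LD j ((wd - j%:~R) *: a j) by exact: LDZ.
  apply: (af_free af (a := fun j => (wd - j%:~R) *: a j) (wd * c) (wd * b) us Hj).1.
  transitivity (wd *: X - \[af_d af, X\]).
    rewrite EX !brDr !brZr br_d_K br_d_d !scaler0 !addr0 br_suml !scalerDr !scalerA.
    rewrite [RHS]addrAC; congr (_ + _); rewrite [RHS]addrAC; congr (_ + _).
    rewrite scaler_sumr -sumrB; apply: eq_bigr => j _.
    by rewrite tZ // af_br_d // scalerBl.
  by have := rX (0, 0, 1); rewrite aff_io_d => ->; rewrite subrr.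
have Hh h : [/\ wh h * c = 0, wh h * b = 0 &
    forall j, j \in s -> LK j (wh h *: a j - \[io h, a j\])].
  have Hj j : LD j (wh h *: a j - \[io h, a j\]).
    by rewrite -scaleN1r; apply: LDD; apply: LDZ => //; apply: LDio.
  apply: (af_free af (a := fun j => wh h *: a j - \[io h,
    a j\]) (wh h * c) (wh h * b) us Hj).1.
  transitivity (wh h *: X - \[tt_ 0 (io h), X\]).
    rewrite EX !brDr !brZr br_h_K br_h_d !scaler0 !addr0 br_suml !scalerDr !scalerA.
    rewrite [RHS]addrAC; congr (_ + _); rewrite [RHS]addrAC; congr (_ + _).
    rewrite scaler_sumr -sumrB; apply: eq_bigr => j _.
    by rewrite tB ?tZ ?br_h_t //; [exact: LDZ|exact: LDio].
  by have := rX (h, 0, 0); rewrite aff_io_h => ->; rewrite subrr.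
have z0 (u v : C) : v <> 0 -> u * v = 0 -> u = 0.
  by move=> v0 /eqP; rewrite mulf_eq0 => /orP [/eqP|/eqP].
(* A component along K or d has weight zero and would force [w = 0]. *)
have [cb|/not_andP cb] := EM (c = 0 /\ b = 0); last first.
  case: w0; rewrite wE.
  have -> : wd = 0 by have [H1 H2 _] := Hd; case: cb => cb; apply: (z0 _ _ cb).
  rewrite scale0r addr0 -ext0; congr E; apply/lfunP => h; rewrite lE lfunE /=.
  by have [H1 H2 _] := Hh h; case: cb => cb; apply: (z0 _ _ cb).
have [j js nK] : exists2 j, j \in s & ~ LK j (a j).
  apply: contrapT => H; apply: X0; rewrite EX.
  apply: (af_free af c b us Ha).2; have [-> ->] := cb; split=> // j js.
  by apply: contrapT => nK; apply: H; exists j.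
have wj : wd = j%:~R.
  apply/eqP; rewrite -subr_eq0; apply: contrapT => /negP d0; apply: nK.
  have [_ _ /(_ j js)] := Hd; move=> /(LKZ (wd - j%:~R)^-1).
  by rewrite scalerA mulVf // scale1r.
exists l, j; rewrite -wj; split=> //.
apply: (@quotient_weight _ _ (LK j) l (a j)) => //.
- by move=> u; exact: LKio.
- by move=> k u; exact: LKZ.
move=> h; have [_ _ /(_ j js)] := Hh h; move=> /(LKZ (-1)).
by rewrite scaleN1r opprB lE.
Qed.

Lemma ext_aff_root_parity a n p : roots_of_parity io p a ->
  roots_of_parity (aff_io af) p (E a + n%:~R *: dl).
Proof.
move=> [a0 [x [x0 px rx]]]; have Dx : LD n x.
  by rewrite /loop_dom; case: eqP => // _; exact: (ld_root ld a0 rx).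
split.
  move=> w0; have [] // := @ext_eq _ _ a 0 n%:~R 0.
  by rewrite w0 ext0 scale0r addr0.
exists (tt_ n x); split; last first.
- move=> [[h c] b]; rewrite /aff_io /= !brDl !brZl af_br_K scaler0 addr0.
  rewrite br_h_t // af_br_d // rx tZ // scalerA -scalerDl; congr (_ *: _).
  by rewrite add_lfunE scale_lfunE ext_weightE deltaE /= scale_regularE mulrC.
- exact: af_part.
move=> t0'; have us : uniq [:: n] by [].
have := af_free af (a := fun j => if j == n then x else 0) 0 0 us.
case.
  by move=> j; case: eqP => [->|].
rewrite big_seq1 eqxx t0' !scale0r !addr0 => /(_ erefl) [_ _ /(_ n)].
(* If the vector vanished in degree [n], then [x] would lie in the Cartan subalgebra, contrary to
   [a <> 0]. *)
rewrite inE eqxx => /(_ isT) /LKio [h Eh] _.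
have r0 : root_space io 0 x by apply/root_space0; exists h.
apply: a0; apply/lfunP => h'; rewrite lfunE /=.
have := rx h'; rewrite Eh io_comm => /esym/eqP; rewrite scaler_eq0 -Eh.
by case/orP => /eqP.
Qed.

Lemma ext_aff_root a n : Rt a -> aff_roots af (E a + n%:~R *: dl).
Proof.
move=> /q_rootsP [p /(@ext_aff_root_parity _ n) [w0 [X [X0 _ rX]]]].
by split=> //; exists X.
Qed.

End AffineRoots.

Section FreeBase.
Variables (C : numClosedFieldType) (V : vectType C).

Lemma free_height (s : seq V) : free s -> exists h : V -> C,
  linear (h : V -> C^o) /\ forall u, u \in s -> h u = 1.
Proof.
move=> fs; pose t := in_tuple s; exists (fun v => \sum_i coord t i v); split.
  move=> c x y; rewrite scale_regularE mulr_sumr -big_split /=.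
  by apply: eq_bigr => i _; rewrite linearP.
move=> u /(nthP 0) [i si <-].
rewrite (bigD1 (Ordinal si)) //= (coord_free (X := t) (Ordinal si) (Ordinal si)) //.
rewrite eqxx big1 ?addr0 // => j ji.
by rewrite (coord_free (X := t) (Ordinal si) j) // eq_sym (negbTE ji).
Qed.

End FreeBase.

(** * The shape of an affine base over a finite one *)

Section AffineBase.
Variables (C : numClosedFieldType) (gd : quadLSA C) (D N : set gd).
Variables (g : lieSuperalgebra C) (af : affinisation D N g).
Hypothesis ld : loop_data D N.
Local Notation Hs := 'Hom(aff_H gd, C^o).
Local Notation io := (@q_io _ gd).
Local Notation Rt := (@q_roots _ gd).
Local Notation E := (@ext_weight _ gd).
Local Notation dl := (delta gd).
Local Notation form := (dform (@q_hform _ gd)).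
Hypothesis ssD : supersystem form Rt.

Definition affine_base n (b : 'I_n -> 'Hom(q_H gd, C^o)) th : set Hs :=
  [set w | w = dl - E th \/ exists i, w = E (b i)].

Lemma finite_base_good (Sdot : set 'Hom(q_H gd, C^o)) : is_base io Sdot ->
  exists n (b : 'I_n -> 'Hom(q_H gd, C^o)) (h : 'Hom(q_H gd, C^o) -> C),
    [/\ good_base Rt b, Sdot = range b, linear (h : _ -> C^o) &
        forall i, h (b i) = 1].
Proof.
move=> [SR Sfree Scov]; have [s0 Hs0] := ss_fin ssD.
(* [is_base] speaks of finite sequences only; as there are finitely many roots, [Sdot] can be
   listed. *)
pose s := [seq x <- undup s0 | `[< Sdot x >]].
have us : uniq s by rewrite filter_uniq ?undup_uniq.
have sS x : x \in s -> Sdot x by rewrite mem_filter => /andP [/asboolP].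
have Ss x : Sdot x -> x \in s.
  move=> Sx; rewrite mem_filter mem_undup Hs0 ?andbT; last exact: SR.
  exact/asboolP.
have [h [hl h1]] := free_height (Sfree _ us sS).
have [u|n [b [gb Eb]]] := base_is_good (@qform_linear _ gd) (@qform_sym _ gd) ssD SR Scov
  hl _.
  by move=> /Ss /h1.
exists n, b, h; split=> // i; apply/h1/Ss; rewrite Eb; by exists i.
Qed.

Variables (n : nat) (b : 'I_n -> 'Hom(q_H gd, C^o)).
Hypothesis gb : good_base Rt b.
Variable S : set Hs.
Hypothesis bS : is_base (aff_io af) S.
Hypothesis SdS : E @` range b `<=` S.
Hypothesis dS : natcone S dl.

Let X := [seq E (b i) | i <- enum 'I_n].

Let XE w : w \in X <-> exists i, w = E (b i).
Proof.
split; first by move=> /mapP [i _ ->]; exists i.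
by move=> [i ->]; apply: map_f; rewrite mem_enum.
Qed.

Let X_Pos a : Pos b a -> E a \in <<X>>%VS.
Proof.
move=> [k ->]; elim/big_rec: _ => [|i x _ IH]; first by rewrite ext0 mem0v.
rewrite extD -scaler_nat extZ; apply: rpredD => //; apply: rpredZ.
by apply: memv_span; apply/XE; exists i.
Qed.

Let X_root a : Rt a -> E a \in <<X>>%VS.
Proof.
have [[_ _ cov _] _] := gb; case/cov => /X_Pos //.
by rewrite extN rpredN.
Qed.

Let notXspan w : S w -> w \notin X -> w \notin <<X>>%VS.
Proof.
move=> Sw wX; have [_ fr _] := bS.
have uX : uniq X.
  rewrite map_inj_uniq ?enum_uniq // => i j /ext_inj.
  by have [[fb _ _ _] _] := gb; apply: base_inj.
have := fr (w :: X); rewrite free_cons => H.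
suff /andP [] : (w \notin <<X>>%VS) && free X by [].
apply: H; first by rewrite /= wX.
move=> v; rewrite inE => /orP [/eqP -> //|/XE [i ->]].
by apply: SdS; exists (b i) => //; exists i.
Qed.

Let notX2 w w' : S w -> S w' -> w != w' -> w \notin X -> w' \notin X ->
  w \notin <<w' :: X>>%VS.
Proof.
move=> Sw Sw' ww wX wX'; have [_ fr _] := bS.
have uX : uniq X.
  rewrite map_inj_uniq ?enum_uniq // => i j /ext_inj.
  by have [[fb _ _ _] _] := gb; apply: base_inj.
have := fr (w :: w' :: X); rewrite free_cons => H.
suff /andP [] : (w \notin <<w' :: X>>%VS) && free (w' :: X) by [].
apply: H; first by rewrite /= inE negb_or ww wX wX'.
move=> v; rewrite !inE => /or3P [/eqP -> //|/eqP -> //|/XE [i ->]].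
by apply: SdS; exists (b i) => //; exists i.
Qed.

(** Affine roots lie in the span of the finite base and [delta], so freeness of [S] leaves at most
    one element [E a + m delta] outside the finite base. It exists and has [m = 1] because [delta]
    is in the cone; since [c + delta] is positive for every finite root [c], the root [- a] lies
    above all others. *)
Lemma affine_base_shape : exists th, [/\ locally_highest Rt b th,
  forall c, Rt c -> Pos b (th - c) & S = affine_base b th].
Proof.
have [SR fr cov] := bS; have [[fb Db bcov dec] uh] := gb.
have d0 x : x \in <<X>>%VS -> x (0, 0, 1) = 0.
  move=> /coord_span ->; rewrite sum_lfunE big1 // => i _.
  rewrite scale_lfunE.
  have /XE [j ->] : (in_tuple X)`_i \in X by apply: mem_nth; rewrite size_map -cardE;
    exact: ltn_ord.
  by have := ext_d (b j) 0; rewrite scale0r addr0 => ->; rewrite scaler0.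
have shape w : S w -> w \notin X -> exists a m, w = E a + m%:~R *: dl
  /\ E a \in <<X>>%VS /\ m != 0.
  move=> Sw wX; have [a [m [Ew Ra]]] := aff_roots_ext ld (SR _ Sw).
  have Ea : E a \in <<X>>%VS.
    by case: Ra => [/X_root //|->]; rewrite ext0 mem0v.
  exists a, m; split=> //; split=> //; apply/eqP => m0.
  have := notXspan Sw wX; rewrite Ew m0 scale0r addr0 => /negP; exact.
have [x Sx xX] : exists2 x, S x & x \notin X.
  apply: contrapT => H; have [s [sS Es]] := dS.
  have : dl \in <<X>>%VS.
    rewrite Es big_seq; apply: rpred_sum => u us; apply: memv_span.
    by apply: contrapT => /negP uX; apply: H; exists u => //; exact: sS.
  move=> /d0; rewrite deltaE /= => /eqP; by rewrite oner_eq0.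
have [a [m [Ex [Ea m0]]]] := shape _ Sx xX.
have Sdich y : S y -> y = x \/ exists i, y = E (b i).
  move=> Sy; have [yX|yX] := boolP (y \in X); first by right; apply/XE.
  left; apply/eqP; apply: contrapT => /negP yx.
  have := notX2 Sx Sy; rewrite eq_sym => /(_ yx xX yX) /negP; apply.
  have [a' [m' [Ey [Ea' m'0]]]] := shape _ Sy yX.
  have XS : {subset <<X>>%VS <= <<y :: X>>%VS}.
    by apply/subvP; apply: sub_span => v vX; rewrite inE vX orbT.
  have m'C : (m'%:~R : C) != 0 by rewrite intr_eq0.
  suff -> : x = (m%:~R / m'%:~R) *: y + (E a - (m%:~R / m'%:~R) *: E a').
    apply: rpredD; first by apply: rpredZ; apply: memv_span; exact: mem_head.
    by apply: XS; apply: rpredB => //; apply: rpredZ.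
  by rewrite Ex Ey scalerDr scalerA divfK // [RHS]addrC addrA subrK.
have conedec w : natcone S w -> exists (k : nat) a',
    Pos b a' /\ w = x *+ k + E a'.
  move=> [s [sS ->]] {w}; elim: s sS => [|u s IH] sS.
    exists 0%N, 0; split; first exact: Pos0.
    by rewrite big_nil ext0 addr0.
  rewrite big_cons; have [|k [a' [Pa' ->]]] := IH.
    by move=> v vs; apply: sS; rewrite inE vs orbT.
  case: (Sdich _ (sS _ (mem_head _ _))) => [->|[i ->]].
    by exists k.+1, a'; rewrite mulrS addrA.
  exists k, (b i + a'); split; first by apply: PosD => //; exact: Pos_base.
  by rewrite extD addrCA.
have conem w (l : int) a' : w = E a' + l%:~R *: dl -> natcone S w ->
    exists k : nat, l = m * k%:Z /\ Pos b (a' - a *+ k).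
  move=> Ew /conedec [k [c [Pc]]]; rewrite Ew Ex mulrnDl -!scaler_nat -extZ.
  rewrite scalerA addrAC -extD => /ext_eq [Eac El].
  exists k; split; last first.
    by rewrite Eac scaler_nat addrC addKr.
  by apply/eqP; rewrite -(eqr_int C) El intrM mulrC.
have m1 : m = 1.
  have [|k [Ek _]] := @conem dl 1 0 _ dS; first by rewrite ext0 add0r scale1r.
  move: Ek; case: m {m0 Ex conem} => m Ek; last by nia.
  by move: Ek => /eqP; rewrite eq_sym -PoszM (eqz_nat _ 1) muln_eq1 => /andP [/eqP -> _].
have Pall c : Rt c -> Pos b (c - a).
  move=> Rc; have Rcd : aff_roots af (E c + 1%:~R *: dl) by exact: ext_aff_root.
  case: (cov _ Rcd) => nc.
    have [k [Ek]] := conem _ _ _ erefl nc.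
    by move: Ek; rewrite m1 mul1r => -[<-].
  have E' : - (E c + 1%:~R *: dl) = E (- c) + (-1)%:~R *: dl.
    by rewrite opprD extN -scaleNr rmorphN1.
  have [k [Ek _]] := conem _ _ _ E' nc.
  by move: Ek; rewrite m1 mul1r.
have RN c : Rt c -> Rt (- c) by exact: (ss_opp ssD).
have R0 c : Rt c -> c <> 0 by exact: (ss_neq0 ssD).
have [c0 Rc0 _] := ss_exists_iso ssD.
have a0 : a <> 0.
  move=> a0; apply: (R0 _ Rc0); apply: (Pos_anti fb).
    by have := Pall _ Rc0; rewrite a0 subr0.
  by have := Pall _ (RN _ Rc0); rewrite a0 subr0.
have Ra : Rt a.
  have [a' [l [Ew Ra']]] := aff_roots_ext ld (SR _ Sx).
  move: Ew; rewrite Ex => /ext_eq [Eaa _]; rewrite Eaa; case: Ra' => // a'0.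
  by case: a0; rewrite Eaa a'0.
have Pth c : Rt c -> Pos b (- a - c).
  by move=> /RN/Pall; rewrite addrC.
exists (- a); split=> //; last first.
  apply/seteqP; split=> [y /Sdich [->|[i ->]]|y [->|[i ->]]].
  - by left; rewrite Ex m1 scale1r extN opprK addrC.
  - by right; exists i.
  - by move: Sx; rewrite Ex m1 scale1r extN opprK addrC.
  - by apply: SdS; exists (b i) => //; exists i.
split=> [|j]; first exact: RN.
have Pj : Pos b (b j) by exact: Pos_base.
split=> [Rj|j0].
  apply: (R0 _ (Db j)); apply: (Pos_anti fb Pj).
  by have := Pth _ Rj; rewrite opprD addNKr.
have := Pth _ (Db j).
have -> : - a - b j = - (b j *+ 2).
  by rewrite mulr2n opprD; congr (_ - _); apply/eqP; rewrite -subr_eq0 opprK j0.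
move=> P2; have : b j *+ 2 = 0.
  by apply: (Pos_anti fb _ P2); rewrite mulr2n; apply: PosD.
rewrite -scaler_nat => /eqP; rewrite scaler_eq0 pnatr_eq0 => /eqP.
exact: R0.
Qed.

End AffineBase.

Lemma sref_scale (C : numClosedFieldType) (V : lmodType C) (f : V -> V -> C)
    (c : C) a :
  (forall y, linear (f^~ y : V -> C^o)) -> (forall x y, f x y = f y x) ->
  c != 0 -> sref f (c *: a) = sref f a.
Proof.
move=> fl fs c0; apply: funext => x; rewrite /sref !(fE fl fs) scalerA.
(* As the inverse of 0 is 0, both reflections are the identity when [a] is isotropic. *)
congr (_ - _ *: _); have [->|a0] := eqVneq (f a a) 0.
  by rewrite !mulr0 invr0 !mulr0 mul0r.
by field; rewrite ?c0 ?a0.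
Qed.

(** * Reaching the finite roots *)

Section RealRoots.
Variables (C : numClosedFieldType) (gd : quadLSA C) (D N : set gd).
Variables (g : lieSuperalgebra C) (af : affinisation D N g).
Hypothesis ld : loop_data D N.
Local Notation Hf := 'Hom(q_H gd, C^o).
Local Notation Hs := 'Hom(aff_H gd, C^o).
Local Notation io := (@q_io _ gd).
Local Notation Rt := (@q_roots _ gd).
Local Notation E := (@ext_weight _ gd).
Local Notation dl := (delta gd).
Local Notation form := (dform (@q_hform _ gd)).
Local Notation aform := (dform (@aff_hform _ gd)).
Local Notation fl := (@qform_linear _ gd).
Local Notation fs := (@qform_sym _ gd).
Local Notation afl := (@aform_linear _ gd).
Local Notation afs := (@aform_sym _ gd).
Hypothesis ssD : supersystem form Rt.
Local Notation s_ := (sref form).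
Local Notation S_ := (sref aform).

Lemma Sref_ext a x (c : C) : S_ (E a) (E x + c *: dl) = E (s_ a x) + c *: dl.
Proof.
rewrite /sref; have := aform_ext x a c 0; rewrite scale0r addr0 => ->.
by rewrite aform_extE extB extZ addrAC.
Qed.
Lemma Sref_extE a x : S_ (E a) (E x) = E (s_ a x).
Proof. by have := Sref_ext a x 0; rewrite scale0r !addr0. Qed.

Lemma aformDl x y z : aform (x + y) z = aform x z + aform y z.
Proof. exact: (fDl afl). Qed.
Lemma aformNl x z : aform (- x) z = - aform x z.
Proof. exact: (fNl afl). Qed.
Lemma aform_dlE x : aform dl (E x) = 0.
Proof. by have := aform_delta x 0; rewrite scale0r addr0. Qed.

(** Since [(delta - th, b i) = - (th, b i)], the affine simple root gains [b i] exactly when the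
    highest root loses it. *)
Lemma odd_reflexion_affine n (b : 'I_n -> Hf) th i : good_base Rt b ->
  locally_highest Rt b th -> form (b i) (b i) = 0 ->
  odd_reflexion (E (b i)) (affine_base b th) =
  affine_base (odd_refl form b i) (highest_odd form b i th).
Proof.
move=> gb lh iso; have [[fb Db _ _] _] := gb.
have Ei j : E (b j) = E (b i) -> j = i by move=> /ext_inj /(base_inj fb).
have di x : dl - E x <> E (b i).
  move=> H; have : E (- x) + 1 *: dl = E (b i) + 0 *: dl.
    by rewrite scale1r scale0r addr0 -H extN addrC.
  by move=> /ext_eq [_ /eqP]; rewrite oner_eq0.
have fd x : aform (dl - E x) (E (b i)) = - form x (b i).
  by rewrite aformDl aformNl aform_dlE aform_extE add0r.
apply/seteqP; split=> w.
  case=> [->|[x [Sx xi fx ->]]|[Sx xi fx]].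
  - by right; exists i; rewrite odd_refl_i extN.
  - case: Sx xi fx => [->|[j ->]].
      move=> _; rewrite fd => /eqP; rewrite oppr_eq0 => fx; left.
      by rewrite /highest_odd (negbTE fx) extB opprB addrA addrAC.
    rewrite aform_extE => ji fj; right; exists j.
    by rewrite odd_refl_nonorth // extD.
  case: Sx xi fx => [->|[j ->]].
    move=> _; rewrite fd => /eqP; rewrite oppr_eq0 => fx; left.
    by rewrite /highest_odd fx.
  rewrite aform_extE => ji fj; right; exists j.
  by rewrite odd_refl_orth //; apply/eqP => ij; apply: ji; rewrite ij.
case=> [->|[j ->]].
  rewrite /highest_odd; case: eqP => fx.
    apply: Or33; split; [by left|exact: di|by rewrite fd fx oppr0].
  apply: Or32; exists (dl - E th); split; [by left|exact: di| |].
    by rewrite fd => /eqP; rewrite oppr_eq0 => /eqP.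
  by rewrite extB opprB addrA addrAC.
have [->|ji] := eqVneq j i; first by apply: Or31; rewrite odd_refl_i extN.
have ji' : E (b j) <> E (b i) by move=> /Ei /eqP; apply/negP.
have [fj|fj] := EM (form (b j) (b i) = 0).
  apply: Or33; rewrite odd_refl_orth // aform_extE; split=> //.
  by right; exists j.
apply: Or32; exists (E (b j)); rewrite odd_refl_nonorth // aform_extE extD.
by split=> //; right; exists j.
Qed.

Variable S : set Hs.
Local Notation re := (re_bar af S).

Definition weyl_invariant (t : Hs -> Hs) := forall x, re x -> re (t x).

Lemma weyl_invariant_principal a : principal_roots af S a -> weyl_invariant (S_ a).
Proof.
move=> pa _ [w [S1 [x [Ww SS1 S1x ->]]]].
exists (S_ a \o w), S1, x; split=> //; exact: (weyl_refl pa Ww).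
Qed.

Lemma even_or_double a : Rt a -> form a a <> 0 ->
  roots_of_parity io false a \/ roots_of_parity io false (a + a).
Proof.
move=> /q_rootsP [[] pa] fa; last by left.
by right; apply: contrapT => H; apply/fa/odd_root_isotropic.
Qed.

Lemma re_base S1 x : Sp S S1 -> S1 x -> re x.
Proof. by move=> H1 H2; exists id, S1, x; split=> //; exact: weyl_id. Qed.

(** Principal roots are even. If the simple root is odd and not isotropic, its double is even and
    has the same reflection. *)
Lemma weyl_invariant_simple S1 a (m : int) : Sp S S1 -> S1 (E a + m%:~R *: dl) ->
  Rt a -> form a a <> 0 -> weyl_invariant (S_ (E a + m%:~R *: dl)).
Proof.
move=> SS1 S1a Ra fa; set x := E a + _.
case: (even_or_double Ra fa) => pa.
  apply: weyl_invariant_principal; split.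
    exact: (ext_aff_root_parity af ld m pa).
  by exists S1; split=> //; left.
have h2 : (2 : C) != 0 by rewrite pnatr_eq0.
rewrite -(sref_scale x afl afs h2); apply: weyl_invariant_principal.
have E2 : 2 *: x = E (a + a) + (m + m)%:~R *: dl.
  by rewrite scaler_nat mulr2n /x extD rmorphD /= scalerDl addrACA.
split; first by rewrite E2; exact: (ext_aff_root_parity af ld _ pa).
exists S1; split=> //; right.
by rewrite scalerA mulVf // scale1r.
Qed.

(** An isotropic simple root is negated by its odd reflection, any other one by its even
    reflection. *)
Lemma re_simpleN S1 a (m : int) : Sp S S1 -> S1 (E a + m%:~R *: dl) ->
  Rt a -> re (- (E a + m%:~R *: dl)).
Proof.
move=> SS1 S1a Ra; have faE := aform_ext a a (m%:~R) (m%:~R).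
have [fa|fa] := EM (form a a = 0).
  apply: (@re_base (odd_reflexion (E a + m%:~R *: dl) S1)); last by apply: Or31.
  by apply: Sp_step => //; rewrite faE.
rewrite -(sref_id (f := aform)); last by rewrite faE.
by apply: (weyl_invariant_simple SS1) => //; exact: (re_base SS1 S1a).
Qed.

(** The half mirrors [real_roots]: the double of an odd root enters through that root. The
    reflection is carried along because conjugation at even steps needs it. *)
Definition is_reachable a :=
  (re (E a) \/ re (2^-1 *: E a)) /\ (form a a <> 0 -> weyl_invariant (S_ (E a))).

Lemma reachable_simple S1 a : Sp S S1 -> S1 (E a) -> Rt a ->
  is_reachable a /\ is_reachable (- a).
Proof.
move=> SS1 S1a Ra.
have S1a' : S1 (E a + 0%:~R *: dl) by rewrite scale0r addr0.
have N1 : (-1 : C) != 0 by rewrite oppr_eq0 oner_eq0.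
have W : form a a <> 0 -> weyl_invariant (S_ (E a)).
  move=> fa; have := weyl_invariant_simple SS1 S1a' Ra fa.
  by rewrite scale0r addr0.
split; split=> //.
- by left; exact: (re_base SS1 S1a).
- left; rewrite extN; have := re_simpleN SS1 S1a' Ra.
  by rewrite scale0r addr0.
- rewrite (fNl fl) (fNr fl fs) opprK => /W.
  by rewrite extN -scaleN1r (sref_scale _ afl afs N1).
Qed.

Lemma reachable_double a : is_reachable a /\ is_reachable (- a) ->
  re (E a) -> re (E (- a)) -> form a a <> 0 ->
  is_reachable (a *+ 2) /\ is_reachable (- (a *+ 2)).
Proof.
move=> [[_ W1] _] r1 r2 fa.
have h2 : (2 : C) != 0 by rewrite pnatr_eq0.
have N2 : (-2 : C) != 0 by rewrite oppr_eq0.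
split; split.
- by right; rewrite -scaler_nat extZ scalerA mulVf // scale1r.
- by move=> _; rewrite -scaler_nat extZ (sref_scale _ afl afs h2); exact: W1.
- right; rewrite -mulNrn -scaler_nat extZ scalerA mulVf // scale1r //.
- by move=> _; rewrite -scaler_nat -scaleNr extZ (sref_scale _ afl afs N2); exact: W1.
Qed.

Definition reached n (b : 'I_n -> Hf) :=
  exists th, locally_highest Rt b th /\ Sp S (affine_base b th).

Lemma reached_odd n (b : 'I_n -> Hf) i : good_base Rt b ->
  form (b i) (b i) = 0 -> reached b -> reached (odd_refl form b i).
Proof.
move=> gb iso [th [lh Sb]]; exists (highest_odd form b i th); split.
  exact: (locally_highest_odd fl fs ssD (proj1 gb) iso).
rewrite -odd_reflexion_affine //; apply: Sp_step => //; first by right; exists i.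
by rewrite aform_extE.
Qed.

Lemma reachable_conj a x : form a a <> 0 -> weyl_invariant (S_ (E a)) ->
  is_reachable (s_ a x) -> is_reachable x.
Proof.
move=> fa W [H1 H2].
have afa : aform (E a) (E a) <> 0 by rewrite aform_extE.
have sK := srefK afl afa; split.
  by case: H1 => /W H; [left|right]; move: H; rewrite ?(srefZ afl) Sref_extE (srefK fl fa).
move=> fx y ry; have fx' : form (s_ a x) (s_ a x) <> 0 by rewrite (f_sref fl fs fa).
rewrite -[x](srefK fl fa) -Sref_extE (sref_conj afl afs afa).
by apply/W/(H2 fx')/W.
Qed.

Lemma height_pos n (b : 'I_n -> Hf) (h : Hf -> C) :
  linear (h : Hf -> C^o) -> (forall i, h (b i) = 1) ->
  forall y, Rt y -> Pos b y -> 0 < h y.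
Proof.
move=> hl h1 y Ry [k Ey]; have [hD hZ] := scalar_linear hl.
have hy : h y = (\sum_i k i)%:R.
  rewrite Ey natr_sum (big_morph h hD (_ : h 0 = 0)).
    by apply: eq_bigr => i _; rewrite -scaler_nat hZ h1 mulr1.
  by rewrite -(scale0r 0) hZ mul0r.
rewrite hy ltr0n lt0n; apply/negP; rewrite sum_nat_eq0 => /forallP k0.
by case: (ss_neq0 ssD Ry); rewrite Ey big1 // => i _; have /= /eqP -> := k0 i.
Qed.

(** The chain starts at minus the height, which is negative on all positive roots, and ends with a
    functional that is negative on none. So each root, followed along the chain, becomes simple or
    twice a simple root at some step. *)
Lemma chain_reachable n (b : 'I_n -> Hf) (h : Hf -> C) :
  linear (h : Hf -> C^o) -> (forall i, h (b i) = 1) ->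
  good_base Rt b -> reached b -> forall x, Rt x -> is_reachable x.
Proof.
move=> hl h1 gb rb.
pose K n (b : 'I_n -> Hf) (h : Hf -> C) := reached b ->
  forall x, Rt x -> Pos b x -> h x < 0 -> is_reachable x /\ is_reachable (- x).
have Kchain h' : linear (h' : Hf -> C^o) -> (forall x, Rt x -> h' x \is Num.real)
  -> K n b h'.
  move=> hl' hr; apply: (chain_ind fl fs ssD (K := @K n)) => // {h h' hl hl' h1 hr b gb rb}.
  - move=> b h gb hl hb _ x Rx [k ->]; have [hD hZ] := scalar_linear hl.
    suff : 0 <= h (\sum_i b i *+ k i) by move=> /le_gtF ->.
    elim/big_rec: _ => [|i y _ IH]; first by rewrite -(scale0r 0) hZ mul0r.
    by rewrite hD addr_ge0 // -scaler_nat hZ mulr_ge0 ?ler0n.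
  - move=> b h i gb hl iso hi KE rb x Rx Px hx; have [[fb Db _ _] _] := gb.
    have [->|xi] := EM (x = b i).
      have [th [lh Sb]] := rb; apply: (reachable_simple Sb) => //.
      by right; exists i.
    apply: KE => //; first exact: reached_odd.
    exact: (Pos_odd_refl_ss ssD (proj1 gb) iso).
  move=> b h i gb hl niso hi KE rb x Rx Px hx; have [[fb Db _ _] _] := gb.
  have [th [lh Sb]] := rb.
  have Sbi : affine_base b th (E (b i)) by right; exists i.
  have ri := reachable_simple Sb Sbi (Db i).
  have [->//|xi] := EM (x = b i).
  have [->|xi2] := EM (x = b i *+ 2).
    apply: reachable_double => //; first exact: (re_base Sb Sbi).
    have := re_simpleN (a := b i) (m := 0) Sb; rewrite scale0r addr0 extN.
    exact.
  have W : weyl_invariant (S_ (E (b i))) by have [[_ /(_ niso)]] := ri.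
  have [|||r1 r2] := KE rb (s_ (b i) x).
  - exact: (D_sref ssD).
  - exact: (Pos_sref ssD gb niso).
  - by rewrite (srefK fl niso).
  split; first exact: (reachable_conj niso W r1).
  by apply: (reachable_conj niso W); rewrite (srefN fl); exact: r2.
move=> x Rx; have [[fb Db cov dec] uh] := gb.
have [hD hZ] := scalar_linear hl.
have hN y : h (- y) = - h y by rewrite -scaleN1r hZ mulN1r.
have hP := height_pos hl h1.
have hl' : linear ((fun y => - h y) : Hf -> C^o).
  by move=> c u v; rewrite hl opprD scalerN.
have hr y : Rt y -> - h y \is Num.real.
  move=> Ry; rewrite realN; case: (cov _ Ry) => P.
    by apply: gtr0_real; exact: hP.
  by rewrite -realN -hN; apply/gtr0_real/hP => //; exact: (ss_opp ssD).
have key y : Rt y -> Pos b y -> is_reachable y /\ is_reachable (- y).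
  by move=> Ry Py; apply: (Kchain _ hl' hr) => //; rewrite oppr_lt0; exact: hP.
case: (cov _ Rx) => P; first by have [] := key _ Rx P.
by have [_] := key _ (ss_opp ssD Rx) P; rewrite opprK.
Qed.

End RealRoots.

Section LongRoots.
Variables (C : numClosedFieldType) (V : lmodType C).
Variables (f : V -> V -> C) (D : set V).
Hypothesis f_linear : forall y, linear (f^~ y : V -> C^o).
Hypothesis f_sym : forall x y, f x y = f y x.
Hypothesis ssD : supersystem f D.
Local Notation fE := (fE f_linear f_sym).

Lemma long_sref a x : D a -> f a a <> 0 -> long_root f D x ->
  long_root f D (sref f a x).
Proof.
move=> Da fa [Dx fx Hx].
have sK : involutive (sref f a) by exact: (srefK f_linear).
have ff := f_sref f_linear f_sym fa.
split; [exact: (D_sref ssD)|by rewrite ff|move=> y Dy].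
case: (Hx (sref f a y)); first exact: (D_sref ssD).
- by move=> E; apply: Or31; rewrite -[y]sK E.
- by move=> E; apply: Or32; rewrite -[y]sK E (srefN f_linear).
by move=> [c cb E]; apply: Or33; exists c => //; rewrite ff -{1}[y]sK ff.
Qed.

Lemma long_opp x : long_root f D x -> long_root f D (- x).
Proof.
move=> [Dx fx Hx]; split; first exact: (ss_opp ssD).
  by rewrite !fE opprK.
move=> y Dy; case: (Hx _ Dy) => [->|->|[c cb E]].
- by apply: Or32; rewrite opprK.
- exact: Or31.
apply: Or33; exists (- c); first by lia.
by rewrite !fE opprK mulrN E rmorphN mulNr.
Qed.

Lemma long_real x y : long_root f D x -> D y -> 2 * f y x / f x x \is Num.real.
Proof.
move=> [Dx fx Hx] Dy; have [c -> _] := ss_refl ssD Dx fx Dy.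
by rewrite mulfK ?realz //; apply/eqP.
Qed.

(** The sum [x + b j] would have Cartan integer at least 2 against the long root [x], which only [x]
    itself has. *)
Lemma long_locally_highest n (b : 'I_n -> V) x : good_base D b ->
  long_root f D x -> (forall i, 0 <= 2 * f (b i) x / f x x) ->
  locally_highest D b x.
Proof.
move=> [[fb Db _ _] _] [Dx fx Hx] hb; split=> // j.
have fx0 : f x x != 0 by exact/eqP.
have h2 : 2 * f x x / f x x = 2 by rewrite mulfK.
have hj : 2 <= 2 * f (x + b j) x / f x x.
  by rewrite !fE mulrDr mulrDl h2 lerDl.
split; last by move=> x0; move: hj; rewrite x0 (f0l f_linear) mulr0 mul0r (ler_nat _ 2 0).
move=> /Hx [E|E|[c cb E]].
- by apply: (base_neq0 fb (i := j)); apply: (addrI x); rewrite addr0.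
- by move: hj; rewrite E !fE mulrN mulNr h2 -subr_le0 opprK -natrD (ler_nat _ 4 0).
by move: hj; rewrite E mulfK // (ler_int _ 2 c); lia.
Qed.

End LongRoots.

(** * Affine reflections and translations by multiples of delta *)

Section AllReal.
Variables (C : numClosedFieldType) (gd : quadLSA C) (D N : set gd).
Variables (g : lieSuperalgebra C) (af : affinisation D N g).
Hypothesis ld : loop_data D N.
Local Notation Hf := 'Hom(q_H gd, C^o).
Local Notation Hs := 'Hom(aff_H gd, C^o).
Local Notation Rt := (@q_roots _ gd).
Local Notation E := (@ext_weight _ gd).
Local Notation dl := (delta gd).
Local Notation form := (dform (@q_hform _ gd)).
Local Notation aform := (dform (@aff_hform _ gd)).
Local Notation fl := (@qform_linear _ gd).
Local Notation fs := (@qform_sym _ gd).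
Local Notation afl := (@aform_linear _ gd).
Local Notation afs := (@aform_sym _ gd).
Hypothesis ssD : supersystem form Rt.
Local Notation s_ := (sref form).
Local Notation S_ := (sref aform).
Variable S : set Hs.
Local Notation re := (re_bar af S).
Local Notation Winv := (weyl_invariant af S).
Local Notation reached := (reached S).

Lemma Sref_dl x a (c : C) :
  S_ (dl - E a) (E x + c *: dl) =
  E x + c *: dl + (2 * form x a / form a a) *: (dl - E a).
Proof.
have Ea : dl - E a = E (- a) + 1 *: dl by rewrite scale1r extN addrC.
rewrite {1}/sref Ea !aform_ext !(fE fl fs) opprK mulrN mulNr.
by rewrite scaleNr opprK.
Qed.

Lemma Sref_affine a : Rt a -> form a a <> 0 -> forall x,
  S_ (E a) (dl - E x) = dl - E (s_ a x).
Proof.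
move=> Ra fa x; have := Sref_ext a (- x) 1; rewrite scale1r extN addrC => ->.
by rewrite (srefN fl) extN addrC.
Qed.

Definition affine_reflectable a := re (dl - E a) /\ Winv (S_ (dl - E a)).

(** Follow the chain for the Cartan integers against [a]: odd steps change the base, even steps move
    [a]. At its end [a] is dominant, hence locally highest, hence equal to [th] by uniqueness, so
    that [delta - a] is simple. *)
Lemma chain_long n (b0 : 'I_n -> Hf) : good_base Rt b0 -> reached b0 ->
  forall a, long_root form Rt a -> affine_reflectable a.
Proof.
move=> gb0 rb0 a0 La0.
pose K (b : 'I_n -> Hf) (h : Hf -> C) := reached b ->
  forall a, long_root form Rt a -> (forall x, h x = 2 * form x a / form a a) ->
  affine_reflectable a.
suff : K b0 (fun x => 2 * form x a0 / form a0 a0) by apply.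
have hl0 : linear ((fun x => 2 * form x a0 / form a0 a0) : Hf -> C^o).
  by move=> c x y; rewrite !(fE fl fs) scale_regularE; ring.
apply: (chain_ind fl fs ssD (K := K)) => //; last 1 first.
- by move=> x Rx; apply: (long_real ssD).
- move=> b h gb hl hb [th [lh Sb]] a La hE.
  have La' := La; have [Ra fa _] := La'; have [_ uh] := gb.
  have la : locally_highest Rt b a.
    by apply: (long_locally_highest fl gb La) => i; rewrite -hE.
  rewrite -(uh _ _ la lh) in Sb.
  have Ea : dl - E a = E (- a) + 1%:~R *: dl by rewrite scale1r extN addrC.
  split; first by apply: (re_base af Sb); left.
  rewrite Ea; apply: (weyl_invariant_simple ld Sb).
  - by left; rewrite Ea.
  - exact: (ss_opp ssD).
  - by rewrite !(fE fl fs) opprK.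
- move=> b h i gb hl iso hi KE rb a La hE; apply: KE => //.
  exact: (reached_odd ssD).
move=> b h i gb hl niso hi KE rb a La hE; have [[fb Db _ _] _] := gb.
have [th [lh Sb]] := rb.
have W : Winv (S_ (E (b i))).
  have Sbi : affine_base b th (E (b i) + 0%:~R *: dl).
    by right; exists i; rewrite scale0r addr0.
  have := weyl_invariant_simple ld Sb Sbi (Db i) niso.
  by rewrite scale0r addr0.
have ff := f_sref fl fs niso.
have sK : involutive (s_ (b i)) by exact: (srefK fl).
have afa : aform (E (b i)) (E (b i)) <> 0 by rewrite aform_extE.
have [r1 r2] : affine_reflectable (s_ (b i) a).
  apply: KE => //; first exact: (long_sref fl fs ssD).
  by move=> x; rewrite hE ff -{1}[a]sK ff.
have EE : dl - E a = S_ (E (b i)) (dl - E (s_ (b i) a)).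
  by rewrite Sref_affine // sK.
split; first by rewrite EE; exact: W.
by move=> x rx; rewrite EE (sref_conj afl afs afa); apply/W/r2/W.
Qed.

Definition re_or_half x := re x \/ re (2^-1 *: x).

Section Translations.
Variables (n : nat) (b : 'I_n -> Hf) (h : Hf -> C).
Hypotheses (hl : linear (h : Hf -> C^o)) (h1 : forall i, h (b i) = 1).
Hypotheses (gb : good_base Rt b) (rb : reached b).

(** The product of the reflections in [a] and [delta - a] is a translation on these weights; the two
    orders of the factors give the two signs. *)
Lemma translate a x (c : C) : long_root form Rt a ->
  let k := 2 * form x a / form a a in re_or_half (E x + c *: dl) ->
  re_or_half (E x + (c - k) *: dl) /\ re_or_half (E x + (c + k) *: dl).
Proof.
move=> La k; have La' := La; have [Ra fa _] := La'.
have [_ Wd] := chain_long gb rb La.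
have [_ /(_ fa) Wa] := chain_reachable af ld ssD hl h1 gb rb Ra.
pose kk y := 2 * form y a / form a a.
have sE y : s_ a y = y - kk y *: a by [].
have t1 y (d : C) : re (E y + d *: dl) -> re (E y + (d - kk y) *: dl).
  move=> /Wa/Wd; rewrite Sref_ext Sref_dl.
  have -> : form (s_ a y) a = - form y a.
    by rewrite -{2}[a]opprK -[- a](sref_id fa) (fNr fl fs) (f_sref fl fs fa).
  rewrite mulrN mulNr -/(kk y) scaleNr scalerBr opprB scalerBl sE extB extZ.
  suff -> : E y - kk y *: E a + d *: dl + (kk y *: E a - kk y *: dl) =
    E y + (d *: dl - kk y *: dl) by [].
  by rewrite -!addrA; congr (_ + _); rewrite addrCA; congr (_ + _);
    rewrite addrA addNr add0r.
have t2 y (d : C) : re (E y + d *: dl) -> re (E y + (d + kk y) *: dl).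
  move=> /Wd/Wa; rewrite Sref_dl -/(kk y).
  have -> : E y + d *: dl + kk y *: (dl - E a) = E (s_ a y) + (d + kk y) *: dl.
    rewrite sE extB extZ scalerBr scalerDl -!addrA; congr (_ + _).
    by rewrite [RHS]addrC addrA.
  by rewrite Sref_ext (srefK fl fa).
have half y (d : C) : 2^-1 *: (E y + d *: dl) = E (2^-1 *: y) + (2^-1 * d) *: dl.
  by rewrite scalerDr extZ scalerA.
have kh y : kk (2^-1 *: y) = 2^-1 * kk y by rewrite /kk (fZl fl) mulrCA !mulrA.
case=> [H|]; first by split; left; [exact: t1|exact: t2].
rewrite /re_or_half half => H; split; right; rewrite half.
  by rewrite mulrBr -kh; exact: t1.
by rewrite mulrDr -kh; exact: t2.
Qed.

(** A root with Cartan integer 1 or -1 against a long root moves by single steps of [delta]. A long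
    root moves by two steps under its own translation; its odd multiples start from [a + delta],
    which [chain_long] gives for [- a]. *)
Lemma all_re a (m : int) : Rt a -> re_or_half (E a + m%:~R *: dl).
Proof.
move=> Ra; have R0 : re_or_half (E a + 0%:~R *: dl).
  by rewrite scale0r addr0; have [] := chain_reachable af ld ssD hl h1 gb rb Ra.
pose P (l : int) := re_or_half (E a + l%:~R *: dl).
have ind (e : int) : (forall l, P l -> P (l - e) /\ P (l + e)) ->
    forall l0, P l0 -> forall n : nat, P (l0 + n%:Z * e) /\ P (l0 - n%:Z * e).
  move=> st l0 P0; elim=> [|q [IH1 IH2]]; first by rewrite !mul0r ?subr0 ?addr0.
  rewrite intS mulrDl mul1r; split.
    by have [_] := st _ IH1; rewrite -addrA [q%:Z * e + e]addrC.
  by have [] := st _ IH2; rewrite -addrA -opprD [q%:Z * e + e]addrC.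
case: (ss_long ssD Ra) => [La|[x Lx kx]]; last first.
  have [_ fx _] := Lx.
  have step l : P l -> P (l - 1) /\ P (l + 1).
    move=> /(translate Lx) [] /=; rewrite /P rmorphB rmorphD /=.
    have : 2 * form a x / form x x = 1 \/ 2 * form a x / form x x = -1.
      by case: kx => ->; [left|right]; rewrite ?mulNr divff //; exact/eqP.
    by case=> ->; rewrite ?opprK.
  case: m => q; first by have [] := ind 1 step 0 R0 q; rewrite mulr1 add0r.
  by have [_] := ind 1 step 0 R0 q.+1; rewrite mulr1 add0r -NegzE.
have [_ fa _] := La.
have step l : P l -> P (l - 2) /\ P (l + 2).
  move=> /(translate La) [] /=; rewrite mulfK; last exact/eqP.
  have e2 : (2 : int)%:~R = 2 :> C by [].
  by rewrite /P (rmorphB _ l 2) (rmorphD _ l 2) /= e2.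
have R1 : P 1.
  have [H _] := chain_long gb rb (long_opp fl fs ssD La).
  by left; move: H; rewrite extN opprK scale1r addrC.
have mE : m = (m %% 2)%Z + (m %/ 2)%Z * 2 by rewrite addrC -divz_eq.
have Pm2 : P (m %% 2)%Z.
  have : (m %% 2)%Z = 0 \/ (m %% 2)%Z = 1 by lia.
  by case=> ->.
rewrite -/(P m) mE; case: (m %/ 2)%Z => q.
  by have [] := ind 2 step _ Pm2 q.
by have [_] := ind 2 step _ Pm2 q.+1; rewrite NegzE mulNr.
Qed.

End Translations.
End AllReal.

(** * Odd reflections of affine bases *)

Section AffineOdd.
Variables (C : numClosedFieldType) (gd : quadLSA C).
Local Notation Hf := 'Hom(q_H gd, C^o).
Local Notation Hs := 'Hom(aff_H gd, C^o).
Local Notation Rt := (@q_roots _ gd).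
Local Notation E := (@ext_weight _ gd).
Local Notation dl := (delta gd).
Local Notation form := (dform (@q_hform _ gd)).
Local Notation aform := (dform (@aff_hform _ gd)).
Local Notation fl := (@qform_linear _ gd).
Hypothesis ssD : supersystem form Rt.

Definition affw (a : Hf) (m : int) : Hs := E a + m%:~R *: dl.

Lemma affwD a a' m m' : affw a m + affw a' m' = affw (a + a') (m + m').
Proof. by rewrite /affw extD rmorphD /= scalerDl addrACA. Qed.
Lemma affwN a m : - affw a m = affw (- a) (- m).
Proof. by rewrite /affw extN rmorphN /= scaleNr opprD. Qed.
Lemma affwB a a' m m' : affw a m - affw a' m' = affw (a - a') (m - m').
Proof. by rewrite affwN affwD. Qed.
Lemma affw_inj a a' m m' : affw a m = affw a' m' -> a = a' /\ m = m'.
Proof. by move=> /ext_eq [-> /intr_inj]. Qed.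
Lemma affw00 : affw 0 0 = 0.
Proof. by rewrite /affw ext0 scale0r addr0. Qed.
Lemma affw_eq0 a m : affw a m = 0 -> a = 0 /\ m = 0.
Proof. by rewrite -affw00 => /affw_inj. Qed.
Lemma affw_dl : affw 0 1 = dl. Proof. by rewrite /affw ext0 add0r scale1r. Qed.
Lemma aform_affw a a' m m' : aform (affw a m) (affw a' m') = form a a'.
Proof. exact: aform_ext. Qed.

Definition affine_real : set Hs := [set w | exists a m, Rt a /\ w = affw a m].
(** Imaginary roots take part in the splitting of positive roots, as in
    [a + 2 delta = (a + delta) + delta]. *)
Definition affine_all : set Hs :=
  [set w | exists a m, [/\ Rt a \/ a = 0, a <> 0 \/ m <> 0 & w = affw a m]].

Lemma affine_realW w : affine_real w -> affine_all w.
Proof.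
move=> [a [m [Ra ->]]]; exists a, m; split=> //; left => //.
exact: (ss_neq0 ssD).
Qed.

Lemma affine_root a m : Rt a -> affine_all (affw a m).
Proof. by move=> Ra; apply: affine_realW; exists a, m. Qed.

Lemma affine_imag m : m <> 0 -> affine_all (affw 0 m).
Proof. by move=> m0; exists 0, m; split=> //; right. Qed.

Lemma affine_all0 w : affine_all w -> w <> 0.
Proof. by move=> [a [m [_ am ->]]] /affw_eq0 [a0 m0]; case: am. Qed.

Lemma affine_allN w : affine_all w -> affine_all (- w).
Proof.
move=> [a [m [Ra am ->]]]; rewrite affwN; exists (- a), (- m); split=> //.
- by case: Ra => [/(ss_opp ssD)|->]; [left|right; rewrite oppr0].
- by case: am => H; [left|right] => /eqP; rewrite oppr_eq0 => /eqP.
Qed.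

Lemma affine_all_sum a m : Rt a \/ a = 0 -> affw a m <> 0 -> affine_all (affw a m).
Proof.
move=> Ra n0; exists a, m; split=> //.
have [a0|] := EM (a = 0); last by left.
by right => m0; apply: n0; rewrite a0 m0 affw00.
Qed.

Definition affine_good n (b : 'I_n -> Hs) :=
  [/\ root_base affine_all b, forall i, affine_real (b i) & Pos b dl].

Section Step.
Variables (n : nat) (b : 'I_n -> Hs) (i : 'I_n).
Hypothesis ag : affine_good b.
Hypothesis iso : aform (b i) (b i) = 0.

Let rb : root_base affine_all b. Proof. by case: ag. Qed.
Let fb : lin_indep b. Proof. by case: rb. Qed.
Let Db j : affine_all (b j). Proof. by case: rb. Qed.
Let cov w : affine_all w -> Pos b w \/ Pos b (- w).
Proof. by case: rb => _ _ + _; apply. Qed.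
Let Pdl m : 0 <= m -> Pos b (affw 0 m).
Proof.
case: m => // m _; elim: m => [|m IH]; first by rewrite affw00; exact: Pos0.
by rewrite -addn1 PoszD -[0]addr0 -affwD affw_dl; apply: PosD => //; case: ag.
Qed.

(** [l] is the least integer making [x + l delta] positive. The pair of positive roots at the
    threshold, with sum [delta], is used to split roots that involve an imaginary summand. *)
Lemma affine_threshold x : Rt x -> exists l : int,
  Pos b (affw x l) /\ Pos b (affw (- x) (1 - l)).
Proof.
move=> Rx; have [_ _ [d Ed]] := ag.
have [j dj] : exists j, (0 < d j)%N.
  apply: contrapT => /forallNP H.
  have /affine_all0 : affine_all dl by rewrite -affw_dl; exact: affine_imag.
  by apply; rewrite Ed big1 // => j _; have /negP := H j; rewrite -eqn0Ngt => /eqP ->.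
have up l (p : nat) : Pos b (affw x l) -> Pos b (affw x (l + p%:Z)).
  by move=> P; rewrite -[x]addr0 -affwD; apply: PosD => //; apply: Pdl.
have lo y : Rt y -> exists p : nat, Pos b (affw y p).
  move=> Ry; have A0 := affine_root 0 Ry.
  case: (cov A0) => [|[k Ek]]; first by exists 0%N.
  exists (k j).+1; case: (cov (affine_root (k j).+1 Ry)) => // -[q Eq].
  (* Otherwise comparing the coefficients of [b j] would give [k j = q j + d j * (k j + 1)],
     impossible for [d j > 0]. *)
  have := @lin_indep_inj_nat _ _ _ fb (fun i => q i + d i * (k j).+1)%N k.
  under eq_bigr do rewrite mulrnDr mulrnA.
  rewrite big_split /= -Eq sumrMnl -Ed -Ek !affwN -affw_dl => H.
  suff /H /(_ j) : affw (- y) (- (k j).+1%:Z) + affw 0 1 *+ (k j).+1 = affw (- y) (- 0).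
    by case: (d j) dj => // e _; lia.
  have -> (p : nat) : affw 0 1 *+ p = affw 0 p.
    elim: p => [|p IHp]; first by rewrite affw00.
    by rewrite mulrS IHp affwD addr0 -intS.
  by rewrite affwD addr0 addNr oppr0.
have [p Pp] := lo _ Rx.
have [q Pq] := lo _ (ss_opp ssD Rx).
have neg : ~ Pos b (affw x (- q%:Z - 1)).
  move=> P; have := PosD P Pq; rewrite affwD subrr addrAC addNr add0r => P1.
  have E1 : - affw 0 (-1) = affw 0 1 by rewrite affwN oppr0 opprK.
  have := Pos_anti fb P1; rewrite E1 => /(_ (Pdl (m := 1) isT)).
  by move/affw_eq0 => [].
have ex : exists r, `[< Pos b (affw x (r%:Z - q%:Z - 1)) >].
  exists (p + q + 1)%N; apply/asboolP.
  suff -> : (p + q + 1)%N%:Z - q%:Z - 1 = p by [].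
  by lia.
case: (ex_minnP ex) => r /asboolP Pr minr.
case: r Pr minr => [|r] Pr minr.
  by case: neg; move: Pr; rewrite sub0r.
exists (r.+1%:Z - q%:Z - 1); split=> //.
have nP : ~ Pos b (affw x (r%:Z - q%:Z - 1)).
  by move=> /asboolP/minr; rewrite ltnn.
case: (cov (affine_root (r%:Z - q%:Z - 1) Rx)) => //; rewrite affwN.
suff -> : - (r%:Z - q%:Z - 1) = 1 - (r.+1%:Z - q%:Z - 1) by [].
by lia.
Qed.

Let D0 w : affine_all w -> w <> 0. Proof. exact: affine_all0. Qed.

(** As in the finite case, except when an imaginary root intervenes. A root [b i + m delta] is split
    along [be = x + (be - x)], an imaginary root along a finite root and its negative, the multiples
    of [delta] being chosen by [affine_threshold]. *)
Lemma affine_split : odd_split aform affine_all b i.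
Proof.
have [_ Rb _] := ag; have [be [p [Rbe Ebe]]] := Rb i.
have isob : form be be = 0 by have := iso; rewrite Ebe aform_affw.
have R0 x : Rt x -> x <> 0 by exact: (ss_neq0 ssD).
have nR2 : ~ Rt (be + be).
  by move=> R2; have := @ss_mul _ _ _ _ ssD be 2 isT Rbe; rewrite mulr2n => /(_ R2) [].
have n2 : be + be <> 0.
  by move=> /eqP; rewrite -mulr2n -scaler_nat scaler_eq0 pnatr_eq0 => /eqP; exact: R0.
have [_ _ _ dec] := rb.
have Pi : Pos b (b i) by exact: Pos_base.
have ge1 m : affw 0 m <> 0 -> Pos b (affw 0 m) -> 1 <= m.
  move=> n0 P; rewrite leNgt; apply/negP => m1; apply: n0.
  by apply: (Pos_anti fb P); rewrite affwN oppr0; apply: Pdl; lia.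
have [x [Rx Rbx]] : exists x, Rt x /\ Rt (be - x).
  have [y Ry fy] := ss_nonorth ssD Rbe isob.
  have RyN := ss_opp ssD Ry.
  case: (ss_iso ssD Rbe isob Ry fy) => H; first by exists (- y); rewrite opprK addrC.
  by exists y; rewrite -opprB; split=> //; apply: (ss_opp ssD).
have xbe : x <> be by move=> E1; apply: (R0 _ Rbx); rewrite E1 subrr.
have [l [Pl PlN]] := affine_threshold Rx.
have key w y : affine_all w -> affine_all y -> Pos b w -> Pos b y ->
    y <> b i -> w = y + b i ->
  [\/ exists2 j, j != i & w = b j,
      exists2 j, aform (b j) (b i) <> 0 & w = b j + b i |
      exists y z, [/\ affine_all y, affine_all z, Pos b y /\ Pos b z, w = y + z
                    & y <> b i /\ z <> b i]].
  move=> Aw Ay Pw Py yi Ew; have [a [m [Ra am Ey]]] := Ay.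
  case: Ra am => [Ra|a0] am; last first.
    have m1 : 1 <= m by apply: ge1; rewrite -a0 -Ey //; exact: D0.
    apply: Or33; exists (affw x l), (affw (be - x) (p + m - l)); split.
    - exact: affine_root.
    - exact: affine_root.
    - split=> //; have -> : affw (be - x) (p + m - l) =
        b i + (affw 0 (m - 1) + affw (- x) (1 - l)).
        rewrite Ebe !affwD add0r; congr affw; lia.
      by apply: PosD => //; apply: PosD => //; apply: Pdl; lia.
    - by rewrite Ew Ey a0 Ebe !affwD add0r; congr affw; [rewrite addrC subrK|lia].
    split; first by rewrite Ebe => /affw_inj [].
    rewrite Ebe => /affw_inj [/(canRL (subrK _)) E1 _]; apply: (R0 _ Rx).
    by apply: (addrI be); rewrite addr0 -E1.
  have [ab0|ab0] := EM (a + be = 0).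
    have Ew' : w = affw 0 (m + p) by rewrite Ew Ey Ebe affwD ab0.
    have m1 : 1 <= m + p by apply: ge1; rewrite -Ew' //; exact: D0.
    have [z [Rz zb zNb]] : exists z, [/\ Rt z, z <> be & - z <> be].
      have [z Rz fz] := ss_nonorth ssD Rbe isob; exists z; split=> // E1.
        by rewrite E1 isob in fz.
      by rewrite -[z]opprK E1 (fNl fl) isob oppr0 in fz.
    have [l' [Pl' PlN']] := affine_threshold Rz.
    apply: Or33; exists (affw z l'), (affw (- z) (m + p - l')); split.
    - exact: affine_root.
    - by apply: affine_root; exact: (ss_opp ssD).
    - split=> //; have -> : affw (- z) (m + p - l') =
        affw 0 (m + p - 1) + affw (- z) (1 - l').
        by rewrite affwD add0r; congr affw; lia.
      by apply: PosD => //; apply: Pdl; lia.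
    - by rewrite Ew' affwD subrr; congr affw; lia.
    by split; rewrite Ebe => /affw_inj [].
  have Rab : Rt (a + be).
    have [a' [m' [Ra' _ E1]]] := Aw; move: E1.
    rewrite Ew Ey Ebe affwD => /affw_inj [E1 _]; rewrite E1 in ab0 *.
    by case: Ra'.
  have fab := ss_iso_orth ssD Rbe isob Ra Rab.
  case: (dec _ Ay Py) => [[j Ej]|[c [d [Ac Ad Pc Pd Ecd]]]].
    by apply: Or32; exists j; rewrite -?Ej // Ey Ebe aform_affw.
  have [c0 [c1 [Rc cn Ec]]] := Ac; have [d0 [d1 [Rd dn Ed]]] := Ad.
  have [Eacd _] : a = c0 + d0 /\ m = c1 + d1.
    by apply: affw_inj; rewrite -affwD -Ey -Ec -Ed.
  have ni u v : a = u + v -> Rt u \/ u = 0 -> v <> be.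
    move=> E1 Ru vb; rewrite {}vb in E1; case: Ru => [Ru|u0]; last first.
      by apply: nR2; move: Rab; rewrite E1 u0 add0r.
    apply: (ss_iso_string ssD Rbe isob Ru); rewrite -E1 //.
  have di : d <> b i.
    by rewrite Ed Ebe => /affw_inj [E1 _]; exact: (ni _ _ Eacd Rc E1).
  have ci : c <> b i.
    rewrite Ec Ebe => /affw_inj [E1 _]; apply: (ni d0 c0 _ Rd E1).
    by rewrite addrC.
  have fin u v : affine_all u -> affine_all v -> Pos b u -> Pos b v ->
      v <> b i -> y = u + v -> affine_all (u + b i) ->
      exists y z, [/\ affine_all y, affine_all z, Pos b y /\ Pos b z, w = y + z
                    & y <> b i /\ z <> b i].
    move=> Au Av Pu Pv vi Eu Aui; exists (u + b i), v; split=> //.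
    - by split=> //; apply: PosD.
    - by rewrite Ew Eu addrAC.
    split=> // /(canRL (addrK _)); rewrite subrr; exact: D0.
  have n0 u : affine_all u -> Pos b u -> u + b i <> 0.
    move=> Au Pu E1; apply: (D0 Au); apply: (Pos_anti fb Pu).
    by have -> : - u = b i by rewrite -[LHS]addr0 -E1 addKr.
  have cas : (Rt (c0 + be) \/ c0 + be = 0) \/ (Rt (d0 + be) \/ d0 + be = 0).
    case: Rc => [Rc|->]; last by left; left; rewrite add0r.
    case: Rd => [Rd|->]; last by right; left; rewrite add0r.
    by apply: (ss_iso_split ssD Rbe isob Rc Rd); rewrite -Eacd.
  apply: Or33; case: cas => H.
    apply: (fin c d) => //; rewrite Ec Ebe affwD; apply: affine_all_sum => //.
    by rewrite -affwD -Ec -Ebe; exact: n0.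
  apply: (fin d c) => //; first by rewrite addrC.
  rewrite Ed Ebe affwD; apply: affine_all_sum => //.
  by rewrite -affwD -Ed -Ebe; exact: n0.
move=> w Aw Pw wi; case: (dec _ Aw Pw) => [[j Ej]|[y [z [Ay Az Py Pz E1]]]].
  by apply: Or31; exists j => //; apply/eqP => ji; rewrite ji in Ej.
have [zi|zi] := EM (z = b i).
  have [yi|yi] := EM (y = b i).
    have [a [m [Ra am Ew]]] := Aw; move: E1; rewrite yi zi Ew Ebe affwD.
    by move=> /affw_inj [E1 _]; rewrite E1 in Ra; case: Ra.
  by rewrite zi in E1; exact: (key w y).
have [yi|yi] := EM (y = b i).
  by rewrite yi addrC in E1; exact: (key w z).
by apply: Or33; exists y, z.
Qed.

(** Again the difference of two simple roots is not a root. That the sum is real keeps all bases in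
    [Sp] free of imaginary roots. *)
Lemma affine_add j : aform (b j) (b i) <> 0 -> affine_real (b j + b i).
Proof.
have [_ Rb _] := ag; have [be [p [Rbe Ebe]]] := Rb i.
have [a [m [Ra Ea]]] := Rb j; rewrite Ea Ebe aform_affw affwD => fab.
have isob : form be be = 0 by have := iso; rewrite Ebe aform_affw.
case: (ss_iso ssD Rbe isob Ra fab) => H; first by exists (a + be), (m + p).
have ji : j != i by apply/eqP => ji; rewrite -(aform_affw _ _ m p) -Ea -Ebe ji iso in fab.
have Aji : affine_all (b j - b i) by rewrite Ea Ebe affwB; exact: affine_root.
case: (cov Aji) => [/(base_diff fb ji) //|]; rewrite opprB => /(base_diff fb).
by rewrite eq_sym => /(_ ji).
Qed.

Lemma affine_good_odd : affine_good (odd_refl aform b i).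
Proof.
have [_ Rb _] := ag; have [be [p [Rbe Ebe]]] := Rb i.
have sp := affine_split.
have Aadd j : aform (b j) (b i) <> 0 -> affine_all (b j + b i).
  by move=> /affine_add /affine_realW.
split.
- exact: (root_base_odd_refl rb iso D0 affine_allN Aadd sp).
- move=> j; rewrite /odd_refl; case: eqP => _.
    by rewrite Ebe affwN; exists (- be), (- p); split=> //; exact: (ss_opp ssD).
  by case: eqP => // /affine_add.
apply: (Pos_odd_refl rb iso D0 sp).
- by rewrite -affw_dl; exact: affine_imag.
- by case: ag.
by rewrite Ebe -affw_dl => /affw_inj [b0 _]; apply: (ss_neq0 ssD Rbe).
Qed.

Lemma odd_reflexion_range :
  odd_reflexion (b i) (range b) = range (odd_refl aform b i).
Proof.
have ij j : b j = b i -> j = i by move=> /(base_inj fb).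
apply/seteqP; split=> [w|_ [j _ <-]].
  case=> [->|[_ [[j _ <-] ji fj ->]]|[[j _ <-] ji fj]].
  - by exists i => //; rewrite odd_refl_i.
  - by exists j => //; rewrite odd_refl_nonorth.
  by exists j => //; rewrite odd_refl_orth //; apply/eqP => E1; apply: ji; rewrite E1.
have [->|ji] := eqVneq j i; first by apply: Or31; rewrite odd_refl_i.
have ji' : b j <> b i by move=> /ij /eqP; apply/negP.
have [fj|fj] := EM (aform (b j) (b i) = 0).
  by apply: Or33; rewrite odd_refl_orth //; split=> //; exists j.
by apply: Or32; exists (b j); rewrite odd_refl_nonorth //; split=> //; exists j.
Qed.

End Step.
End AffineOdd.

(** * The initial affine base *)

Section InitialBase.
Variables (C : numClosedFieldType) (gd : quadLSA C).
Local Notation Hf := 'Hom(q_H gd, C^o).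
Local Notation Hs := 'Hom(aff_H gd, C^o).
Local Notation Rt := (@q_roots _ gd).
Local Notation E := (@ext_weight _ gd).
Local Notation form := (dform (@q_hform _ gd)).
Hypothesis ssD : supersystem form Rt.
Variables (n : nat) (b : 'I_n -> Hf) (th : Hf).
Hypothesis gb : good_base Rt b.
Hypothesis lh : locally_highest Rt b th.
Hypothesis gh : forall c, Rt c -> Pos b (th - c).

Definition aff_family (i : 'I_n.+1) : Hs :=
  if unlift ord0 i is Some j then E (b j) else affw (- th) 1.
Local Notation bh := aff_family.

Lemma aff_family0 : bh ord0 = affw (- th) 1.
Proof. by rewrite /aff_family unlift_none. Qed.
Lemma aff_familyS j : bh (lift ord0 j) = affw (b j) 0.
Proof. by rewrite /aff_family liftK /affw scale0r addr0. Qed.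

Lemma range_aff_family : range bh = affine_base b th.
Proof.
apply/seteqP; split=> [_ [i _ <-]|w].
  rewrite /aff_family; case: unliftP => [j _|_]; first by right; exists j.
  by left; rewrite /affw scale1r extN addrC.
case=> [->|[j ->]].
  by exists ord0 => //; rewrite aff_family0 /affw scale1r extN addrC.
by exists (lift ord0 j) => //; rewrite aff_familyS /affw scale0r addr0.
Qed.

Let fb : lin_indep b. Proof. by case: gb => [[]]. Qed.
Let Rb j : Rt (b j). Proof. by case: gb => [[]]. Qed.
Let R0 x : Rt x -> x <> 0. Proof. exact: (ss_neq0 ssD). Qed.
Let RN x : Rt x -> Rt (- x). Proof. exact: (ss_opp ssD). Qed.

Lemma affwMn (a : Hf) m k : affw a m *+ k = affw (a *+ k) (m * k%:Z).
Proof.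
elim: k => [|k IH]; first by rewrite !mulr0n mulr0 affw00.
by rewrite !mulrS IH affwD; congr affw; lia.
Qed.

Let Pos_fin a : Pos b a -> Pos bh (affw a 0).
Proof.
move=> [k Ek]; pose k' (i : 'I_n.+1) := if unlift ord0 i is Some j then k j else 0%N.
have k'0 : k' ord0 = 0%N by rewrite /k' unlift_none.
have k'S j : k' (lift ord0 j) = k j by rewrite /k' liftK.
exists k'; rewrite big_ord_recl k'0 mulr0n add0r Ek.
under [RHS]eq_bigr do rewrite k'S aff_familyS affwMn mul0r.
by elim/big_ind2 : _ => [|x1 x2 y1 y2 <- <-|//]; rewrite ?affw00 ?affwD.
Qed.

Let Pos_0 : Pos bh (affw (- th) 1).
Proof. by rewrite -aff_family0; exact: Pos_base. Qed.

Let Pth : Pos b th.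
Proof.
have [[_ _ cov _] _] := gb; have [Rth _] := lh.
case: (cov _ Rth) => // PN; have P2 := gh (RN Rth).
have := Pos_anti fb P2; rewrite opprK opprD => /(_ (PosD PN PN)).
rewrite -mulr2n -scaler_nat => /eqP; rewrite scaler_eq0 pnatr_eq0 => /eqP th0.
by case: (R0 Rth).
Qed.

(** Write the weight as [(m + 1)(delta - th) + m th + (th + a)]; the last term is positive because
    [th] lies above [- a]. *)
Let Pos_level a (m : nat) : Rt a \/ a = 0 -> Pos bh (affw a m.+1).
Proof.
move=> Ra; have Pm k : Pos bh (affw (- th *+ k) k).
  have -> : affw (- th *+ k) k = affw (- th) 1 *+ k by rewrite affwMn mul1r.
  elim: k => [|k IH]; first by rewrite mulr0n; exact: Pos0.
  by rewrite mulrS; apply: PosD.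
have Ptk k : Pos b (th *+ k).
  elim: k => [|k IH]; first by rewrite mulr0n; exact: Pos0.
  by rewrite mulrS; apply: PosD.
have Pa : Pos b (th + a).
  by case: Ra => [/RN/gh|->]; rewrite ?opprK ?addr0.
have := PosD (Pm m.+1) (Pos_fin (PosD Pa (Ptk m))).
rewrite affwD addr0; congr (Pos _ (affw _ _)).
by rewrite mulNrn addrAC -mulrS addrA addNr add0r.
Qed.

Lemma aff_family_indep : lin_indep bh.
Proof.
move=> k; rewrite big_ord_recl aff_family0.
under eq_bigr do rewrite aff_familyS.
have affwMz (a : Hf) m (q : int) : affw a m *~ q = affw (a *~ q) (m * q).
  case: q => q; first exact: affwMn.
  by rewrite NegzE !mulrNz -!pmulrn affwMn affwN mulrN.
have -> : \sum_(i < n) affw (b i) 0 *~ k (lift ord0 i) =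
    affw (\sum_(i < n) b i *~ k (lift ord0 i)) 0.
  by elim/big_ind2 : _ => [|x1 x2 y1 y2 -> ->|i _];
     rewrite ?affw00 ?affwD ?affwMz ?mul0r.
rewrite affwMz affwD addr0 mul1r => /affw_eq0 [E1 k0].
move: E1; rewrite k0 mulr0z add0r => /fb E1 i.
by case: (unliftP ord0 i) => [j|] ->; [exact: E1|].
Qed.

Let cov_hat w : affine_all w -> Pos bh w \/ Pos bh (- w).
Proof.
have [[_ _ cov _] _] := gb.
move=> [a [m [Ra am ->]]]; case: m am => [[|m]|m] am.
- case: Ra => [/cov|a0]; last by case: am.
  by case=> /Pos_fin; [left|right; rewrite affwN oppr0].
- by left; exact: Pos_level.
right; rewrite affwN NegzE opprK; apply: Pos_level.
by case: Ra => [/RN|->]; [left|right; rewrite oppr0].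
Qed.

Lemma aff_family_good : affine_good bh.
Proof.
have [[_ _ cov dec] uh] := gb; have [Rth _] := lh.
have A0 (w : Hs) : affine_all w -> w <> 0 by exact: affine_all0.
split; last first.
- by rewrite -affw_dl; apply: Pos_level; right.
- move=> i; rewrite /aff_family; case: unliftP => [j _|_].
    by exists (b j), 0; split=> //; rewrite /affw scale0r addr0.
  by exists (- th), 1; split=> //; exact: RN.
split; [exact: aff_family_indep| |exact: cov_hat|].
  move=> i; apply: (affine_realW ssD); rewrite /aff_family; case: unliftP => [j _|_].
    by exists (b j), 0; split=> //; rewrite /affw scale0r addr0.
  by exists (- th), 1; split=> //; exact: RN.
have fh := aff_family_indep.
move=> w Aw Pw; have [a [m [Ra am Ew]]] := Aw.
case: m am Ew => [[|m]|m] am Ew; last first.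
- case: (A0 _ Aw); apply: (Pos_anti fh Pw); rewrite Ew affwN NegzE opprK.
  apply: Pos_level.
  by case: Ra => [/RN|->]; [left|right; rewrite oppr0].
- case: Ra => [Ra|a0]; last first.
    right; exists (affw (- th) m.+1), (affw th 0); split.
    + by apply: (affine_root ssD); exact: RN.
    + exact: (affine_root ssD).
    + by apply: Pos_level; left; exact: RN.
    + exact: Pos_fin.
    + by rewrite Ew a0 affwD addNr addr0.
  case: m am Ew => [|m] am Ew; last first.
    right; exists (affw a m.+1), (affw 0 1); split.
    + exact: (affine_root ssD).
    + exact: affine_imag.
    + by apply: Pos_level; left.
    + by apply: Pos_level; right.
    + by rewrite Ew affwD addr0; congr affw; lia.
  have [ath|ath] := EM (- a = th).
    by left; exists ord0; rewrite aff_family0 Ew -ath opprK.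
  (* If [- a] is not [th], uniqueness shows that it is not locally highest, and some [b j] splits
     off from [a + delta]. *)
  have [j Rj] : exists j, Rt (- a + b j) \/ - a + b j = 0.
    apply: contrapT => /forallNP H; apply: ath; apply: uh => //; split; first exact: RN.
    by move=> j; have /not_orP := H j.
  have Rj' : Rt (a - b j) \/ a - b j = 0.
    by rewrite -opprB [b j - a]addrC; case: Rj => [/RN|->]; [left|right; rewrite oppr0].
  right; exists (affw (a - b j) 1), (affw (b j) 0); split.
  + by apply: (affine_all_sum Rj') => /affw_eq0 [].
  + exact: (affine_root ssD).
  + exact: Pos_level.
  + by apply: Pos_fin; exact: Pos_base.
  + by rewrite Ew affwD subrK addr0.
case: Ra => [Ra|a0]; last by case: am.
have Pa : Pos b a.
  case: (cov _ Ra) => // /Pos_fin PN; case: (A0 _ Aw).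
  by apply: (Pos_anti fh Pw); rewrite Ew affwN oppr0.
case: (dec _ Ra Pa) => [[j Ej]|[y [z [Ry Rz Py Pz Eyz]]]].
  by left; exists (lift ord0 j); rewrite aff_familyS Ew Ej.
right; exists (affw y 0), (affw z 0).
by split; [exact: (affine_root ssD)|exact: (affine_root ssD)|exact: Pos_fin|
  exact: Pos_fin|rewrite Ew Eyz affwD].
Qed.

End InitialBase.

(** * Integral roots at an admissible level *)

Lemma int_subgroup (T : int -> Prop) : T 0 -> (forall m n, T m -> T n -> T (m - n)) ->
  (exists2 m, T m & m <> 0) ->
  exists2 p : int, p <> 0 & forall m, T m <-> (p %| m)%Z.
Proof.
move=> T0 TB [m Tm m0].
have TN n : T n -> T (- n) by move=> Tn; rewrite -sub0r; apply: TB.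
have TD n n' : T n -> T n' -> T (n + n').
  by move=> Tn /TN Tn'; rewrite -[n']opprK; apply: TB.
have ex : exists p : nat, (0 < p)%N && `[< T p%:Z >].
  exists `|m|%N; apply/andP; split; first by rewrite absz_gt0; exact/eqP.
  apply/asboolP; rewrite abszE; case: (ger0P m) => // _; exact: TN.
case: (ex_minnP ex) => p /andP [p0 /asboolP Tp] pmin.
have TM (q : int) : T (q * p%:Z).
  have TMn (k : nat) : T (k%:Z * p%:Z).
    elim: k => [|k IH]; first by rewrite mul0r.
    by rewrite intS mulrDl mul1r; apply: TD.
  by case: q => k //; rewrite NegzE mulNr; apply: TN.
exists p%:Z; first by lia.
move=> n; split=> [Tn|/dvdzP [q ->] //].
have Tr : T (n %% p%:Z)%Z.
  have -> : (n %% p%:Z)%Z = n - (n %/ p%:Z)%Z * p%:Z.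
    by rewrite {2}(divz_eq n p%:Z) addrAC subrr add0r.
  exact: TB.
apply/dvdz_mod0P; have p00 : p%:Z != 0 by lia.
have := modz_ge0 n p00; have := ltz_pmod n (d := p%:Z); rewrite ltz_nat p0 => /(_ isT).
move: Tr; case: (n %% p%:Z)%Z => r // Tr rp _.
case: r Tr rp => // r Tr rp.
have := pmin r.+1; rewrite ltn0Sn /= => /(_ (asboolT Tr)).
by move: rp; rewrite ltz_nat ltnNge => /negP.
Qed.

Section Main.
Variables (C : numClosedFieldType) (gd : quadLSA C) (D N : set gd).
Variables (g : lieSuperalgebra C) (af : affinisation D N g).
Hypothesis ld : loop_data D N.
Local Notation Hf := 'Hom(q_H gd, C^o).
Local Notation Hs := 'Hom(aff_H gd, C^o).
Local Notation Rt := (@q_roots _ gd).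
Local Notation E := (@ext_weight _ gd).
Local Notation dl := (delta gd).
Local Notation form := (dform (@q_hform _ gd)).
Local Notation aform := (dform (@aff_hform _ gd)).
Local Notation fl := (@qform_linear _ gd).
Local Notation fs := (@qform_sym _ gd).
Local Notation afl := (@aform_linear _ gd).
Local Notation afs := (@aform_sym _ gd).
Hypothesis ssD : supersystem form Rt.
Local Notation s_ := (sref form).
Local Notation S_ := (sref aform).
Local Notation Phi := (@affine_real _ gd).

Section WithBase.
Variables (S : set Hs) (n : nat) (b : 'I_n -> Hf) (th : Hf) (h : Hf -> C).
Hypotheses (hl : linear (h : Hf -> C^o)) (h1 : forall i, h (b i) = 1).
Hypotheses (gb : good_base Rt b) (lh : locally_highest Rt b th).
Hypothesis gh : forall c, Rt c -> Pos b (th - c).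
Hypothesis SE : S = affine_base b th.
Local Notation re := (re_bar af S).

Let rb : reached S b.
Proof. by exists th; split=> //; rewrite SE; exact: Sp_base. Qed.

Lemma Sp_affine_good S1 : Sp S S1 ->
  exists n1 (b1 : 'I_n1 -> Hs), affine_good b1 /\ S1 = range b1.
Proof.
elim=> [|{}S1 be _ [n1 [b1 [ag ->]]] [i _ <-] iso].
  exists n.+1, (aff_family b th); split; first exact: (aff_family_good ssD).
  by rewrite SE range_aff_family.
exists n1, (odd_refl aform b1 i); split; first exact: (affine_good_odd ssD).
by apply: (odd_reflexion_range ag).
Qed.

Lemma Sref_affw a m x p : form a a <> 0 -> Rt a -> Rt x -> exists q,
  S_ (affw a m) (affw x p) = affw (s_ a x) q.
Proof.
move=> fa Ra Rx; have [c Ec _] := ss_refl ssD Ra fa Rx.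
exists (p - c * m); rewrite /sref !aform_affw Ec mulfK; last exact/eqP.
have aZ : c%:~R *: affw a m = affw (c%:~R *: a) (c * m).
  by rewrite /affw scalerDr extZ scalerA rmorphM.
by rewrite aZ affwB.
Qed.

(** Bases in [Sp] consist of real roots by [Sp_affine_good], and a reflection changes the multiple
    of [delta] by an integer. *)
Lemma re_real x : re x -> Phi x.
Proof.
move=> [w [S1 [y [Ww SS1 S1y ->]]]].
have Py : Phi y.
  have [n1 [b1 [[_ Rb _] E1]]] := Sp_affine_good SS1.
  by move: S1y; rewrite E1 => -[i _ <-].
elim: Ww y Py {S1y} => // a w0 [[a0 ea] _] _ IH y Py.
have [z [p [Rz Ez]]] := IH y Py; rewrite /= Ez.
have [a' [m [Ea Ra]]] : exists a' m, a = affw a' m /\ (Rt a' \/ a' = 0).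
  have [x' [x0 _ rx]] := ea.
  by apply: (aff_roots_ext ld (af := af)); split=> //; exists x'.
have [fa|fa] := EM (form a' a' = 0).
  by rewrite /refl Ea !aform_affw fa invr0 mulr0 scale0r subr0; exists z, p.
case: Ra => [Ra|a0']; last by case: fa; rewrite a0' (f0l fl).
have [q E1] := Sref_affw m p fa Ra Rz.
by rewrite Ea reflE E1; exists (s_ a' z), q; split=> //; exact: (D_sref ssD).
Qed.

Lemma real_rootsE w : real_roots af S w <-> Phi w.
Proof.
split=> [[aw]|[a [m [Ra ->]]]]; last first.
  by split; [exact: ext_aff_root|exact: (all_re af ld ssD hl h1 gb rb)].
have [a [m [Ew [Ra|a0]]]] := aff_roots_ext ld aw; first by exists a, m.
have {}Ew : w = affw a m by [].
case=> /re_real [x [p [Rx Ex]]].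
  by move: Ex; rewrite Ew => /affw_inj [E1 _]; case: (ss_neq0 ssD Rx); rewrite -E1.
have : affw a m = affw (x + x) (p + p).
  rewrite -Ew -affwD -Ex -mulr2n -scaler_nat scalerA mulfV ?scale1r //.
  by rewrite pnatr_eq0.
move=> /affw_inj [E1 _]; case: (ss_neq0 ssD Rx); move: E1.
rewrite a0 -mulr2n -scaler_nat => /esym/eqP.
by rewrite scaler_eq0 pnatr_eq0 => /eqP.
Qed.

Section Mu.
Variable mu : Hs.
Hypothesis mub : forall i, 2 * aform mu (E (b i)) = form (b i) (b i).
Local Notation X := (Delta_ af S mu).
Local Notation Re := (real_roots af S).

(** This bounds [Delta_] from above, as it is contained in every closed set. *)
Lemma real_closed_real : real_closed_set af S mu Re.
Proof.
split=> //.
- split=> // x [rx [j [Ej _]]]; apply/real_rootsE; exact: re_real.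
- move=> a x /real_rootsE [a' [m [Ra ->]]] /real_rootsE [x' [p [Rx ->]]] fa.
  rewrite aform_affw in fa; have [q E1] := Sref_affw m p fa Ra Rx.
  rewrite reflE E1; apply/real_rootsE; exists (s_ a' x'), q; split=> //.
  exact: (D_sref ssD).
Qed.

Lemma X_real x : X x -> Phi x.
Proof. by move=> /(_ _ real_closed_real) /real_rootsE. Qed.

Lemma X_refl a x : X a -> X x -> aform a a <> 0 -> X (S_ a x).
Proof.
move=> Xa Xx fa Y cY; have [_ H _ _] := cY.
by rewrite -reflE; apply: H => //; [exact: Xa|exact: Xx].
Qed.

Lemma X_iso a x : X a -> X x -> aform a a = 0 -> aform a x <> 0 ->
  (Phi (a + x) -> X (a + x)) /\ (Phi (a - x) -> X (a - x)).
Proof.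
move=> Xa Xx fa fax; split=> P Y cY; have [_ _ H _] := cY.
  have : (Re `&` [set a + x; a - x]) (a + x).
    by split; [exact/real_rootsE|left].
  by rewrite -(H _ _ (Xa _ cY) (Xx _ cY) fa fax) => -[].
have : (Re `&` [set a + x; a - x]) (a - x).
  by split; [exact/real_rootsE|right].
by rewrite -(H _ _ (Xa _ cY) (Xx _ cY) fa fax) => -[].
Qed.

Lemma X_double x : X x -> Phi (2 *: x) -> X (2 *: x).
Proof.
move=> Xx P Y cY; have [_ _ _ H] := cY.
by apply: H; [exact: Xx|exact/real_rootsE].
Qed.

Lemma X_base i : X (E (b i)) /\ X (- E (b i)).
Proof.
have Sbi : S (E (b i) + 0%:~R *: dl).
  by rewrite SE; right; exists i; rewrite scale0r addr0.
have r1 : re (E (b i)) by apply: (re_base af (Sp_base S)); move: Sbi; rewrite scale0r addr0.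
have r2 : re (- E (b i)).
  have [[_ Rb _ _] _] := gb.
  by have := re_simpleN af ld (Sp_base S) Sbi (Rb i); rewrite scale0r addr0.
split=> Y [[_ +] _ _ _]; apply; split=> //.
  by exists 1; split=> //; rewrite mub aform_extE mul1r.
exists (-1); split=> //.
by rewrite (fNr afl afs) mulrN mub (fNl afl) (fNr afl afs) aform_extE opprK mulN1r.
Qed.

(** The chain of [chain_reachable] again, with the closure conditions on [Delta_] in place of the
    Weyl group. *)
Lemma X_ext x : Rt x -> X (E x).
Proof.
pose K (b : 'I_n -> Hf) (h : Hf -> C) := (forall i, X (E (b i)) /\ X (- E (b i))) ->
  forall x, Rt x -> Pos b x -> h x < 0 -> X (E x) /\ X (- E x).
have affw0 (y : Hf) : affw y 0 = E y by rewrite /affw scale0r addr0.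
have PhiE y : Rt y -> Phi (E y) by move=> Ry; exists y, 0; rewrite affw0.
have Kchain h' : linear (h' : Hf -> C^o) -> (forall x, Rt x -> h' x \is Num.real) -> K b h'.
  move=> hl' hr; apply: (chain_ind fl fs ssD (K := K)) => //.
  - move=> b1 h2 gb1 hl2 hb _ y Ry [k ->]; have [hD hZ] := scalar_linear hl2.
    suff : 0 <= h2 (\sum_i b1 i *+ k i) by move=> /le_gtF ->.
    elim/big_rec: _ => [|i z _ IH]; first by rewrite -(scale0r 0) hZ mul0r.
    by rewrite hD addr_ge0 // -scaler_nat hZ mulr_ge0 ?ler0n.
  - move=> b1 h2 i gb1 hl2 iso hi KE Xb y Ry Py hy; have [[fb Rb _ _] _] := gb1.
    have [->|yi] := EM (y = b1 i); first exact: Xb.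
    apply: KE => //; last exact: (Pos_odd_refl_ss ssD (proj1 gb1) iso).
    move=> j; rewrite /odd_refl; case: eqP => _.
      by have [X1 X2] := Xb i; rewrite extN opprK.
    case: eqP => // fj; rewrite extD.
    have Rji := supersystem_add ssD (proj1 gb1) iso fj.
    have [X1 X2] := Xb i; have [X3 X4] := Xb j.
    have ai : aform (E (b1 i)) (E (b1 i)) = 0 by rewrite aform_extE.
    have aij : aform (E (b1 i)) (E (b1 j)) <> 0 by rewrite aform_extE fs.
    have [H _] := X_iso X1 X3 ai aij.
    have aiN : aform (- E (b1 i)) (- E (b1 i)) = 0.
      by rewrite (fNl afl) (fNr afl afs) opprK.
    have aijN : aform (- E (b1 i)) (- E (b1 j)) <> 0.
      by rewrite (fNl afl) (fNr afl afs) opprK.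
    have [HN _] := X_iso X2 X4 aiN aijN.
    rewrite addrC; split; first by apply: H; rewrite -extD addrC; exact: PhiE.
    rewrite opprD; apply: HN; rewrite -opprD -extD addrC -extN; apply: PhiE.
    exact: (ss_opp ssD).
  move=> b1 h2 i gb1 hl2 niso hi KE Xb y Ry Py hy; have [[fb Rb _ _] _] := gb1.
  have [->|yi] := EM (y = b1 i); first exact: Xb.
  have [yE|yi2] := EM (y = b1 i *+ 2).
    have [X1 X2] := Xb i; rewrite yE -scaler_nat extZ -scalerN.
    split; apply: X_double => //; rewrite -?extN -extZ; apply: PhiE.
      by rewrite scaler_nat -yE.
    by rewrite scalerN scaler_nat -yE; exact: (ss_opp ssD).
  have ai : aform (E (b1 i)) (E (b1 i)) <> 0 by rewrite aform_extE.
  have [|||r1 r2] := KE Xb (s_ (b1 i) y).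
  - exact: (D_sref ssD).
  - exact: (Pos_sref ssD gb1 niso).
  - by rewrite (srefK fl niso).
  have [X1 X2] := Xb i.
  have := X_refl X1 r1 ai; have := X_refl X1 r2 ai.
  rewrite (srefN afl) Sref_extE (srefK fl niso) => ? ?; by split.
move=> Rx; have [[fb Rb cov dec] uh] := gb.
have [hD hZ] := scalar_linear hl.
have hN y : h (- y) = - h y by rewrite -scaleN1r hZ mulN1r.
have hP := height_pos ssD hl h1.
have hl' : linear ((fun y => - h y) : Hf -> C^o).
  by move=> c u v; rewrite hl opprD scalerN.
have hr y : Rt y -> - h y \is Num.real.
  move=> Ry; rewrite realN; case: (cov _ Ry) => P.
    by apply: gtr0_real; exact: hP.
  by rewrite -realN -hN; apply/gtr0_real/hP => //; exact: (ss_opp ssD).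
have key y : Rt y -> Pos b y -> X (E y) /\ X (- E y).
  move=> Ry Py; apply: (Kchain _ hl' hr) => //; last by rewrite oppr_lt0; exact: hP.
  exact: X_base.
case: (cov _ Rx) => P; first by have [] := key _ Rx P.
by have [_] := key _ (ss_opp ssD Rx) P; rewrite extN opprK.
Qed.

(** The finite roots lie in [Delta_], and adding them or reflecting in them leaves the multiple of
    [delta] alone; [ss_conn] does the rest. *)
Lemma X_transport m x y : Rt x -> Rt y -> X (affw x m) -> X (affw y m).
Proof.
have X0 a : Rt a -> X (affw a 0).
  by move=> Ra; rewrite /affw scale0r addr0; exact: X_ext.
apply: (ss_conn ssD (T := fun x => X (affw x m))).
  move=> u be Ru Rbe isob Rub Xu; have fub := ss_iso_orth ssD Rbe isob Ru Rub.
  have [|| H _] := X_iso (X0 _ Rbe) Xu; rewrite ?aform_affw // 1?fs //.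
  have E1 : affw be 0 + affw u m = affw (u + be) m by rewrite affwD add0r addrC.
  by rewrite -E1; apply: H; rewrite E1; exists (u + be), m.
move=> u a c Ru Ra fa Ec Xu.
have := X_refl (X0 _ Ra) Xu; rewrite aform_affw => /(_ fa).
rewrite /sref !aform_affw Ec mulfK; last exact/eqP.
have -> : c%:~R *: affw a 0 = affw (a *~ c) 0.
  by rewrite /affw !scale0r !addr0 -extZ scaler_int.
by rewrite affwB subr0.
Qed.

Lemma X_lattice : (exists a m, X (affw a m) /\ m <> 0) ->
  exists2 p : int, p <> 0 &
    forall w, X w <-> exists a m, Rt a /\ w = affw a (p * m).
Proof.
have [be Rbe isob] := ss_exists_iso ssD.
have [y Ry fy] := ss_nonorth ssD Rbe isob.
have RN x : Rt x -> Rt (- x) by exact: (ss_opp ssD).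
have [z [Rz Rbz fz]] : exists z, [/\ Rt z, Rt (be + z) & form be z <> 0].
  case: (ss_iso ssD Rbe isob Ry fy) => H.
    by exists y; rewrite addrC fs.
  exists (- y); rewrite -opprB; split; [exact: RN|exact: RN|].
  by rewrite (fNr fl fs) fs => /eqP; rewrite oppr_eq0 => /eqP.
move=> [a0 [m0 [Xa0 m00]]].
have Ra0 : Rt a0 by have [a' [m' [Ra' /affw_inj [-> _]]]] := X_real Xa0.
pose T m := X (affw be m).
have [|||p p0 Tp] := @int_subgroup T.
- by rewrite /T /affw scale0r addr0; exact: X_ext.
(* As [be + z] is a root, the difference of [be + m delta] and [- z + m' delta] lies in [Delta_],
   and transport brings its multiple [m - m'] back to [be]. *)
- move=> m m' Tm Tm'.
  have Xz : X (affw (- z) m') by apply: (X_transport Rbe (RN _ Rz) Tm').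
  have [|| _ H] := X_iso Tm Xz; rewrite ?aform_affw //.
    by rewrite (fNr fl fs) => /eqP; rewrite oppr_eq0 => /eqP.
  apply: (X_transport Rbz Rbe); move: H; rewrite affwB opprK; apply.
  by exists (be + z), (m - m').
- by exists m0 => //; apply: (X_transport Ra0 Rbe).
exists p => // w; split=> [Xw|[a [m [Ra ->]]]].
  have [a [m [Ra Ew]]] := X_real Xw; exists a.
  have /Tp /dvdzP [q Eq] : T m by apply: (X_transport Ra Rbe); rewrite -Ew.
  by exists q; rewrite Ew Eq mulrC.
by apply: (X_transport Rbe Ra); apply/Tp; rewrite dvdz_mulr.
Qed.

End Mu.
End WithBase.
End Main.

(** * Rescaling delta *)

Section Isometry.
Variables (C : numClosedFieldType) (gd : quadLSA C).
Local Notation Hs := 'Hom(aff_H gd, C^o).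
Local Notation E := (@ext_weight _ gd).
Local Notation dl := (delta gd).
Local Notation aform := (dform (@aff_hform _ gd)).
Local Notation afl := (@aform_linear _ gd).
Local Notation afs := (@aform_sym _ gd).

(** The point [(0, 0, 1)] is the element d; evaluation there reads off the coefficient of
    [delta]. *)
Definition stretch_fun (r : C) (w : Hs) : Hs := w + ((r - 1) * w (0, 0, 1)) *: dl.

Lemma stretch_linear r : linear (stretch_fun r).
Proof.
move=> c u v; rewrite /stretch_fun add_lfunE scale_lfunE scale_regularE.
by rewrite scalerDr scalerA mulrCA addrACA -scalerDl mulrDr.
Qed.

Definition stretch r : 'Hom(Hs, Hs) :=
  linfun (HB.pack_for {linear Hs -> Hs} (stretch_fun r)
    (GRing.isLinear.Build _ _ _ _ (stretch_fun r) (@stretch_linear r))).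

Lemma stretchE r w : stretch r w = w + ((r - 1) * w (0, 0, 1)) *: dl.
Proof. by rewrite /stretch lfunE. Qed.

Lemma stretch_ext r a (c : C) : stretch r (E a + c *: dl) = E a + (r * c) *: dl.
Proof.
by rewrite stretchE ext_d -addrA -scalerDl; congr (_ + _ *: _); ring.
Qed.

Lemma stretchK r : r != 0 -> cancel (stretch r) (stretch r^-1).
Proof.
move=> r0 w; rewrite !stretchE add_lfunE scale_lfunE deltaE /= scale_regularE mulr1.
rewrite -addrA -scalerDl.
suff -> : (r - 1) * w (0, 0, 1) + (r^-1 - 1) * (w (0, 0, 1) + (r - 1) * w (0, 0, 1)) = 0.
  by rewrite scale0r addr0.
by field.
Qed.

(** The span of [X] is orthogonal to the isotropic [delta], so adding multiples of [delta] does not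
    change the form. *)
Lemma isometric_stretch (X Y : set Hs) r : r != 0 ->
  (forall w, X w -> exists a (c : C), w = E a + c *: dl) ->
  (forall w, X w <-> Y (stretch r w)) -> isometric (@aff_hform _ gd) X Y.
Proof.
move=> r0 Xs XY; exists (stretch r).
have K := stretchK r0.
have K' : cancel (stretch r^-1) (stretch r).
  by have := stretchK (r := r^-1); rewrite invrK invr_eq0 => /(_ r0).
have dspan u : Cspan X u -> aform dl u = 0.
  move=> [s [c [sX ->]]]; elim: s sX => [|v s IH] sX.
    by rewrite big_nil afs; apply: (f0l afl).
  rewrite big_cons (fDr afl afs) (fZr afl afs) IH => [|w ws]; last first.
    by apply: sX; rewrite inE ws orbT.
  have [a [e ->]] := Xs _ (sX _ (mem_head _ _)).
  by rewrite aform_delta mulr0 addr0.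
split.
- move=> u [s [c [sX ->]]]; exists (map (stretch r) s), (c \o stretch r^-1); split.
    by move=> _ /mapP [v vs ->]; apply/XY/sX.
  rewrite linear_sum big_map; apply: eq_bigr => v _.
  by rewrite linearZ /= K.
- move=> u v Xu Xv; rewrite !stretchE.
  have dd : aform dl dl = 0 by have := aform_delta 0 1 (gd := gd);
    rewrite ext0 add0r scale1r.
  have ud : aform u dl = 0 by rewrite afs dspan.
  by rewrite !(fDl afl, fDr afl afs, fZl afl, fZr afl afs) dd ud dspan // !mulr0 !addr0.
- split.
  + by move=> w Xw; apply/XY.
  + by move=> u v _ _; exact: (can_inj K).
  + move=> w Yw; exists (stretch r^-1 w); last exact: K'.
    by apply/XY; rewrite K'.
Qed.

End Isometry.

Theorem principal_of_supersystem (C : numClosedFieldType) (gd : quadLSA C)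
    (D N : set gd) (g : lieSuperalgebra C) (af : affinisation D N g)
    (Sdot : set 'Hom(q_H gd, C^o)) (S : set 'Hom(aff_H gd, C^o))
    (rho rhos Lambda0 : 'Hom(aff_H gd, C^o)) (k : C) :
  loop_data D N ->
  supersystem (dform (@q_hform _ gd)) (@q_roots _ gd) ->
  (exists2 a, @q_roots _ gd a & q_sqlen a = 2) ->
  is_base (@q_io _ gd) Sdot ->
  is_base (aff_io af) S ->
  (@ext_weight _ gd) @` Sdot `<=` S ->
  natcone S (delta gd) ->
  is_rho (@aff_hform _ gd) S rho ->
  is_Lambda0 Lambda0 ->
  admissible_level af S rho rhos Lambda0 k ->
  principal_admissible_level af S rho rhos Lambda0 k.
Proof.
move=> ld ssD [a2 Ra2 sq2] bdot bS SdS dS Hrho HL adm; split=> //.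
set mu := k *: Lambda0 + rho.
have [n [b [h [gb Edot hl h1]]]] := finite_base_good ssD bdot.
rewrite Edot in SdS.
have [th [lh gh SE]] := affine_base_shape ld ssD gb bS SdS dS.
have [[fb Rb cov dec] uh] := gb.
(* [Lambda0] is orthogonal to the finite roots, so only [rho] contributes. *)
have mub i : 2 * dform (@aff_hform _ gd) mu (ext_weight (b i))
  = dform (@q_hform _ gd) (b i) (b i).
  have [_ HL2 _] := HL.
  rewrite /mu (fDl (@aform_linear _ gd)) (fZl (@aform_linear _ gd)) HL2 // mulr0 add0r.
  by rewrite Hrho ?aform_extE // SE; right; exists i.
have reE := real_rootsE af ld ssD hl h1 gb lh gh SE.
have [_ spanE _] := adm.
(* The normalisation supplies a root of square length 2, and it or its double is even. With it
   [delta = (a + delta) - a] lies in the rational span of [Delta_sharp]. *)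
have [a [Ra ea fa]] : exists a, [/\ @q_roots _ gd a, roots_of_parity (@q_io _ gd) false a &
    0 < dform (@q_hform _ gd) a a].
  have f2 : 0 < dform (@q_hform _ gd) a2 a2 by rewrite -/(q_sqlen a2) sq2 ltr0n.
  have f2' : dform (@q_hform _ gd) a2 a2 <> 0 by move=> E0; rewrite E0 ltxx in f2.
  case: (even_or_double Ra2 f2') => e; first by exists a2.
  exists (a2 + a2); split=> //; first by apply/q_rootsP; exists false.
  rewrite (fDl (@qform_linear _ gd)) !(fDr (@qform_linear _ gd) (@qform_sym _ gd)).
  by do 2 apply: addr_gt0 => //; exact: addr_gt0.
have Dsh (m : int) : Delta_sharp af (affw a m).
  by split; [exact: ext_aff_root_parity|rewrite aform_affw].
have [x [m [Xx m0]]] : exists x m, Delta_ af S mu (affw x m) /\ m <> 0.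
  (* If only finite roots were in [Delta_], evaluation at d would vanish on a span containing
     [delta]. *)
  apply: contrapT => H.
  have : Qspan (@Delta_sharp _ gd _ _ _ af) (delta gd).
    exists [:: affw a 1; affw a 0], (fun w => if w == affw a 1 then 1 else -1); split.
      by move=> u; rewrite !inE => /orP [] /eqP ->.
    have ne : (affw a 0 == affw a 1) = false by apply/eqP => /affw_inj [].
    rewrite big_cons big_seq1 eqxx ne rmorph1 rmorphN1 scale1r scaleN1r.
    by rewrite affwB subrr affw_dl.
  rewrite -spanE => -[s [c [sX Ed]]].
  suff : delta gd (0, 0, 1) = 0 by rewrite deltaE /= => /eqP; rewrite oner_eq0.
  rewrite Ed; elim: s {Ed} sX => [|w s IH] sX; first by rewrite big_nil lfunE.
  rewrite big_cons add_lfunE scale_lfunE IH ?addr0 => [|u us]; last first.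
    by apply: sX; rewrite inE us orbT.
  have [Xw _] := sX _ (mem_head _ _).
  have [x [m [Rx Ew]]] := X_real ld ssD hl h1 gb lh gh SE Xw.
  rewrite Ew ext_d; have [->|m0] := EM (m = 0); first by rewrite scaler0.
  by case: H; exists x, m; rewrite -Ew.
have ex : exists a m, Delta_ af S mu (affw a m) /\ m <> 0 by exists x, m.
have [p p0 Xp] := X_lattice ld ssD hl h1 gb lh gh SE mub ex.
have pC : (p%:~R : C) != 0 by rewrite intr_eq0; exact/eqP.
apply: (isometric_stretch (r := p%:~R^-1)); first by rewrite invr_eq0.
  by move=> w /Xp [y [q [_ ->]]]; exists y, (p * q)%:~R.
move=> w; split=> [/Xp [y [q [Ry ->]]]|].
  apply/reE; exists y, q; split=> //.
  by rewrite /affw stretch_ext rmorphM /= mulKf.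
move=> /reE [y [q [Ry Ew]]]; apply/Xp; exists y, q; split=> //.
have pC' : (p%:~R^-1 : C) != 0 by rewrite invr_eq0.
rewrite -[w](stretchK pC') Ew invrK /affw stretch_ext.
by rewrite rmorphM.
Qed.

(** * Models of the finite root systems *)

Section Transport.
Variables (L : zmodType) (fm : L -> L -> int) (Dm : set L).
Variables (R : numDomainType) (V : zmodType) (f : V -> V -> R) (D : set V).
Variables (p : {additive L -> V}) (Lz : set L) (ka : R).
Hypothesis ssm : supersystem fm Dm.
Hypothesis Lz_add : forall x y, Lz x -> Lz y -> Lz (x + y).
Hypothesis Lz_opp : forall x, Lz x -> Lz (- x).
Hypothesis Lz_root : forall x, Dm x -> Lz x.
Hypothesis p_inj : forall x, Lz x -> p x = 0 -> x = 0.
Hypothesis DE : D = p @` Dm.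
Hypothesis ka0 : ka != 0.
Hypothesis fE : forall x y, Dm x -> Dm y -> f (p x) (p y) = ka * (fm x y)%:~R.

Let Lz0 : Lz 0.
Proof.
have [b Db _] := ss_exists_iso ssm.
by rewrite -(subrr b); apply: Lz_add; [|apply: Lz_opp]; exact: Lz_root.
Qed.

Let Lz_mulz x (k : int) : Lz x -> Lz (x *~ k).
Proof.
move=> Lx; have Ln (n : nat) : Lz (x *+ n).
  by elim: n => [|n IH]; rewrite ?mulr0n // mulrS; exact: Lz_add.
by case: k => n; rewrite ?NegzE ?mulrNz -pmulrn; [exact: Ln|apply: Lz_opp; exact: Ln].
Qed.

Let pz_inj x y : Lz x -> Lz y -> p x = p y -> x = y.
Proof.
move=> Lx Ly E; apply/eqP; rewrite -subr_eq0; apply/eqP/p_inj.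
  by apply: Lz_add => //; exact: Lz_opp.
by rewrite raddfB E subrr.
Qed.

Let DP x : Lz x -> D (p x) <-> Dm x.
Proof.
rewrite DE => Lx; split=> [[y Dy /pz_inj <- //]|Dx]; last by exists x.
exact: Lz_root.
Qed.

Let f0 x y : Dm x -> Dm y -> f (p x) (p y) = 0 <-> fm x y = 0.
Proof.
move=> Dx Dy; rewrite fE //; split=> [/eqP|->]; last by rewrite mulr0.
by rewrite mulf_eq0 (negbTE ka0) intr_eq0 => /eqP.
Qed.

Let fc x y a c : Dm x -> Dm y -> Dm a ->
  2 * f (p x) (p y) = c%:~R * f (p a) (p a) <-> 2 * fm x y = c%:~R * fm a a.
Proof.
move=> Dx Dy Da; rewrite !fE // mulrCA [c%:~R * (ka * _)]mulrCA.
split=> [/(mulfI ka0)|E].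
  rewrite -(@rmorph_nat int R intr 2).
  by rewrite -!rmorphM => /intr_inj ->; rewrite intz.
congr (_ * _); move: E; rewrite intz => /(congr1 (intr : int -> R)).
by rewrite !rmorphM /= => <-.
Qed.

Let Lz_base N (b : 'I_N -> L) (k : 'I_N -> int) : (forall i, Dm (b i)) ->
  Lz (\sum_i b i *~ k i).
Proof.
move=> Db; elim/big_ind: _ => // i _; apply: Lz_mulz; exact: Lz_root.
Qed.

Let Pos_p N (b : 'I_N -> L) x : (forall i, Dm (b i)) -> Lz x ->
  Pos (fun i => p (b i)) (p x) <-> Pos b x.
Proof.
move=> Db Lx; have pS (k : 'I_N -> nat) :
    \sum_i p (b i) *+ k i = p (\sum_i b i *+ k i).
  by rewrite raddf_sum; apply: eq_bigr => i _; rewrite raddfMn.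
split=> -[k E]; exists k; last by rewrite pS -E.
apply: pz_inj => //; last by rewrite -pS.
by rewrite sum_mulz; exact: Lz_base.
Qed.

Lemma transport_base N (b : 'I_N -> L) : good_base Dm b ->
  good_base D (fun i => p (b i)).
Proof.
move=> [[fb Db cov dec] uh].
have zz x : p x <> 0 -> x <> 0 by move=> H x0; apply: H; rewrite x0 raddf0.
have LH x : Lz x -> locally_highest D (fun i => p (b i)) (p x) ->
    locally_highest Dm b x.
  move=> Lx [/(DP Lx) Dx Hx]; split=> // j; have [H1 H2] := Hx j.
  have Lxj : Lz (x + b j) by apply: Lz_add => //; exact: Lz_root.
  by move: H1 H2; rewrite -raddfD => H1 /zz H2; split=> // /(DP Lxj).
split; last first.
  move=> x y Hx Hy; have := Hx.1; have := Hy.1.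
  rewrite DE => -[y' Dy' Ey] [x' Dx' Ex]; rewrite -Ex -Ey in Hx Hy *.
  by rewrite (uh x' y') //; apply: LH => //; exact: Lz_root.
split.
- move=> k E; apply: fb; apply: p_inj; first exact: Lz_base.
  rewrite -[RHS]E raddf_sum; apply: eq_bigr => i _.
  by rewrite raddfMz.
- by move=> i; apply/DP => //; exact: Lz_root.
- rewrite DE => _ [x Dx <-]; rewrite -raddfN.
  by case: (cov _ Dx) => P; [left|right]; apply/Pos_p => //; try apply: Lz_opp;
    exact: Lz_root.
rewrite {1}DE => _ [x Dx <-] /(Pos_p Db (Lz_root Dx)) Px.
case: (dec _ Dx Px) => [[i ->]|[y [z [Dy Dz Py Pz ->]]]]; first by left; exists i.
right; exists (p y), (p z); split; last by rewrite raddfD.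
- by apply/DP => //; exact: Lz_root.
- by apply/DP => //; exact: Lz_root.
- by apply/Pos_p => //; exact: Lz_root.
- by apply/Pos_p => //; exact: Lz_root.
Qed.

Lemma transport_long x : long_root fm Dm x -> long_root f D (p x).
Proof.
move=> [Dx fx Hx]; split.
- by apply/DP => //; exact: Lz_root.
- by move/(f0 Dx Dx).
rewrite {1}DE => _ [y Dy <-]; case: (Hx _ Dy) => [->|->|[c cb E]].
- exact: Or31.
- by apply: Or32; rewrite raddfN.
by apply: Or33; exists c => //; apply/fc.
Qed.

(** [Lz] is a subgroup on which [p] is injective, while [p] may have a kernel: the weights of sl
    satisfy a linear relation, and the model of G(3) has a dummy coordinate. *)
Lemma transport_supersystem : supersystem f D.
Proof.
have dE x : D x -> exists2 y, Dm y & x = p y by rewrite DE => -[y Dy <-]; exists y.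
have Dp x : Dm x -> D (p x) by move=> Dx; rewrite DE; exists x.
have DpD x y : Dm x -> Dm y -> D (p x + p y) <-> Dm (x + y).
  by move=> Dx Dy; rewrite -raddfD; apply: DP; apply: Lz_add; exact: Lz_root.
split.
- have [s Hs] := ss_fin ssm; exists (map p s) => _ /dE [x Dx ->].
  exact/map_f/Hs.
- move=> _ /dE [x Dx ->]; rewrite -raddfN; apply: Dp; exact: (ss_opp ssm).
- move=> _ /dE [x Dx ->] /(p_inj (Lz_root Dx)); exact: (ss_neq0 ssm).
- move=> _ n n1 /dE [x Dx ->]; rewrite -raddfMn => /DP H.
  have {}H : Dm (x *+ n) by apply: H; rewrite pmulrn; apply: Lz_mulz; exact: Lz_root.
  by have [-> fx] := ss_mul ssm n1 Dx H; split=> // /(f0 Dx Dx).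
- move=> _ _ /dE [a Da ->] fa /dE [x Dx ->].
  have [|c Ec Dc] := ss_refl ssm Da _ Dx; first by move/(f0 Da Da).
  by exists c; [exact/fc|rewrite -raddfMz -raddfB; exact: Dp].
- move=> _ /dE [b Db ->] /(f0 Db Db) fb; have [x Dx fx] := ss_nonorth ssm Db fb.
  by exists (p x); [exact: Dp|move/(f0 Dx Db)].
- move=> _ _ /dE [b Db ->] /(f0 Db Db) fb /dE [x Dx ->] fx.
  have DbN := ss_opp ssm Db.
  have [||] := ss_iso ssm Db fb Dx; first by move/(f0 Dx Db).
    by move/(DpD _ _ Dx Db); left.
  by move/(DpD _ _ Dx DbN); rewrite raddfN; right.
- move=> _ _ /dE [b Db ->] /(f0 Db Db) fb /dE [x Dx ->] /(DpD _ _ Dx Db) Dxb.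
  by move=> /(f0 Dx Db); exact: (ss_iso_orth ssm Db fb Dx).
- move=> _ _ /dE [b Db ->] /(f0 Db Db) fb /dE [x Dx ->] /(DpD _ _ Dx Db) Dxb.
  rewrite -raddfD => /(DpD _ _ Dxb Db); exact: (ss_iso_string ssm Db fb Dx).
- move=> _ _ _ /dE [b Db ->] /(f0 Db Db) fb /dE [x Dx ->] /dE [y Dy ->].
  move=> /(DpD _ _ Dx Dy) Dxy; rewrite -raddfD => /(DpD _ _ Dxy Db) Dxyb.
  case: (ss_iso_split ssm Db fb Dx Dy Dxy Dxyb) => H; [left|right]; rewrite -raddfD;
    by case: H => [/Dp|->]; [left|right; rewrite raddf0].
- move=> _ /dE [x Dx ->]; case: (ss_long ssm Dx) => [/transport_long|[a La Ha]]; first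
  by left.
  right; exists (p a); first exact: transport_long.
  have [Da _ _] := La.
  case: Ha => Ha; [left|right].
    have : 2 * f (p x) (p a) = 1%:~R * f (p a) (p a) by apply/fc => //; rewrite mul1r.
    by rewrite mul1r.
  have : 2 * f (p x) (p a) = (-1)%:~R * f (p a) (p a) by apply/fc => //;
    rewrite rmorphN1 mulN1r.
  by rewrite rmorphN1 mulN1r.
- move=> T T1 T2 _ _ /dE [x Dx ->] /dE [y Dy ->].
  apply: (ss_conn ssm (T := fun x => T (p x))) => //.
    move=> u b Du Db fb Dub; rewrite raddfD; apply: T1; try exact: Dp.
      exact/(f0 Db Db).
    by rewrite -raddfD; exact: Dp.
  move=> u a c Du Da fa Ec; rewrite raddfB raddfMz; apply: T2; try exact: Dp.
    by move/(f0 Da Da).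
  exact/fc.
- have [b Db fb] := ss_exists_iso ssm; exists (p b); first exact: Dp.
  exact/(f0 Db Db).
have [N [b gb]] := ss_std ssm; exists N, (fun i => p (b i)).
exact: transport_base.
Qed.

End Transport.

(* With [b = (b1, b2)] read as an isotropic root, a pair [(x1, x2)] of
   coordinates of a root either allows adding [b], or is [- b], or lies in a
   cone which is closed under addition. *)
Lemma iso_coords (x1 x2 b1 b2 : int) : `|b1|%N = 1%N -> `|b2|%N = 1%N ->
  (`|x1| <= 1)%N -> (`|x1| + `|x2| <= 2)%N ->
  (`|(x1 + b1)%R| + `|(x2 + b2)%R| = `|x1| + `|x2|)%N /\ (`|(x1 + b1)%R| <= 1)%N
  \/ (x1 = - b1 /\ x2 = - b2)
  \/ (0 <= b1 * x1 /\ (b1 * x1 = 0 -> 0 <= b2 * x2)).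
Proof.
move=> B1 B2 X1 X2.
have c1 : x1 = 0 \/ x1 = 1 \/ x1 = -1 by lia.
have c2 : x2 = 0 \/ x2 = 1 \/ x2 = -1 \/ x2 = 2 \/ x2 = -2 by lia.
have E1 : b1 = 1 \/ b1 = -1 by lia.
have E2 : b2 = 1 \/ b2 = -1 by lia.
case: c1 => [|[]] c1; case: c2 => [|[|[|[]]]] c2; case: E1 => E1; case: E2 => E2;
  rewrite {}c1 {}c2 {}E1 {}E2 /= in B1 B2 X1 X2 *; (try by []);
  by [left | right; left | right; right].
Qed.

(** The conclusion describes the complement of the cone in [iso_coords]. *)
Lemma iso_coords_ok (x1 x2 b1 b2 : int) : `|b1|%N = 1%N -> `|b2|%N = 1%N ->
  (`|x1| <= 1)%N -> (`|x1| + `|x2| <= 2)%N ->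
  (`|(x1 + b1)%R| + `|(x2 + b2)%R| = `|x1| + `|x2|)%N -> (`|(x1 + b1)%R| <= 1)%N ->
  b1 * x1 <= 0 /\ (b1 * x1 = 0 -> b2 * x2 < 0).
Proof.
move=> B1 B2 X1 X2.
have c1 : x1 = 0 \/ x1 = 1 \/ x1 = -1 by lia.
have c2 : x2 = 0 \/ x2 = 1 \/ x2 = -1 \/ x2 = 2 \/ x2 = -2 by lia.
have E1 : b1 = 1 \/ b1 = -1 by lia.
have E2 : b2 = 1 \/ b2 = -1 by lia.
by case: c1 => [|[]] c1; case: c2 => [|[|[|[]]]] c2; case: E1 => E1; case: E2 => E2;
  rewrite {}c1 {}c2 {}E1 {}E2 /= in B1 B2 X1 X2 *.
Qed.

Lemma iso_coords_add (x1 x2 b1 b2 : int) : `|b1|%N = 1%N -> `|b2|%N = 1%N ->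
  (`|x1| <= 1)%N -> (`|x1| + `|x2| <= 2)%N -> x1 * b1 - x2 * b2 <> 0 ->
  (`|(x1 + b1)%R| + `|(x2 + b2)%R| = `|x1| + `|x2|)%N /\ (`|(x1 + b1)%R| <= 1)%N \/
  (`|(x1 - b1)%R| + `|(x2 - b2)%R| = `|x1| + `|x2|)%N /\ (`|(x1 - b1)%R| <= 1)%N.
Proof.
move=> B1 B2 X1 X2.
have c1 : x1 = 0 \/ x1 = 1 \/ x1 = -1 by lia.
have c2 : x2 = 0 \/ x2 = 1 \/ x2 = -1 \/ x2 = 2 \/ x2 = -2 by lia.
have E1 : b1 = 1 \/ b1 = -1 by lia.
have E2 : b2 = 1 \/ b2 = -1 by lia.
case: c1 => [|[]] c1; case: c2 => [|[|[|[]]]] c2; case: E1 => E1; case: E2 => E2;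
  rewrite {}c1 {}c2 {}E1 {}E2 /= in B1 B2 X1 X2 *; (try by []);
  by [left | right].
Qed.

Lemma iso_coords_string (x1 x2 b1 b2 : int) : `|b1|%N = 1%N -> `|b2|%N = 1%N ->
  (`|x1| <= 1)%N -> (`|x1| + `|x2| <= 2)%N ->
  (`|(x1 + b1)%R| + `|(x2 + b2)%R| = `|x1| + `|x2|)%N -> (`|(x1 + b1)%R| <= 1)%N ->
  x1 * b1 - x2 * b2 <> 0 /\
  ((`|(x1 + b1 + b1)%R| + `|(x2 + b2 + b2)%R| = `|(x1 + b1)%R| + `|(x2 + b2)%R|)%N ->
   (`|(x1 + b1 + b1)%R| <= 1)%N -> False).
Proof.
move=> B1 B2 X1 X2.
have c1 : x1 = 0 \/ x1 = 1 \/ x1 = -1 by lia.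
have c2 : x2 = 0 \/ x2 = 1 \/ x2 = -1 \/ x2 = 2 \/ x2 = -2 by lia.
have E1 : b1 = 1 \/ b1 = -1 by lia.
have E2 : b2 = 1 \/ b2 = -1 by lia.
by case: c1 => [|[]] c1; case: c2 => [|[|[|[]]]] c2; case: E1 => E1; case: E2 => E2;
  rewrite {}c1 {}c2 {}E1 {}E2 /= in B1 B2 X1 X2 *.
Qed.

(** Lexicographically nonnegative pairs are closed under addition. *)
Lemma iso_cone (u v w t : int) : 0 <= u -> (u = 0 -> 0 <= w) -> 0 <= v ->
  (v = 0 -> 0 <= t) -> u + v <= 0 -> (u + v = 0 -> w + t < 0) -> False.
Proof. lia. Qed.

(* The roots of [osp] in the coordinates given by the weights of the defining
   representation; [odd a] tells whether the coordinate [a] belongs to the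
   symplectic factor.  If [zs] holds only the roots with coordinate sum [0] are
   kept, which gives [gl]. *)
Section ClassicalModel.
Variables (N : nat) (odd : 'I_N -> bool) (zs : bool).
Local Notation L := {ffun 'I_N -> int}.
Implicit Types (x y : L) (p q r : 'I_N).

Definition cnorm x := (\sum_a `|x a|)%N.
Definition csum x : int := \sum_a x a.
(** Absolute values adding up to 2 give the vectors [+- e_a +- e_b] and [+- 2 e_a]; the bound on
    even coordinates keeps the doubles for odd [a] only. *)
Definition croot : set L := [set x | [/\ cnorm x = 2%N,
  forall a, ~~ odd a -> (`|x a| <= 1)%N & zs -> csum x = 0]].
Definition csg p : int := if odd p then -1 else 1.
Definition cform x y : int := \sum_a csg a * x a * y a.

Lemma csumD x y : csum (x + y) = csum x + csum y.
Proof. by rewrite /csum -big_split; apply: eq_bigr => i _; rewrite ffunE. Qed.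
Lemma csumN x : csum (- x) = - csum x.
Proof. by rewrite /csum -sumrN; apply: eq_bigr => i _; rewrite ffunE. Qed.
Lemma csumMz x k : csum (x *~ k) = csum x * k.
Proof.
rewrite /csum mulr_suml; apply: eq_bigr => i _.
by rewrite -mulrzr mulrzAr mulr1 ffunMzE mulrzz.
Qed.

Lemma cnorm_split p q x : p != q ->
  cnorm x = (`|x p| + (`|x q| + \sum_(c | (c != p) && (c != q)) `|x c|))%N.
Proof.
by move=> pq; rewrite /cnorm (bigD1 p) //= (bigD1 q) //= eq_sym.
Qed.

Lemma cnorm_local p q x y : p != q ->
  (forall c, c != p -> c != q -> x c = y c) ->
  (cnorm y + `|x p| + `|x q| = cnorm x + `|y p| + `|y q|)%N.
Proof.
move=> pq xy; rewrite !(cnorm_split _ pq).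
have -> : (\sum_(c | (c != p) && (c != q)) `|x c| =
   \sum_(c | (c != p) && (c != q)) `|y c|)%N.
  by apply: eq_bigr => c /andP [cp cq]; rewrite xy.
lia.
Qed.

Lemma cnorm_le p q x : p != q -> (`|x p| + `|x q| <= cnorm x)%N.
Proof. by move=> pq; rewrite (cnorm_split x pq); lia. Qed.

Lemma cnorm_supp p q x : p != q -> cnorm x = (`|x p| + `|x q|)%N ->
  forall c, c != p -> c != q -> x c = 0.
Proof.
move=> pq; rewrite (cnorm_split x pq) => E c cp cq.
have : (\sum_(c | (c != p) && (c != q)) `|x c| == 0)%N by lia.
by rewrite sum_nat_eq0 => /forallP/(_ c); rewrite cp cq /= absz_eq0 => /eqP.
Qed.

Lemma croot_local p q x y : p != q -> croot x ->
  (forall c, c != p -> c != q -> x c = y c) ->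
  (`|y p| + `|y q| = `|x p| + `|x q|)%N ->
  (~~ odd p -> (`|y p| <= 1)%N) -> (~~ odd q -> (`|y q| <= 1)%N) ->
  (zs -> csum y = 0) -> croot y.
Proof.
move=> pq [nx ox sx] xy nxy op oq sy; split=> //.
  by have := cnorm_local pq xy; lia.
move=> a oa; have [ap|ap] := eqVneq a p; first by rewrite ap op // -ap.
have [aq|aq] := eqVneq a q; first by rewrite aq oq // -aq.
by rewrite -xy // ox.
Qed.

Lemma cform_local p q x y : p != q ->
  (forall c, c != p -> c != q -> y c = 0) ->
  cform x y = csg p * x p * y p + csg q * x q * y q.
Proof.
move=> pq yc; rewrite /cform (bigD1 p) //= (bigD1 q) //= 1?eq_sym // addrA.
by rewrite big1 ?addr0 // => c /andP [cp cq]; rewrite yc ?mulr0.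
Qed.

Lemma croot_neq x : croot x -> exists p, x p <> 0.
Proof.
move=> [nx _ _]; apply: contrapT => /forallNP H.
by move: nx; rewrite /cnorm big1 // => a _; have /contrapT -> := H a.
Qed.

Lemma croot_shape x : croot x ->
  (exists p q, [/\ p != q, `|x p|%N = 1%N, `|x q|%N = 1%N &
     forall c, c != p -> c != q -> x c = 0]) \/
  (exists p, [/\ `|x p|%N = 2%N, odd p, zs = false & forall c, c != p -> x c = 0]).
Proof.
move=> Dx; have [p xp] := croot_neq Dx; have [nx ox sx] := Dx.
have E : cnorm x = (`|x p| + \sum_(c | c != p) `|x c|)%N by rewrite /cnorm (bigD1 p).
have p0 : (0 < `|x p|)%N by rewrite absz_gt0; exact/eqP.
have [p2|p1] : (`|x p| = 2 \/ `|x p| = 1)%N by lia.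
  right; exists p; have cz c : c != p -> x c = 0.
    have : (\sum_(c | c != p) `|x c| == 0)%N by lia.
    by rewrite sum_nat_eq0 => /forallP/(_ c) + cp; rewrite cp /= absz_eq0 => /eqP.
  split=> //.
    by apply: contraT => /ox; rewrite p2.
  case: zs sx => // /(_ isT); rewrite /csum (bigD1 p) //= big1 ?addr0 => [xp0|c /cz //].
  by rewrite xp0 in p2.
left; have [q qp xq] : exists2 q, q != p & x q <> 0.
  apply: contrapT => H; have : (\sum_(c | c != p) `|x c| = 0)%N.
    rewrite big1 // => c cp; apply/eqP; rewrite absz_eq0; apply: contrapT => /negP cn.
    by apply: H; exists c => //; exact/eqP.
  by lia.
have q0 : (0 < `|x q|)%N by rewrite absz_gt0; exact/eqP.
have pq : p != q by rewrite eq_sym.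
have q1 : `|x q|%N = 1%N by have := cnorm_le x pq; lia.
exists p, q; split=> //; apply: (cnorm_supp pq); lia.
Qed.

Lemma croot_opp x : croot x -> croot (- x).
Proof.
move=> [nx ox sx]; split.
- by rewrite -nx /cnorm; apply: eq_bigr => a _; rewrite ffunE abszN.
- by move=> a /ox; rewrite ffunE abszN.
- by move=> z; rewrite csumN sx // oppr0.
Qed.

Lemma croot_iso x : croot x -> cform x x = 0 -> exists p q,
  [/\ ~~ odd p, odd q, `|x p|%N = 1%N /\ `|x q|%N = 1%N &
     forall c, c != p -> c != q -> x c = 0].
Proof.
move=> Dx; case: (croot_shape Dx) => [[p [q [pq xp xq xc]]]|[p [xp op z xc]]].
  rewrite (cform_local _ pq) // /csg => fx.
  case op: (odd p) fx; case oq: (odd q) => fx; [nia| | |nia].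
    by exists q, p; split=> //; [rewrite oq|move=> c cq cp; exact: xc].
  by exists p, q; split=> //; rewrite op.
rewrite /cform (bigD1 p) //= big1 ?addr0 => [|c cp]; last by rewrite xc // mulr0.
by rewrite /csg op; nia.
Qed.

Section Isotropic.
Variables (be : L) (p q : 'I_N).
Hypotheses (op : ~~ odd p) (oq : odd q) (bp : `|be p|%N = 1%N) (bq : `|be q|%N = 1%N).
Hypothesis bc : forall c, c != p -> c != q -> be c = 0.
Hypothesis Db : croot be.

Let pq : p != q. Proof. by apply: contraTneq oq => <-. Qed.

Lemma cform_iso x : cform x be = x p * be p - x q * be q.
Proof.
by rewrite (cform_local _ pq) // /csg oq (negbTE op); ring.
Qed.

(** An isotropic root is supported on [p] and [q], so only these two coordinates decide. *)
Lemma croot_add_iso x : croot x -> croot (x + be) <->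
  (`|(x p + be p)%R| + `|(x q + be q)%R| = `|x p| + `|x q|)%N /\ (`|(x p + be p)%R| <= 1)%N.
Proof.
move=> Dx; have [nx ox sx] := Dx.
have xy c : c != p -> c != q -> x c = (x + be) c.
  by move=> cp cq; rewrite ffunE bc ?addr0.
split=> [[ny oy sy]|[H1 H2]].
  split; last by have := oy p op; rewrite ffunE.
  by have /eqP := cnorm_local pq xy; rewrite ny nx !ffunE -!addnA eqn_add2l => /eqP.
apply: (croot_local pq Dx xy); rewrite ?ffunE ?oq //.
by have [_ _ sb] := Db; move=> z; rewrite csumD sx ?sb ?addr0.
Qed.

Lemma croot_bounds x : croot x -> (`|x p| <= 1)%N /\ (`|x p| + `|x q| <= 2)%N.
Proof.
by move=> [nx ox _]; split; [exact: ox|rewrite -nx; exact: cnorm_le].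
Qed.

Lemma croot_eqN x : croot x -> x p = - be p -> x q = - be q -> x + be = 0.
Proof.
move=> [nx _ _] xp xq; apply/ffunP => c; rewrite !ffunE.
have [->|cp] := eqVneq c p; first by rewrite xp addNr.
have [->|cq] := eqVneq c q; first by rewrite xq addNr.
by rewrite bc // addr0; apply: (cnorm_supp pq _ cp cq); lia.
Qed.

(** If neither [x] nor [y] can absorb [be] or equals [- be], both have their two coordinates in the
    cone of [iso_coords]. Then so does [x + y], and [be] cannot be added to it. *)
Lemma ciso_split x y : croot x -> croot y -> croot (x + y) ->
  croot (x + y + be) ->
  (croot (x + be) \/ x + be = 0) \/ (croot (y + be) \/ y + be = 0).
Proof.
move=> Dx Dy Dxy /(croot_add_iso Dxy) [H1 H2].
have [Bx1 Bx2] := croot_bounds Dx; have [By1 By2] := croot_bounds Dy.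
have [Bz1 Bz2] := croot_bounds Dxy.
have cx := (croot_add_iso Dx).2; have cy := (croot_add_iso Dy).2.
have ex := croot_eqN Dx; have ey := croot_eqN Dy.
rewrite !ffunE in H1 H2 Bz1 Bz2.
have kx := iso_coords bp bq Bx1 Bx2; have ky := iso_coords bp bq By1 By2.
have [kz1 kz2] := iso_coords_ok bp bq Bz1 Bz2 H1 H2.
case: kx => [[k1 k2]|[[k1 k2]|[kx1 kx2]]]; [by left; left; exact: cx|by left; right;
  exact: ex|].
case: ky => [[k1 k2]|[[k1 k2]|[ky1 ky2]]]; [by right; left; exact: cy|by right; right;
  exact: ey|].
rewrite !mulrDr in kz1 kz2.
by case: (iso_cone kx1 kx2 ky1 ky2 kz1 kz2).
Qed.

Lemma ciso_orth x : croot x -> croot (x + be) -> cform x be <> 0.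
Proof.
move=> Dx /(croot_add_iso Dx) [H1 H2]; have [Bx1 Bx2] := croot_bounds Dx.
by rewrite cform_iso; have [] := iso_coords_string bp bq Bx1 Bx2 H1 H2.
Qed.

Lemma ciso_string x : croot x -> croot (x + be) -> ~ croot (x + be + be).
Proof.
move=> Dx Dxb /(croot_add_iso Dxb) [H3 H4].
move/(croot_add_iso Dx): Dxb => [H1 H2]; have [Bx1 Bx2] := croot_bounds Dx.
have [_] := iso_coords_string bp bq Bx1 Bx2 H1 H2.
by rewrite !ffunE in H3 H4; exact.
Qed.

End Isotropic.

Lemma ciso_add be x : croot be -> cform be be = 0 -> croot x -> cform x be <> 0 ->
  croot (x + be) \/ croot (x - be).
Proof.
move=> Db ib Dx fx; have [p [q [op oq [bp bq] bc]]] := croot_iso Db ib.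
have [Bx1 Bx2] := croot_bounds op oq Dx.
rewrite (cform_iso op oq bc) in fx.
have DbN := croot_opp Db.
have bpN : `|(- be)%R p|%N = 1%N by rewrite ffunE abszN.
have bqN : `|(- be)%R q|%N = 1%N by rewrite ffunE abszN.
have bcN c : c != p -> c != q -> (- be) c = 0 by move=> cp cq; rewrite ffunE bc ?oppr0.
case: (iso_coords_add bp bq Bx1 Bx2 fx) => [[H1 H2]|[H1 H2]]; [left|right].
  exact/(croot_add_iso op oq bc Db Dx).
by apply/(croot_add_iso op oq bcN DbN Dx); rewrite !ffunE.
Qed.

Definition csv (s : bool) p : L := [ffun a => if a == p then (if s then -1 else 1) else 0].

Lemma csvN s p : - csv s p = csv (~~ s) p.
Proof. by apply/ffunP => a; rewrite !ffunE; case: eqP => //; case: s;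
  rewrite ?oppr0 ?opprK. Qed.

Lemma cform_csv x s p : cform x (csv s p) = csg p * x p * (if s then -1 else 1).
Proof.
rewrite /cform (bigD1 p) //= big1 ?addr0 ?ffunE ?eqxx // => a /negbTE ap.
by rewrite ffunE ap mulr0.
Qed.

Lemma cformDl x y z : cform (x + y) z = cform x z + cform y z.
Proof. by rewrite /cform -big_split /=; apply: eq_bigr => a _;
  rewrite ffunE mulrDr mulrDl. Qed.

Lemma cform_sym x y : cform x y = cform y x.
Proof. by rewrite /cform; apply: eq_bigr => a _; rewrite -!mulrA (mulrC (x a)). Qed.

Lemma cformDr x y z : cform z (x + y) = cform z x + cform z y.
Proof. by rewrite cform_sym cformDl !(cform_sym z). Qed.

Lemma cformNN x y : cform (- x) (- y) = cform x y.
Proof. by rewrite /cform; apply: eq_bigr => a _; rewrite !ffunE; ring. Qed.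

Lemma cformMzl x y (k : int) : cform (x *~ k) y = k * cform x y.
Proof. by rewrite /cform mulr_sumr; apply: eq_bigr => a _; rewrite ffunMzE -mulrzr intz;
  ring. Qed.

Lemma csum_csv s p : csum (csv s p) = if s then -1 else 1.
Proof.
rewrite /csum (bigD1 p) //= big1 ?addr0 ?ffunE ?eqxx // => a /negbTE ap.
by rewrite ffunE ap.
Qed.

Lemma croot_pair s p t q : (p = q -> odd p /\ s = t) -> (zs -> s = ~~ t) ->
  croot (csv s p + csv t q).
Proof.
move=> pq st; split; last by move=> z; rewrite csumD !csum_csv (st z); case: t {pq st}.
- have [E|pq'] := eqVneq p q.
    have [_ E2] := pq E; subst q t; rewrite /cnorm (bigD1 p) //= big1 ?addn0.
      by rewrite !ffunE eqxx; case: s {pq st}.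
    by move=> a /negbTE ap; rewrite !ffunE ap.
  rewrite (cnorm_split _ pq') !ffunE !eqxx (negbTE pq') eq_sym (negbTE pq').
  rewrite big1; first by case: s {pq st}; case: t.
  by move=> a /andP [/negbTE ap /negbTE aq]; rewrite !ffunE ap aq.
- move=> a oa; rewrite !ffunE; case: eqP => [ap|_]; last first.
    by case: eqP => // _; case: (t).
  case: eqP => [aq|_]; last by case: (s).
  have [op _] : odd p /\ s = t by apply: pq; rewrite -ap.
  by rewrite ap op in oa.
Qed.

Lemma croot_pairE x : croot x -> exists s p t q,
  [/\ p = q -> odd p /\ s = t, zs -> s = ~~ t & x = csv s p + csv t q].
Proof.
move=> Dx; have [_ _ sx] := Dx.
have sgE (k : int) : `|k|%N = 1%N -> k = if k < 0 then -1 else 1 by move=> k1;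
  case: ifP; lia.
case: (croot_shape Dx) => [[p [q [pq xp xq xc]]]|[p [xp op z xc]]].
  exists (x p < 0), p, (x q < 0), q; split; first by move=> E; rewrite E eqxx in pq.
    move=> z; have := sx z; rewrite /csum (bigD1 p) //= (bigD1 q) 1?eq_sym //=.
    rewrite big1 => [|c /andP [cp cq]]; last exact: xc.
    by move: xp xq; case: (ltP (x p) 0); case: (ltP (x q) 0) => //; lia.
  apply/ffunP => a; rewrite !ffunE; have [->|ap] := eqVneq a p.
    by rewrite (negbTE pq) addr0; exact: sgE.
  by have [->|aq] := eqVneq a q; rewrite add0r; [exact: sgE|rewrite xc].
exists (x p < 0), p, (x p < 0), p; split=> //; first by rewrite z.
apply/ffunP => a; rewrite !ffunE; have [->|ap] := eqVneq a p; last by rewrite xc // addr0.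
by move: (x p) xp => k; case: ltP => /= ? ?; lia.
Qed.

Lemma croot_fin : exists s : seq L, forall x, croot x -> x \in s.
Proof.
exists [seq [ffun a => (g a : nat)%:Z - 2] | g : {ffun 'I_N
  -> 'I_5} <- enum {: {ffun 'I_N -> 'I_5}}].
move=> x [nx _ _]; apply/mapP; exists [ffun a => inord `|(x a + 2)%R|%N].
  by rewrite mem_enum.
apply/ffunP => a; rewrite !ffunE.
have xa : (`|x a| <= 2)%N by rewrite -nx /cnorm (bigD1 a) //= leq_addr.
move: (x a) xa => k k2; have k0 : 0 <= k + 2 by lia.
by rewrite inordK; lia.
Qed.

Lemma croot_neq0 x : croot x -> x <> 0.
Proof. by move=> /croot_neq [p xp] E; rewrite E ffunE in xp. Qed.

Lemma croot_mul x n : (1 < n)%N -> croot x -> croot (x *+ n) -> False.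
Proof.
move=> n1 [nx _ _] [+ _ _].
have -> : cnorm (x *+ n) = (cnorm x * n)%N.
  by rewrite /cnorm big_distrl; apply: eq_bigr => a _;
    rewrite ffunMnE -mulr_natr abszM natz.
by rewrite nx; lia.
Qed.

(** For [a] twice a unit vector the reflection changes one sign. Otherwise nonisotropy forces equal
    parities, and two coordinates are exchanged up to sign. *)
Lemma croot_refl a x : croot a -> cform a a <> 0 -> croot x ->
  exists2 c : int, 2 * cform x a = c * cform a a & croot (x - a *~ c).
Proof.
move=> /croot_pairE [s [p [t [q [pqE zst ->]]]]] fa Dx; have [nx ox sx] := Dx.
have [E|pq] := eqVneq p q.
  have [op E2] := pqE E; subst q t; exists (x p * if s then -1 else 1).
    rewrite !cformDr !cformDl !cform_csv !ffunE eqxx /csg op; case: (s); ring.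
  split.
  - rewrite -nx /cnorm; apply: eq_bigr => c _; rewrite !ffunE ffunMzE !ffunE.
    case: eqP => [->|_]; last by rewrite addr0 mul0rz subr0.
    by rewrite -mulrzr intz; case: (s) => /=; move: (x p) => k; lia.
  - move=> c oc; rewrite !ffunE ffunMzE !ffunE; case: eqP => [E3|_].
      by rewrite E3 op in oc.
    by rewrite addr0 mul0rz subr0; exact: ox.
  - by move=> z; move: (zst z); case: (s).
have oE : odd p = odd q.
  apply/eqP; apply: contrapT => /negP opq; apply: fa.
  rewrite !cformDr !cformDl !cform_csv !ffunE !eqxx (negbTE pq) eq_sym (negbTE pq).
  by rewrite /csg; case: (odd p) opq; case: (odd q) => //; case: (s); case: (t).
set e1 : int := if s then -1 else 1; set e2 : int := if t then -1 else 1.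
exists (e1 * x p + e2 * x q).
  rewrite !cformDr !cformDl !cform_csv !ffunE !eqxx (negbTE pq) eq_sym (negbTE pq).
  by rewrite -/e1 -/e2 /csg oE /e1 /e2; case: (odd q); case: (s); case: (t); ring.
have ap : (x - (csv s p + csv t q) *~ (e1 * x p + e2 * x q)) p = - (e1 * e2 * x q).
  rewrite !ffunE ffunMzE !ffunE !eqxx (negbTE pq) -/e1 -mulrzr intz /e1 /e2.
  by case: (s); case: (t); ring.
have aq : (x - (csv s p + csv t q) *~ (e1 * x p + e2 * x q)) q = - (e1 * e2 * x p).
  rewrite !ffunE ffunMzE !ffunE !eqxx eq_sym (negbTE pq) -/e2 -mulrzr intz /e1 /e2.
  by case: (s); case: (t); ring.
have e12 : `|(e1 * e2)%R|%N = 1%N by rewrite /e1 /e2; case: (s); case: (t).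
apply: (croot_local pq Dx).
- move=> c cp cq; rewrite !ffunE ffunMzE !ffunE (negbTE cp) (negbTE cq) addr0 mul0rz.
  by rewrite subr0.
- by rewrite ap aq !abszN abszM [in X in (_ + X)%N]abszM e12 !mul1n addnC.
- by rewrite ap abszN abszM e12 mul1n oE; exact: ox.
- by rewrite aq abszN abszM e12 mul1n -oE; exact: ox.
- move=> z; rewrite csumD csumN csumMz csumD !csum_csv sx // (zst z) -/e2.
  by rewrite /e2; case: (t); rewrite ?addNr ?addrN mul0r oppr0.
Qed.

End ClassicalModel.

(** * Bases from a height function *)

Section HeightBase.
Variables (L : zmodType) (D : set L) (K : nat) (b : 'I_K -> L) (ht : L -> int).
Hypothesis htD : {morph ht : x y / x + y}.

Lemma int_morph0 : ht 0 = 0.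
Proof. by apply: (addrI (ht 0)); rewrite -htD !addr0. Qed.
Lemma int_morphN : {morph ht : x / - x}.
Proof. by move=> x; apply: (addrI (ht x)); rewrite -htD !subrr int_morph0. Qed.
Lemma int_morphMn x n : ht (x *+ n) = ht x *+ n.
Proof. by elim: n => [|n IH]; rewrite ?mulr0n ?int_morph0 // !mulrS htD IH. Qed.
Lemma int_morphMz x n : ht (x *~ n) = ht x *~ n.
Proof. by case: n => n; rewrite ?NegzE ?mulrNz ?int_morphN -!pmulrn int_morphMn. Qed.
Lemma int_morph_sum (I : finType) (F : I -> L) : ht (\sum_i F i) = \sum_i ht (F i).
Proof. by apply: (big_morph ht htD int_morph0). Qed.

Hypothesis fb : lin_indep b.
Hypothesis Db : forall i, D (b i).
Hypothesis htb : forall i, 0 < ht (b i).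
Hypothesis Dopp : forall x, D x -> D (- x).
Hypothesis ht0 : forall x, D x -> ht x <> 0.
Hypothesis dec : forall x, D x -> 0 < ht x -> (exists i, x = b i) \/
  exists y z, [/\ D y, D z, 0 < ht y, 0 < ht z & x = y + z].

Lemma height_Pos x : D x -> 0 < ht x -> Pos b x.
Proof.
move: {2}`|ht x|%N (leqnn `|ht x|) => n; elim: n x => [|n IH] x xn Dx hx; first lia.
case: (dec Dx hx) => [[i ->]|[y [z [Dy Dz hy hz E]]]]; first exact: Pos_base.
by rewrite E; move: xn; rewrite E htD => xn; apply: PosD; apply: IH => //; lia.
Qed.

Lemma root_base_height : root_base D b.
Proof.
split=> // [x Dx|x Dx [k E]].
  have := ht0 Dx; case: (ltP 0 (ht x)) => hx hn; first by left; exact: height_Pos.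
  by right; apply: height_Pos; [exact: Dopp|rewrite int_morphN; lia].
have hx : 0 < ht x.
  have := ht0 Dx; suff : 0 <= ht x by lia.
  rewrite E int_morph_sum sumr_ge0 // => i _.
  by rewrite int_morphMn mulrn_wge0 // ltW.
case: (dec Dx hx) => [|[y [z [Dy Dz hy hz e]]]]; [by left|right].
by exists y, z; split=> //; exact: height_Pos.
Qed.

End HeightBase.

Lemma lin_indep_dual (L : zmodType) K (b : 'I_K -> L) (w : 'I_K -> L -> int) :
  (forall i, {morph w i : x y / x + y}) -> (forall i, w i (b i) <> 0) ->
  (forall i j, i != j -> w i (b j) = 0) -> lin_indep b.
Proof.
move=> wD wi wj k E i; have := congr1 (w i) E.
rewrite (int_morph0 (wD i)) (int_morph_sum (wD i)) (bigD1 i) //= big1.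
  rewrite addr0 int_morphMz // -mulrzr intz => /eqP.
  by rewrite mulf_eq0 => /orP [] /eqP // /wi.
by move=> j ji; rewrite int_morphMz // wj ?mul0rz // eq_sym.
Qed.

(** * Standard bases of the classical systems *)

Section ClassicalSuper.
Variables (n : nat) (odd : 'I_n.+2 -> bool) (zs : bool).
Local Notation L := {ffun 'I_n.+2 -> int}.
Local Notation N := n.+2.
Local Notation croot := (@croot N odd zs).
Implicit Types (x y : L) (p q r : 'I_N).
Hypothesis odd0 : odd ord0.
Hypothesis odd_last : ~~ odd ord_max.
Hypothesis zsn : zs -> (0 < n)%N.

Let ev s (k : nat) : L := csv s (inord k).

Lemma ev_root s i t j : (i < N)%N -> (j < N)%N ->
  (i = j -> odd (inord i) /\ s = t) -> (zs -> s = ~~ t) -> croot (ev s i + ev t j).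
Proof.
move=> iN jN ij st; apply: croot_pair => // E; apply: ij.
by have := congr1 val E; rewrite /= !inordK.
Qed.

Lemma ev_rootE x : croot x -> exists s i t j, [/\ (i <= j < N)%N,
  i = j -> odd (inord i) /\ s = t, zs -> s = ~~ t & x = ev s i + ev t j].
Proof.
move=> /croot_pairE [s [p [t [q [pq st ->]]]]].
case: (leqP p q) => c.
  exists s, p, t, q; rewrite /ev !inord_val; split=> //; first by rewrite c ltn_ord.
  by move=> E; apply: pq; exact: val_inj.
exists t, q, s, p; rewrite /ev !inord_val; split; last by rewrite addrC.
- by rewrite (ltnW c) ltn_ord.
- by move=> E; rewrite E ltnn in c.
- by move=> /st ->; rewrite negbK.
Qed.

Lemma evKr s k x y : x + ev s k + (ev (~~ s) k + y) = x + y.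
Proof. by rewrite /ev -csvN addrA addrK. Qed.

Definition cdot (w : nat -> int) x := \sum_(a < N) w a * x a.
Lemma cdotD w : {morph cdot w : x y / x + y}.
Proof.
by move=> x y; rewrite /cdot -big_split /=; apply: eq_bigr => a _; rewrite ffunE mulrDr.
Qed.
Lemma cdot_ev w s k : (k < N)%N -> cdot w (ev s k) = w k * if s then -1 else 1.
Proof.
move=> kN; rewrite /cdot (bigD1 (inord k)) //= big1 ?addr0.
  by rewrite ffunE eqxx inordK.
by move=> a /negbTE ak; rewrite ffunE ak mulr0.
Qed.

(** A diagram of type A, with a fork of type D at the end for osp. The last coordinate is even, so
    its double is no root and the fork is right; the first one is odd, so [2 e_0] is a root and
    becomes the highest one. *)
Definition std (k : nat) : L :=
  if (k <= n)%N then ev false k + ev true k.+1 else ev false n + ev false n.+1.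
Let K := (n.+1 + ~~ zs)%N.
Let b : 'I_K -> L := fun i => std i.
(** All simple roots get height 1, including the last one of the fork, since the last coordinate has
    weight 0. *)
Let ht := cdot (fun a => (n.+1 - a)%:Z).
(** Functionals dual to [std] up to a factor: partial sums, and for the two ends of the fork the sum
    of all coordinates, with the last one negated for [k = n]. *)
Let w (k : nat) := cdot (fun a => if zs || (k < n)%N then (a <= k)%N%:Z
  else 1 - ((k == n) && (n < a)%N)%:Z * 2).

Lemma cdot_std w0 k : cdot w0 (std k) =
  if (k <= n)%N then w0 k - w0 k.+1 else w0 n + w0 n.+1.
Proof. by rewrite /std; case: leqP => kn; rewrite cdotD !cdot_ev; lia. Qed.

Lemma std_lin_indep : lin_indep b.
Proof.
apply: (@lin_indep_dual _ _ _ (fun i => w i)) => [i|i|i j].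
- exact: cdotD.
- rewrite /b /w cdot_std; have := ltn_ord i; rewrite /K; move: (val i) => k.
  by case: (zs) => /= kn; [|case: (ltnP k n) => ? /=]; case: (leqP k n) => ?; lia.
- rewrite -(inj_eq val_inj) /b /w cdot_std /=; have := ltn_ord i; have := ltn_ord j.
  rewrite {1 2}/K; move: (val i) (val j) => k l.
  by case: (zs) => /= ? ? ?; [|case: (ltnP k n) => ? /=]; case: (leqP l n) => ?; lia.
Qed.

Lemma std_root k : (k < K)%N -> croot (std k).
Proof.
rewrite /std /K; case: (leqP k n) => kn kK; apply: ev_root => //; lia.
Qed.

Lemma last_even : ~~ odd (inord n.+1).
Proof. by have -> : inord n.+1 = ord_max :> 'I_N by apply: val_inj; rewrite /= inordK. Qed.
Lemma first_odd : odd (inord 0).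
Proof. by have -> : inord 0 = ord0 :> 'I_N by apply: val_inj; rewrite /= inordK. Qed.

Lemma std_height_neq0 x : croot x -> ht x <> 0.
Proof.
move=> /ev_rootE [s [i [t [j [ij E st ->]]]]]; rewrite /ht cdotD !cdot_ev; try lia.
have [e|ne] := eqVneq i j; last by case: s {E st}; case: t; lia.
have [oi <-] := E e; have : i != n.+1 by apply: contraTneq oi => ->; exact: last_even.
by case: (s); lia.
Qed.

Lemma std_dec x : croot x -> 0 < ht x -> (exists i, x = b i) \/
  exists y z, [/\ croot y, croot z, 0 < ht y, 0 < ht z & x = y + z].
Proof.
move=> /ev_rootE [s [i [t [j [ij E st ->]]]]]; rewrite {1}/ht cdotD !cdot_ev; try lia.
case: s E st => E st; first by case: t E st => E st; lia.
move=> hp; case: t E st hp => E st hp.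
  have lij : (i < j)%N by case: (ltngtP i j) => //; [lia|move=> /E []].
  have [e|ne] := eqVneq j i.+1.
    have iK : (i < K)%N by rewrite /K; lia.
    by left; exists (Ordinal iK); rewrite /b /std /=; case: leqP; [rewrite e|lia].
  right; exists (ev false i + ev true i.+1), (ev false i.+1 + ev true j).
  split; try (by apply: ev_root => //; lia); try by rewrite /ht cdotD !cdot_ev; lia.
  by rewrite evKr.
have z : zs = false by case: zs st => // /(_ isT).
case: (ltnP j n.+1) => jn.
  right; exists (ev false i + ev false j.+1), (ev true j.+1 + ev false j).
  split; try (by apply: ev_root => //; rewrite ?z //; lia); last by rewrite evKr.
    by rewrite /ht cdotD !cdot_ev; lia.
  by rewrite /ht cdotD !cdot_ev; lia.
have jE : j = n.+1 by lia.
have ij' : (i < j)%N.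
  case: (ltngtP i j) => //; [lia|move=> e; have [oi _] := E e].
  by move: oi; rewrite e jE (negbTE last_even).
case: (ltnP i n) => iN.
  right; exists (ev false i + ev true n), (ev false n + ev false n.+1).
  split; try (by apply: ev_root => //; rewrite ?z //; lia); try
    by rewrite /ht cdotD !cdot_ev; lia.
  by rewrite evKr jE.
have nK : (n.+1 < K)%N by rewrite /K z; lia.
left; exists (Ordinal nK); rewrite /b /std /= ltnn jE.
by have -> : i = n by lia.
Qed.

Lemma std_root_base : root_base croot b.
Proof.
apply: (@root_base_height _ _ _ _ ht).
- exact: cdotD.
- exact: std_lin_indep.
- by move=> i; exact: std_root.
- move=> i; rewrite /ht /b cdot_std; case: leqP; lia.
- exact: croot_opp.
- exact: std_height_neq0.
- exact: std_dec.
Qed.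

(** The cases go by signs and positions: unless the root is [e_0 - e_(n+1)] for gl or [2 e_0] for
    osp, a nonzero coordinate can be moved towards the front, or its sign changed at the fork. *)
Lemma std_highest x : croot x ->
  x = (ev false 0 + if zs then ev true n.+1 else ev false 0) \/
  exists i : 'I_K, croot (x + b i) \/ x + b i = 0.
Proof.
move=> /ev_rootE [s [i [t [j [ij E st ->]]]]].
have go k : (k < K)%N -> (croot (ev s i + ev t j + std k) \/ ev s i + ev t j + std k = 0) ->
    exists i0 : 'I_K, croot (ev s i + ev t j + b i0) \/ ev s i + ev t j + b i0 = 0.
  by move=> kK H; exists (Ordinal kK).
have stdl k : (k <= n)%N -> std k = ev true k.+1 + ev false k.
  by move=> kn; rewrite /std kn addrC.
have stdL : std n.+1 = ev false n + ev false n.+1 by rewrite /std ltnn.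
have nK : (n < K)%N by rewrite /K; lia.
case: s E st go => E st go; case: t E st go => E st go.
- have z : zs = false by case: (zs) st => // /(_ isT).
  have nK' : (n.+1 < K)%N by rewrite /K z; lia.
  case: (ltnP j n.+1) => jn.
    right; apply: (go j); first lia.
    left; rewrite /std -ltnS jn evKr; apply: ev_root; rewrite ?z //; lia.
  have jE : j = n.+1 by lia.
  have ij' : (i < j)%N.
    case: (ltngtP i j) => //; [lia|move=> e; have [oi _] := E e].
    by move: oi; rewrite e jE (negbTE last_even).
  case: (ltnP i n) => iN.
    right; apply: (go i); first lia.
    left; rewrite /std (ltnW iN) (addrC (ev true i)) evKr.
    by apply: ev_root; rewrite ?z //; lia.
  right; apply: (go n.+1) => //; right.
  have -> : i = n by lia.
  by rewrite jE stdL /ev -!(csvN false) addrACA !addNr addr0.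
- have lij : (i < j)%N by case: (ltngtP i j) => //; [lia|move=> /E []].
  right; apply: (go j.-1); first lia.
  have jE : j = j.-1.+1 by lia.
  rewrite stdl; last lia.
  rewrite {1 2 4 5}jE evKr; have [->|ne] := eqVneq i j.-1.
    by right; rewrite /ev -(csvN false) addNr.
  by left; apply: ev_root => //; lia.
- have lij : (i < j)%N by case: (ltngtP i j) => //; [lia|move=> /E []].
  case: (posnP i) => i0.
    case: (ltnP j n.+1) => jn.
      right; apply: (go j); first lia.
      by left; rewrite /std -ltnS jn evKr i0; apply: ev_root; rewrite ?z //; lia.
    have jE : j = n.+1 by lia.
    have [z|z] : zs = true \/ zs = false by case: (zs); [left|right].
      by left; rewrite i0 jE z.
    right; apply: (go n.+1); first by rewrite /K z; lia.
    left; rewrite stdL jE (addrC (ev false n)) evKr i0; apply: ev_root; rewrite ?z //.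
    by move=> _; split=> //; exact: first_odd.
  right; apply: (go i.-1); first lia.
  have iE : i = i.-1.+1 by lia.
  left; rewrite stdl; last lia.
  by rewrite {1}iE (addrC (ev false _)) evKr; apply: ev_root => //; lia.
- have z : zs = false by case: (zs) st => // /(_ isT).
  have [e|ne] := eqVneq i j.
    have [oi _] := E e; case: (posnP i) => i0; first by left; rewrite z -e i0.
    right; apply: (go i.-1); first lia.
    have iE : i = i.-1.+1 by lia.
    left; rewrite stdl; last lia.
    by rewrite {1}iE (addrC (ev false _)) evKr; apply: ev_root; rewrite ?z //; lia.
  have jE : j = j.-1.+1 by lia.
  (* For [j = i + 1], moving [j] forward yields [2 e_i], a root only if [i] is odd; otherwise [i] is
     moved. *)
  case oi : ((i < j.-1)%N || odd (inord i)).
    right; apply: (go j.-1); first lia.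
    left; rewrite stdl; last lia.
    rewrite {1}jE evKr; apply: ev_root; rewrite ?z //; lia.
  have i0 : (0 < i)%N by rewrite lt0n; apply: contraFN oi => /eqP ->;
    rewrite first_odd orbT.
  right; apply: (go i.-1); first lia.
  have iE : i = i.-1.+1 by lia.
  left; rewrite stdl; last lia.
  by rewrite {1}iE (addrC (ev false _)) evKr; apply: ev_root; rewrite ?z //; lia.
Qed.

Lemma std_good : good_base croot b.
Proof.
split; first exact: std_root_base.
have top x : locally_highest croot b x ->
    x = (ev false 0 + if zs then ev true n.+1 else ev false 0).
  by move=> [Dx H]; case: (std_highest Dx) => // [[i []]]; have [] := H i.
by move=> x y /top -> /top ->.
Qed.

End ClassicalSuper.

Lemma ord_third n (p q : 'I_n) : (2 < n)%N -> exists r, r != p /\ r != q.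
Proof.
move=> n2; apply: contrapT => H.
have : (size (enum 'I_n) <= size [:: p; q])%N.
  apply: uniq_leq_size (enum_uniq _) _ => r _; rewrite !inE.
  by apply: contrapT => /negP; rewrite negb_or => /andP [rp rq]; apply: H; exists r.
by rewrite size_enum_ord /= leqNgt n2.
Qed.

(** * Long roots and connectedness in the classical systems *)

Section ClassicalSupersystem.
Variables (n : nat) (odd : 'I_n.+2 -> bool) (zs : bool).
Local Notation N := n.+2.
Local Notation L := {ffun 'I_N -> int}.
Local Notation croot := (@croot N odd zs).
Local Notation cform := (@cform N odd).
Implicit Types (x y : L) (p q r : 'I_N).
Hypothesis odd0 : odd ord0.
Hypothesis odd_last : ~~ odd ord_max.
Hypothesis zsn : zs -> (0 < n)%N.

(** For gl a third index is needed, which [zsn] provides; for osp the root [2 e_q] serves. *)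
Lemma croot_nonorth be : croot be -> cform be be = 0 ->
  exists2 x, croot x & cform x be <> 0.
Proof.
move=> Db ib; have [p [q [op oq [bp bq] bc]]] := croot_iso Db ib.
have [z|z] : zs = true \/ zs = false by case: (zs); [left|right].
  have [r [rp rq]] := ord_third p q (zsn z).
  exists (csv false p + csv true r).
    by apply: croot_pair => // E; rewrite E eqxx in rp.
  have qp : q == p = false by apply: contraNF op => /eqP <-.
  rewrite (cform_iso op oq bc) !ffunE eqxx qp !(eq_sym _ r) (negbTE rp) (negbTE rq).
  by move: (be p) (be q) bp bq => u v; lia.
exists (csv false q + csv false q); first by apply: croot_pair => //; rewrite z.
rewrite (cform_iso op oq bc) !ffunE eqxx (negbTE (_ : p != q)); last first.
  by apply: contraNneq op => ->.
by move: (be p) (be q) bp bq => u v; lia.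
Qed.

Lemma long_double x q s : zs = false -> odd q -> long_root cform croot (csv s q + csv s q).
Proof.
move=> z oq; split.
- by apply: croot_pair => //; rewrite z.
- by rewrite !cformDr !cform_csv !ffunE eqxx /csg oq; case: s.
move=> y Dy; rewrite !cformDr !cform_csv !ffunE eqxx /csg oq.
set e : int := if s then -1 else 1.
have [y1|y1] := leqP `|y q| 1.
  apply: Or33; exists (e * y q); first by rewrite /e; case: (s); lia.
  by rewrite /e intz; case: (s); ring.
have [ny _ _] := Dy.
have y2 : `|y q|%N = 2%N.
  have : (`|y q| <= 2)%N by rewrite -ny /cnorm (bigD1 q) //= leq_addr.
  lia.
have yc c : c != q -> y c = 0.
  move=> cq; have := cnorm_le y cq; rewrite ny y2.
  by rewrite -[X in (_ <= X)%N]add0n leq_add2r leqn0 absz_eq0 => /eqP.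
suff : y = csv s q + csv s q \/ y = - (csv s q + csv s q) by case;
  [exact: Or31|exact: Or32].
have : y q = e *+ 2 \/ y q = - (e *+ 2) by rewrite /e; case: (s); lia.
case=> yq; [left|right]; apply/ffunP => c; rewrite !ffunE -/e;
  by have [->|cq] := eqVneq c q; [rewrite yq mulr2n|rewrite yc // addr0 ?oppr0].
Qed.

Lemma long_diff s p t q : p != q -> odd p = odd q -> (zs -> s = ~~ t) -> zs || ~~ odd p ->
  long_root cform croot (csv s p + csv t q).
Proof.
move=> pq opq st zp.
have Da : croot (csv s p + csv t q).
  by apply: croot_pair => // E; rewrite E eqxx in pq.
set e1 : int := if s then -1 else 1; set e2 : int := if t then -1 else 1.
have fa y : cform y (csv s p + csv t q) = csg odd q * (e1 * y p + e2 * y q).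
  by rewrite !cformDr !cform_csv /csg opq -/e1 -/e2; ring.
split=> //.
  rewrite fa !ffunE !eqxx (negbTE pq) eq_sym (negbTE pq) /csg /e1 /e2.
  by case: (odd q); case: (s); case: (t).
move=> y Dy; rewrite !fa !ffunE !eqxx (negbTE pq) eq_sym (negbTE pq) -/e1 -/e2.
have [ny oy sy] := Dy; have := cnorm_le y pq; rewrite ny => npq.
have [c2|c2] := leqP `|(e1 * y p + e2 * y q)%R| 1.
  apply: Or33; exists (e1 * y p + e2 * y q); first by lia.
  rewrite intz addr0 add0r.
  have -> : e1 * e1 + e2 * e2 = 2 by rewrite /e1 /e2; case: (s); case: (t).
  ring.
have [y1 y2] : `|y p|%N = 1%N /\ `|y q|%N = 1%N.
  have [z|z] : zs = true \/ zs = false by case: (zs); [left|right].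
    have yc := cnorm_supp pq (x := y).
    have {}c2 : (`|y p| + `|y q| = 2)%N.
      by move: (y p) (y q) c2 npq; rewrite /e1 /e2; case: (s); case: (t);
        clear => u v /=; lia.
    have := sy z; rewrite /csum (bigD1 p) //= (bigD1 q) 1?eq_sym //= big1.
      by rewrite addr0; move: (y p) (y q) c2 => u v; clear; lia.
    by move=> c /andP [cp cq]; apply: yc => //; rewrite ny.
  move: zp; rewrite z /= => op; have y1 := oy _ op; have y2 := oy q; rewrite -opq in y2.
  move: (y p) (y q) y1 (y2 op) c2 npq; rewrite /e1 /e2.
  by case: (s); case: (t); clear => u v /=; lia.
have yc c : c != p -> c != q -> y c = 0.
  by move=> cp cq; apply: (cnorm_supp pq) => //; rewrite ny y1 y2.
suff : y = csv s p + csv t q \/ y = - (csv s p + csv t q) by case;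
  [exact: Or31|exact: Or32].
have : y p = e1 /\ y q = e2 \/ y p = - e1 /\ y q = - e2.
  by move: (y p) (y q) y1 y2 c2; rewrite /e1 /e2; case: (s); case: (t); clear => u v /=;
    lia.
case=> [[yp yq]|[yp yq]]; [left|right]; apply/ffunP => c; rewrite !ffunE -/e1 -/e2;
  (have [->|cp] := eqVneq c p; first by rewrite (negbTE pq) addr0);
  by have [->|cq] := eqVneq c q; [rewrite add0r|rewrite yc // addr0 ?oppr0].
Qed.

(** For gl the long roots join indices of equal parity. For osp they are the doubles of odd
    coordinates and the roots on two even coordinates. Any other root shares one coordinate with a
    suitable long root. *)
Lemma croot_long x : croot x -> long_root cform croot x \/
  exists2 a, long_root cform croot a & 2 * cform x a = cform a a \/ 2 * cform x a
    = - cform a a.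
Proof.
move=> Dx; have [s [p [t [q [pq st E]]]]] := croot_pairE Dx.
have [z|z] : zs = true \/ zs = false by case: (zs); [left|right].
  have npq : p != q.
    by apply/eqP => /pq [_ e]; move: (st z); rewrite e; case: (t).
  have [opq|opq] := eqVneq (odd p) (odd q).
    by left; rewrite E; apply: long_diff => //; rewrite z.
  right; have [r [rp rq]] := ord_third p q (zsn z).
  have [orp|orp] := eqVneq (odd p) (odd r).
    exists (csv s p + csv (~~ s) r); first by apply: long_diff; rewrite ?z ?negbK // eq_sym.
    left; rewrite E !cformDr !cform_csv !ffunE !eqxx /csg orp.
    rewrite (negbTE npq) (negbTE rp) (negbTE rq) eq_sym (negbTE rp).
    by case: (odd r); case: (s).
  have orq : odd q = odd r by case: (odd p) (odd q) (odd r) opq orp => [] [] [].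
  exists (csv t q + csv (~~ t) r); first by apply: long_diff; rewrite ?z ?negbK // eq_sym.
  left; rewrite E !cformDr !cform_csv !ffunE !eqxx /csg orq.
  rewrite (eq_sym q) (negbTE npq) (negbTE rp) (negbTE rq) eq_sym (negbTE rq).
  by case: (odd r); case: (t).
have H r : odd r -> x r <> 0 -> `|x r|%N = 1%N -> exists2 a, long_root cform croot a &
    2 * cform x a = cform a a \/ 2 * cform x a = - cform a a.
  move=> or xr x1; exists (csv false r + csv false r); first exact: long_double.
  rewrite !cformDr !cform_csv !ffunE eqxx /csg or.
  by move: (x r) x1 => k; lia.
have [e|npq] := eqVneq p q.
  by have [op et] := pq e; left; rewrite E -et -e; exact: long_double.
case op : (odd p).
  right; apply: (H p op); rewrite E !ffunE eqxx (negbTE npq); by case: (s).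
case oq : (odd q).
  right; apply: (H q oq); rewrite E !ffunE eqxx eq_sym (negbTE npq); by case: (t).
by left; rewrite E; apply: long_diff => //; rewrite op // orbT.
Qed.

Section Connected.
Variable T : L -> Prop.
Hypothesis Tiso : forall x b, croot x -> croot b -> cform b b = 0 -> croot (x + b) ->
  T x -> T (x + b).
Hypothesis Trefl : forall x a (c : int), croot x -> croot a -> cform a a <> 0 ->
  2 * cform x a = c%:~R * cform a a -> T x -> T (x - a *~ c).

(** Adding an isotropic root moves one signed coordinate to an index of the other parity. *)
Lemma conn_iso s p t q u r : croot (csv s p + csv t q) -> croot (csv s p + csv u r) ->
  odd q != odd r -> (zs -> t = u) ->
  T (csv s p + csv t q) <-> T (csv s p + csv u r).
Proof.
move=> D1 D2 oqr tu.
have nqr : q != r by apply: contraNneq oqr => ->.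
have Db : croot (csv (~~ t) q + csv u r).
  by apply: croot_pair => [E|/tu ->] //; rewrite E eqxx in nqr.
have ib : cform (csv (~~ t) q + csv u r) (csv (~~ t) q + csv u r) = 0.
  rewrite !cformDr !cform_csv !ffunE !eqxx (eq_sym r) (negbTE nqr) /csg.
  by move: oqr; case: (odd q); case: (odd r) => //; case: (t); case: (u).
have e : csv s p + csv t q + (csv (~~ t) q + csv u r) = csv s p + csv u r.
  by rewrite -csvN addrA addrK.
split=> [H|H]; first by rewrite -e; apply: Tiso; rewrite ?e.
have e2 : csv s p + csv u r + - (csv (~~ t) q + csv u r) = csv s p + csv t q.
  by rewrite -e addrK.
rewrite -e2; apply: Tiso; rewrite ?e2 //; first exact: croot_opp.
by rewrite cformNN.
Qed.

Lemma conn_refl x y a (c : int) : croot x -> croot y -> croot a -> cform a a <> 0 ->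
  y = x - a *~ c -> 2 * cform x a = c * cform a a -> T x <-> T y.
Proof.
move=> Dx Dy Da fa ey cx; split=> H; first by rewrite ey; apply: Trefl => //; rewrite intz.
have -> : x = y - a *~ (- c) by rewrite mulrNz opprK ey subrK.
apply: Trefl => //; rewrite intz ey.
have -> : x - a *~ c = x + a *~ (- c) by rewrite mulrNz.
by rewrite cformDl cformMzl mulrDr cx; ring.
Qed.

Lemma conn_same s p t q r : p != q -> p != r -> (zs -> s = ~~ t) -> odd q = odd r ->
  T (csv s p + csv t q) <-> T (csv s p + csv t r).
Proof.
move=> pq pr st oqr; have [<-//|qr] := eqVneq q r.
have D1 : croot (csv s p + csv t q) by apply: croot_pair => // E; rewrite E eqxx in pq.
have D2 : croot (csv s p + csv t r) by apply: croot_pair => // E; rewrite E eqxx in pr.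
apply: (@conn_refl _ _ (csv (~~ t) q + csv t r) (-1)) => //.
- by apply: croot_pair => // E; rewrite E eqxx in qr.
- rewrite !cformDr !cform_csv !ffunE !eqxx (eq_sym r) (negbTE qr) /csg oqr.
  by case: (odd r); case: (t).
- by rewrite mulrN1z opprK -csvN addrA addrK.
- rewrite !cformDr !cform_csv !ffunE !eqxx (eq_sym r q) (eq_sym q p) (eq_sym r p).
  rewrite (negbTE pq) (negbTE pr) (negbTE qr) /csg oqr.
  by case: (odd r); case: (t).
Qed.

Lemma conn_gl x y : zs -> croot x -> croot y -> T x -> T y.
Proof.
move=> z.
have step s p t q r : p != q -> p != r -> s = ~~ t ->
    T (csv s p + csv t q) <-> T (csv s p + csv t r).
  move=> pq pr st; have [oqr|oqr] := eqVneq (odd q) (odd r); first exact: conn_same.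
  by apply: conn_iso => //; apply: croot_pair => // E;
    [rewrite E eqxx in pq|rewrite E eqxx in pr].
have step2 p q p' q' : p != q -> p' != q' -> p' != q ->
    T (csv false p + csv true q) <-> T (csv false p' + csv true q').
  move=> pq pq' pq2; apply: (iff_trans (B := T (csv false p' + csv true q))).
    by rewrite (addrC (csv false p)) (addrC (csv false p')); apply: step; rewrite 1?eq_sym.
  exact: step.
have all p q p' q' : p != q -> p' != q' ->
    T (csv false p + csv true q) <-> T (csv false p' + csv true q').
  move=> pq pq'; have [e|ne] := eqVneq p' q; last exact: step2.
  (* If [p' = q] the two moves would collide, so the path goes through a third index. *)
  have [r [rp rq]] := ord_third p' p (zsn z).
  apply: (iff_trans (B := T (csv false p + csv true r))).
    by apply: step2 => //; rewrite eq_sym.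
  by apply: step2 => //; rewrite eq_sym.
have shape x0 : croot x0 -> exists p q, p != q /\ x0 = csv false p + csv true q.
  move=> /croot_pairE [s [p1 [t [q1 [pq1 st ->]]]]].
  have npq : p1 != q1 by apply/eqP => /pq1 [_ e]; move: (st z); rewrite e; case: (t).
  rewrite (st z); case: (t); first by exists p1, q1.
  by exists q1, p1; rewrite eq_sym addrC.
by move=> /shape [p [q [pq ->]]] /shape [p' [q' [pq' ->]]] /(all _ _ _ _ pq pq').
Qed.

(** Every root is connected to [2 e_0]: isotropic moves change the parity of an index, and the
    reflection in [flip] changes the sign of [e_0]. *)
Lemma conn_osp x y : zs = false -> croot x -> croot y -> T x -> T y.
Proof.
move=> z.
have Dp s p t q : (p = q -> odd p /\ s = t) -> croot (csv s p + csv t q).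
  by move=> H; apply: croot_pair => //; rewrite z.
have iso s p t q u r : (p = q -> odd p /\ s = t) -> (p = r -> odd p /\ s = u) ->
    odd q != odd r -> T (csv s p + csv t q) <-> T (csv s p + csv u r).
  by move=> H1 H2 o; apply: conn_iso => //; [exact: Dp|exact: Dp|rewrite z].
have ol : odd ord_max = false by exact/negbTE.
have l0 : ord_max <> ord0 :> 'I_N by move=> E; move: odd_last; rewrite E odd0.
have flip : T (csv false ord_max + csv true ord0) <-> T (csv false ord_max + csv false
  ord0).
  apply: (@conn_refl _ _ (csv false ord0 + csv false ord0) (-1)).
  - by apply: Dp => /l0.
  - by apply: Dp => /l0.
  - exact: Dp.
  - by rewrite !cformDr !cform_csv !ffunE !eqxx /csg odd0.
  - rewrite mulrN1z opprK -(csvN false) -!addrA; congr (_ + _).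
    by rewrite addKr.
  - by rewrite !cformDr !cform_csv !ffunE !eqxx /csg odd0; case: eqP => // /esym/l0.
have A t q : odd q -> T (csv false ord_max + csv t q) <-> T (csv false ord0 + csv false
  ord0).
  move=> oq; have A0 : T (csv false ord0 + csv false ord_max) <->
      T (csv false ord0 + csv false ord0).
    by apply: iso; rewrite ?ol ?odd0 // => /esym/l0.
  have [e|q0] := eqVneq q ord0.
    by subst q; case: t; first (apply: (iff_trans flip)); rewrite addrC.
  have lq : q <> ord_max by move=> e; rewrite e ol in oq.
  have zq : q <> ord0 by apply/eqP.
  apply: (iff_trans (B := T (csv t q + csv false ord0))).
    by rewrite addrC; apply: iso; rewrite ?ol ?odd0.
  apply: iff_trans A0; rewrite addrC; apply: iso; rewrite ?oq ?ol //.
    by move=> e; case: zq.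
have B s p t q : odd p -> (p = q -> odd p /\ s = t) ->
    T (csv s p + csv t q) <-> T (csv false ord0 + csv false ord0).
  move=> op pq; have pl : p <> ord_max by move=> e; rewrite e ol in op.
  have B0 : T (csv s p + csv false ord_max) <-> T (csv false ord0 + csv false ord0).
    by rewrite addrC; exact: A.
  case oq : (odd q); first by apply: iff_trans B0; apply: iso => //; rewrite oq ol.
  apply: (iff_trans (B := T (csv s p + csv s p))).
    by apply: iso => //; rewrite oq op.
  by apply: iff_trans B0; apply: iso => //; rewrite op ol.
suff all x0 : croot x0 -> T x0 <-> T (csv false ord0 + csv false ord0).
  by move=> Dx Dy /(all _ Dx).1 /(all _ Dy).2.
move=> /croot_pairE [s [p [t [q [pq _ ->]]]]].
case op : (odd p); first by apply: B.
case oq : (odd q).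
  by rewrite addrC; apply: B => // e; have [] := pq (esym e); rewrite op.
have p0 : p <> ord0 by move=> e; rewrite e odd0 in op.
apply: (iff_trans (B := T (csv s p + csv false ord0))).
  by apply: iso; rewrite ?oq ?odd0.
by rewrite addrC; apply: iso; rewrite ?op ?odd0 // => /esym/p0.
Qed.

End Connected.

Lemma classical_supersystem : supersystem cform croot.
Proof.
have io0 : croot (csv false ord_max + csv true ord0).
  by apply: croot_pair => // E; move: odd_last; rewrite E odd0.
split.
- exact: croot_fin.
- exact: croot_opp.
- exact: croot_neq0.
- by move=> x k k1 Dx /(croot_mul k1 Dx).
- move=> a x Da fa Dx; have [c ? ?] := croot_refl Da fa Dx.
  by exists c; rewrite ?intz.
- exact: croot_nonorth.
- by move=> be x Db ib Dx; exact: ciso_add.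
- move=> be x Db ib Dx; have [p [q [op oq [bp bq] bc]]] := croot_iso Db ib.
  exact: (ciso_orth op oq bp bq bc Db).
- move=> be x Db ib Dx; have [p [q [op oq [bp bq] bc]]] := croot_iso Db ib.
  exact: (ciso_string op oq bp bq bc Db).
- move=> be x y Db ib; have [p [q [op oq [bp bq] bc]]] := croot_iso Db ib.
  exact: (ciso_split op oq bp bq bc Db).
- exact: croot_long.
- move=> T T1 T2 x y; have [z|z] : zs = true \/ zs = false by case: (zs); [left|right].
    by apply: conn_gl T1 T2 _ _ z.
  by apply: conn_osp T1 T2 _ _ z.
- exists (csv false ord_max + csv true ord0) => //.
  rewrite !cformDr !cform_csv !ffunE !eqxx /csg odd0 (negbTE odd_last).
  by case: eqP => // E; move: odd_last; rewrite E odd0.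
- by exists (n.+1 + ~~ zs)%N; eexists; exact: std_good.
Qed.

End ClassicalSupersystem.

(** * Finite models checked by computation *)

Section FiniteModel.
Variables (L : zmodType) (f : L -> L -> int) (l : seq L).
Variables (bs : seq L) (ht : L -> int) (ws : seq (L -> int)) (B : nat).
Implicit Types (x y a b : L).

Let isiso b := f b b == 0.
(** The division is exact on the roots, which [model_check] verifies by multiplying back. *)
Definition refl_coef x a : int := ((2 * f x a) %/ f a a)%Z.
Definition longb a := (f a a != 0) && all (fun x => [|| x == a, x == - a |
  has (fun c : int => 2 * f x a == c * f a a) [:: -1; 0; 1]]) l.
(** Edges are directed, because [ss_conn] transports [T] one way; the check asks for both
    directions. *)
Definition conn_edge x y := ((y - x \in l) && isiso (y - x)) ||
  has (fun a => (f a a != 0) && (y == x - a *~ refl_coef x a)) l.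
Definition highestb x := all (fun b => (x + b \notin l) && (x + b != 0)) bs.

(** The nested [if] spares call-by-value evaluation the inner loop when the outer test already
    decides. *)
Definition isob b := has (fun x => f x b != 0) l &&
    all (fun x => [&& (f x b != 0) ==> (x + b \in l) || (x - b \in l),
      (x + b \in l) ==> (f x b != 0) && (x + b + b \notin l) &
      if (x + b \in l) || (x + b == 0) then true else
      all (fun y => if (y + b \in l) || (y + b == 0) then true
        else if x + y \in l then x + y + b \notin l else true) l]) l.

(* [supersystem] as a computation on the list [l] of roots: [ht] takes positive
   values on the base [bs] and at most [B] on [l], the functionals [ws] are dual to
   [bs] up to scaling, and each root in [l] is connected to an earlier one. *)
Definition model_check := [&&
  (uniq l) && (0 \notin l), all (fun x => - x \in l) l,
  all (fun x => (ht x != 0) && (`|ht x| <= B)%N) l,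
  all (fun n => all (fun x => (x *+ n \in l) ==> (n == 2%N) && ~~ isiso x) l) (iota 2 B),
  all (fun a => isiso a || all (fun x =>
    (2 * f x a == refl_coef x a * f a a) && (x - a *~ refl_coef x a \in l)) l) l &
  [&& all (fun b => isiso b ==> isob b) l,
  all (fun x => longb x || has (fun a => longb a &&
    ((2 * f x a == f a a) || (2 * f x a == - f a a))) l) l,
  all (fun i => has (fun y => conn_edge (nth 0 l i) y && conn_edge y (nth 0 l i))
     (take i l)) (iota 1 (size l).-1),
  has isiso l &
  [&& all (fun b => (b \in l) && (0 < ht b)) bs,
    all (fun i => all (fun j => (nth (fun=> 0) ws i (nth 0 bs j) != 0) == (i == j))
      (iota 0 (size bs))) (iota 0 (size bs)),
    all (fun x => (0 < ht x) ==> (x \in bs) ||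
      has (fun y => [&& 0 < ht y, x - y \in l & 0 < ht (x - y)]) l) l &
    all (fun x => all (fun y => highestb x && highestb y ==> (x == y)) l) l]]].

Hypothesis htD : {morph ht : x y / x + y}.
Hypothesis wD : forall i, (i < size bs)%N ->
  {morph nth (fun=> 0) ws i : x y / x + y}.
Hypothesis ok : model_check.

Lemma model_supersystem : supersystem f [set x | x \in l].
Proof.
have := ok.
case/and5P => /andP [ul n0] /allP Hopp /allP Hht /allP Hmul /andP [/allP Hrefl].
case/and5P => /allP Hiso /allP Hlong /allP Hconn /hasP [b0 Db0 /eqP ib0].
case/and4P => /allP Hb /allP Hw /allP Hdec /allP Hhigh.
have isoP b : b \in l -> f b b = 0 -> isob b.
  by move=> Db ib; have := Hiso _ Db; rewrite /isiso ib eqxx.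
have longP a : a \in l -> longb a -> long_root f [set x | x \in l] a.
  move=> Da /andP [/eqP fa /allP H]; split=> // x Dx.
  have /or3P [/eqP|/eqP|/hasP [c c3 /eqP e]] := H _ Dx; [by constructor|by constructor|].
  by apply: Or33; exists c; [move: c c3 {e}; apply/allP|rewrite intz].
split.
- by exists l.
- by move=> x /Hopp.
- by move=> x Dx e; move: n0; rewrite -e; move/negP.
- move=> x n n1 Dx Dxn; have /andP [h0 hB] := Hht _ Dx; have /andP [_ hnB] := Hht _ Dxn.
  (* Heights of roots are nonzero and bounded by [B], so a multiple by [n] can be a root only for
     [n] up to [B]. *)
  have nB : n \in iota 2 B.
    rewrite mem_iota n1 /=; move: hnB; rewrite int_morphMn // -mulr_natr abszM natz.
    by move=> hnB; have := leq_pmull n (_ : 0 < `|ht x|)%N; rewrite absz_gt0 => /(_ h0);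
      lia.
  have /allP/(_ x Dx) := Hmul _ nB; rewrite Dxn /= => /andP [/eqP -> /eqP ?].
  by [].
- move=> a x Da /eqP fa Dx; have := Hrefl _ Da; rewrite /isiso (negbTE fa) /=.
  by move/allP/(_ x Dx)/andP => [/eqP e ?]; exists (refl_coef x a); rewrite ?intz.
- move=> b Db ib; have /andP [/hasP [x Dx /eqP fx] _] := isoP _ Db ib.
  by exists x.
- move=> b x Db ib Dx /eqP fx; have /andP [_ /allP/(_ x Dx)/and3P [H _ _]] := isoP _ Db ib.
  by apply/orP; move: H; rewrite fx.
- move=> b x Db ib Dx Dxb; have /andP [_ /allP/(_ x Dx)/and3P [_ H _]] := isoP _ Db ib.
  by move: H; rewrite Dxb /= => /andP [/eqP].
- move=> b x Db ib Dx Dxb; have /andP [_ /allP/(_ x Dx)/and3P [_ H _]] := isoP _ Db ib.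
  by move: H; rewrite Dxb /= => /andP [_ /negP].
- move=> b x y Db ib Dx Dy Dxy Dxyb.
  have /andP [_ /allP/(_ x Dx)/and3P [_ _]] := isoP _ Db ib.
  case: ifP => [/orP [?|/eqP ?] _|_ /allP/(_ y Dy)]; [by left; left|by left; right|].
  case: ifP => [/orP [?|/eqP ?] _|_]; [by right; left|by right; right|].
  by rewrite Dxy Dxyb.
- move=> x Dx; have /orP [lx|/hasP [a Da /andP [la fa]]] := Hlong _ Dx.
    by left; exact: longP.
  right; exists a; first exact: longP.
  by case/orP: fa => /eqP; [left|right].
- move=> T T1 T2; have edge x y : x \in l -> y \in l -> conn_edge x y -> T x -> T y.
    move=> Dx Dy /orP [/andP [Db /eqP ib] Tx|/hasP [a Da /andP [fa /eqP ->]] Tx].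
      by rewrite -[y](addrNK x) addrC; apply: T1 => //; rewrite /= addrC addrNK.
    apply: T2 => //; first exact/eqP.
    have := Hrefl _ Da; rewrite /isiso (negbTE fa) /=.
    by move/allP/(_ x Dx)/andP => [/eqP e ?]; rewrite intz.
  (* Strong induction: the root at each position is joined to one at a smaller position. *)
  have all i : (i < size l)%N -> T (nth 0 l i) <-> T (nth 0 l 0).
    elim/ltn_ind: i => i IH il; case: i IH il => // i IH il.
    have /hasP [y yt /andP [e1 e2]] : has (fun y => conn_edge (nth 0 l i.+1) y &&
        conn_edge y (nth 0 l i.+1)) (take i.+1 l).
      by apply: Hconn; rewrite mem_iota; lia.
    have yl : y \in l by exact: mem_take yt.
    have yi : (index y l < i.+1)%N by exact: index_ltn.
    have := IH _ yi; rewrite nth_index // index_mem => /(_ yl) <-.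
    by split; apply: edge => //; exact: mem_nth.
  have T0 x : x \in l -> T x <-> T (nth 0 l 0).
    by move=> Dx; rewrite -{1}(nth_index 0 Dx); apply: all; rewrite index_mem.
  by move=> x y /T0 H1 /T0 H2 /H1 /H2.
- by exists b0.
- exists (size bs), (fun i => nth 0 bs i); split.
    apply: (@root_base_height _ _ _ _ ht htD).
    + apply: (@lin_indep_dual _ _ _ (fun i => nth (fun=> 0) ws i)).
      * by move=> i; apply: wD.
      * move=> i; have := Hw i; rewrite mem_iota /= => /(_ (ltn_ord i))/allP/(_ i).
        by rewrite mem_iota /= eqxx => /(_ (ltn_ord i))/eqP/eqP.
      * move=> i j ij; have := Hw i; rewrite mem_iota /= => /(_ (ltn_ord i))/allP/(_ j).
        rewrite mem_iota /= => /(_ (ltn_ord j)); rewrite (inj_eq val_inj) (negbTE ij).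
        by move=> /eqP/negbT; rewrite negbK => /eqP.
    + by move=> i; have /andP [] := Hb _ (mem_nth 0 (ltn_ord i)).
    + by move=> i; have /andP [] := Hb _ (mem_nth 0 (ltn_ord i)).
    + by move=> x /Hopp.
    + by move=> x /Hht /andP [/eqP].
    + move=> x Dx hx; have := Hdec _ Dx; rewrite hx /= => /orP [xb|/hasP [y Dy /and3P [?
      ? ?]]].
        have ib : (index x bs < size bs)%N by rewrite index_mem.
        by left; exists (Ordinal ib); rewrite /= nth_index.
      by right; exists y, (x - y); split=> //; rewrite addrC subrK.
  have hP x : locally_highest [set x | x \in l] (fun i : 'I_(size bs) => nth 0 bs i) x ->
      x \in l /\ highestb x.
    move=> [Dx H]; split=> //; apply/allP => b bb.
    have ib : (index b bs < size bs)%N by rewrite index_mem.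
    have [] := H (Ordinal ib); rewrite /= nth_index // => /negP -> /eqP ->.
    by [].
  move=> x y /hP [Dx hx] /hP [Dy hy].
  by have /allP/(_ y Dy) := Hhigh _ Dx; rewrite hx hy => /eqP.
Qed.

End FiniteModel.

Local Notation Z4 := (int * int * int * int)%type.

Definition dot4 (w x : Z4) : int :=
  w.1.1.1 * x.1.1.1 + w.1.1.2 * x.1.1.2 + w.1.2 * x.1.2 + w.2 * x.2.

Lemma dot4D w : {morph dot4 w : x y / x + y}.
Proof. by move=> x y; rewrite /dot4 /= !mulrDr; ring. Qed.

(** The last diagonal coefficient is -3, so that the vectors with all coordinates 1 or -1 are
    isotropic. *)
Definition f4_form (x y : Z4) : int := dot4 x y - 4 * (x.2 * y.2).
(** Here [e_0] and [e_1] have squares 2 and product -1, so [e_2 = - e_0 - e_1] has square 2 too; [d]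
    has square -2, which makes each [e_i + d] isotropic. *)
Definition g3_form (x y : Z4) : int :=
  2 * (x.1.1.1 * y.1.1.1 + x.1.1.2 * y.1.1.2 - x.1.2 * y.1.2)
  - (x.1.1.1 * y.1.1.2 + x.1.1.2 * y.1.1.1).

Definition sgn1 : seq int := [:: 1; -1].
(* Coordinates with respect to the basis [e_i/2, d/2]. *)
Definition f4_even : seq Z4 :=
  [seq (0, 0, 0, 2 * s) | s <- sgn1] ++
  [seq x | s <- sgn1, x <- [:: (2 * s, 0, 0, 0); (0, 2 * s, 0, 0); (0, 0, 2 * s, 0)]] ++
  [seq x | x <- [seq (s, t) | s <- sgn1, t <- sgn1],
    x <- [:: (2 * x.1, 2 * x.2, 0, 0); (2 * x.1, 0, 2 * x.2, 0); (0, 2 * x.1, 2 * x.2, 0)]].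
Definition f4_odd : seq Z4 :=
  [seq (x.1, x.2, y.1, y.2) | x <- [seq (s, t) | s <- sgn1, t <- sgn1],
    y <- [seq (s, t) | s <- sgn1, t <- sgn1]].
(** The order matters: the check joins each root to an earlier one. *)
Definition f4_roots := f4_odd ++ f4_even.
Definition f4_base : seq Z4 := [:: (-1, -1, -1, 1); (0, 0, 2, 0); (0, 2, -2, 0); (2, -2,
  0, 0)].
Definition f4_dual := map dot4 [:: (0, 0, 0, 1); (1, 1, 1, 3); (1, 1, 0, 2); (1, 0, 0, 1)].

(* Coordinates with respect to [e_0, e_1, d]; the fourth one is a dummy. *)
Definition g3_e : seq Z4 := [:: (1, 0, 0, 0); (0, 1, 0, 0); (-1, -1, 0, 0)].
Definition g3_d : seq Z4 := [seq (0, 0, s, 0) | s <- sgn1].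
Definition g3_2d : seq Z4 := [seq (0, 0, 2 * s, 0) | s <- sgn1].
Definition g3_short : seq Z4 := [seq x *~ s | x <- g3_e, s <- sgn1].
Definition g3_long : seq Z4 :=
  [seq x *~ s | x <- [:: (1, -1, 0, 0); (2, 1, 0, 0); (1, 2, 0, 0)], s <- sgn1].
Definition g3_iso : seq Z4 := [seq x + y | x <- g3_short, y <- g3_d].
Definition g3_roots := g3_d ++ g3_short ++ g3_iso ++ g3_2d ++ g3_long.
Definition g3_base : seq Z4 := [:: (-1, -1, 1, 0); (0, 1, 0, 0); (1, -1, 0, 0)].
Definition g3_dual := map dot4 [:: (0, 0, 1, 0); (1, 1, 2, 0); (1, 0, 1, 0)].

Lemma f4_supersystem : supersystem f4_form [set x | x \in f4_roots].
Proof.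
(* The height is 2 on every simple root, and its maximum 16 is attained at [(0, 0, 0, 2)]. *)
apply: (@model_supersystem _ _ _ f4_base (dot4 (3, 2, 1, 8)) f4_dual 16).
- exact: dot4D.
- by case=> [|[|[|[|]]]] // _; exact: dot4D.
- by vm_cast_no_check (erefl true).
Qed.

Lemma g3_supersystem : supersystem g3_form [set x | x \in g3_roots].
Proof.
(* The height is 1 on every simple root, and its maximum 8 is attained at [(0, 0, 2, 0)]. *)
apply: (@model_supersystem _ _ _ g3_base (dot4 (2, 1, 4, 0)) g3_dual 8).
- exact: dot4D.
- by case=> [|[|[|]]] // _; exact: dot4D.
- by vm_cast_no_check (erefl true).
Qed.

(** * The root systems of the listed superalgebras *)

Section ModelRoots.
Variables (C : numClosedFieldType) (gd : quadLSA C).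
Local Notation Hs := 'Hom(q_H gd, C^o).
Local Notation io := (@q_io _ gd).
Local Notation form := (dform (@q_hform _ gd)).
Local Notation Rt := (@q_roots _ gd).
Variables (L : zmodType) (fm : L -> L -> int) (Dm : set L).
Variables (p : {additive L -> Hs}) (Lz : set L).
Hypothesis Lz_add : forall x y, Lz x -> Lz y -> Lz (x + y).
Hypothesis Lz_opp : forall x, Lz x -> Lz (- x).
Hypothesis Lz_root : forall x, Dm x -> Lz x.
Hypothesis p_inj : forall x, Lz x -> p x = 0 -> x = 0.
Hypothesis DE : Rt = p @` Dm.

Lemma model_root x : Lz x -> Rt (p x) <-> Dm x.
Proof.
move=> Lx; rewrite DE; split=> [[y Dy E]|Dx]; last by exists x.
suff -> : x = y by [].
apply/eqP; rewrite -subr_eq0; apply/eqP/p_inj; last by rewrite raddfB E subrr.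
by apply: Lz_add => //; apply/Lz_opp/Lz_root.
Qed.

Lemma model_orth x y : Dm x -> Dm y -> ~ Dm (x + y) -> x + y <> 0 ->
  ~ Dm (y - x) -> y - x <> 0 -> form (p x) (p y) = 0.
Proof.
move=> Dx Dy n1 z1 n2 z2.
have Lx := Lz_root Dx; have Ly := Lz_root Dy; have LNx := Lz_opp Lx.
apply: root_orth; rewrite -?raddfD -?raddfB; first 1 last.
- exact/model_root.
- by move/model_root => H; apply/n1/H/Lz_add.
- by move/p_inj => H; apply/z1/H/Lz_add.
- by move/model_root => H; apply/n2/H/Lz_add.
- by move/p_inj => H; apply/z2/H/Lz_add.
- exact/model_root.
Qed.

Lemma model_isotropic x : Dm x -> roots_of_parity io true (p x) -> ~ Dm (x + x) ->
  form (p x) (p x) = 0.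
Proof.
move=> Dx ox n1; apply: (odd_root_isotropic ox) => H; apply/n1/model_root.
  by apply: Lz_add; exact: Lz_root.
by rewrite raddfD; apply/q_rootsP; exists false.
Qed.

Lemma model_super ka : supersystem fm Dm ->
  (forall x y, Dm x -> Dm y -> form (p x) (p y) = ka * (fm x y)%:~R) ->
  (exists2 a, Rt a & @q_sqlen _ gd a = 2) -> supersystem form Rt.
Proof.
move=> ssm fE [a Ra a2]; apply: (transport_supersystem ssm Lz_add Lz_opp Lz_root p_inj DE
  _ fE).
apply: contraTneq isT => ka0; move: Ra; rewrite DE => -[x Dx E].
by move/eqP: a2; rewrite /q_sqlen -E fE // ka0 mul0r eq_sym pnatr_eq0.
Qed.

End ModelRoots.

Section FourVectors.
Variables (V : zmodType) (u1 u2 u3 u4 : V).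
Definition p4 (x : int * int * int * int) : V :=
  u1 *~ x.1.1.1 + u2 *~ x.1.1.2 + u3 *~ x.1.2 + u4 *~ x.2.
Lemma p4_morph : GRing.zmod_morphism p4.
Proof.
by move=> x y; rewrite /p4 /= !mulrzBr !opprD !addrA (ACl (1*3*5*7*2*4*6*8)).
Qed.
HB.instance Definition _ := GRing.isZmodMorphism.Build _ _ p4 p4_morph.
End FourVectors.

Definition sgz (b : bool) : int := if b then -1 else 1.
Lemma signZ (C : numClosedFieldType) (V : lmodType C) (b : bool) (v : V) :
  (-1) ^+ b *: v = v *~ sgz b.
Proof. by case: b; rewrite ?expr1 ?scaleN1r ?expr0 ?scale1r ?mulrN1z. Qed.

Lemma p4_inj (C : numClosedFieldType) (V : vectType C) (u1 u2 u3 u4 : V) x :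
  free [:: u1; u2; u3; u4] -> p4 u1 u2 u3 u4 x = 0 -> x = 0.
Proof.
move=> /(freeP (X := [tuple u1; u2; u3; u4])) H E.
pose c := [:: x.1.1.1; x.1.1.2; x.1.2; x.2].
have /H k0 : \sum_(i < 4) ((nth 0 c i)%:~R : C) *: [tuple u1; u2; u3; u4]`_i = 0.
  by rewrite !big_ord_recl big_ord0 addr0 !scaler_int !addrA -[RHS]E.
have := k0 (@Ordinal 4 0 isT); have := k0 (@Ordinal 4 1 isT).
have := k0 (@Ordinal 4 2 isT); have := k0 (@Ordinal 4 3 isT).
move=> /= /eqP + /eqP + /eqP + /eqP; rewrite !intr_eq0 => /eqP + /eqP + /eqP + /eqP.
by case: x {E c k0} => [[[? ?] ?] ?] /= -> -> -> ->.
Qed.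

Lemma p4_mulz (V : zmodType) (u1 u2 u3 u4 : V) k x :
  p4 (u1 *~ k) (u2 *~ k) (u3 *~ k) (u4 *~ k) x = p4 u1 u2 u3 u4 x *~ k.
Proof. by rewrite /p4 !mulrzDl !(mulrzAC _ k). Qed.

Section P4Form.
Variables (C : numClosedFieldType) (gd : quadLSA C).
Local Notation form := (dform (@q_hform _ gd)).
Variables u1 u2 u3 u4 : 'Hom(q_H gd, C^o).

Lemma p4_form x y : form (p4 u1 u2 u3 u4 x) (p4 u1 u2 u3 u4 y) =
  let: (x1, x2, x3, x4) := x in let: (y1, y2, y3, y4) := y in
  (x1 * y1)%:~R * form u1 u1 + (x2 * y2)%:~R * form u2 u2
  + (x3 * y3)%:~R * form u3 u3 + (x4 * y4)%:~R * form u4 u4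
  + (x1 * y2 + x2 * y1)%:~R * form u1 u2 + (x1 * y3 + x3 * y1)%:~R * form u1 u3
  + (x2 * y3 + x3 * y2)%:~R * form u2 u3 + (x1 * y4 + x4 * y1)%:~R * form u1 u4
  + (x2 * y4 + x4 * y2)%:~R * form u2 u4 + (x3 * y4 + x4 * y3)%:~R * form u3 u4.
Proof.
case: x => [[[x1 x2] x3] x4]; case: y => [[[y1 y2] y3] y4].
have fl := @qform_linear _ gd; have fs := @qform_sym _ gd.
rewrite /p4 /= -!scaler_int !(fE fl fs) !(fs u2 u1) !(fs u3 u1) !(fs u4 u1) !(fs u3 u2).
by rewrite !(fs u4 u2) !(fs u4 u3) !rmorphD !rmorphM /=; ring.
Qed.
End P4Form.

Definition f4_e (i : nat) : Z4 :=
  match i with 0 => (2, 0, 0, 0) | 1 => (0, 2, 0, 0) | _ => (0, 0, 2, 0) end.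

Lemma f4_evenE (x : Z4) : x \in f4_even <->
  [\/ exists i j (a b : bool), [/\ (i < 3)%N, (j < 3)%N, i != j &
        x = f4_e i *~ sgz a + f4_e j *~ sgz b],
      exists i (a : bool), (i < 3)%N /\ x = f4_e i *~ sgz a |
      exists a : bool, x = (0, 0, 0, 2) *~ sgz a].
Proof.
split=> [xl|].
  have : all (fun x => [|| has (fun i => has (fun j => has (fun a => has (fun b =>
      (i != j) && (x == f4_e i *~ sgz a + f4_e j *~ sgz b)) [:: true; false])
      [:: true; false]) (iota 0 3)) (iota 0 3),
    has (fun i => has (fun a => x == f4_e i *~ sgz a) [:: true; false]) (iota 0 3) |
    has (fun a => x == (0, 0, 0, 2) *~ sgz a) [:: true; false]]) f4_even by vm_compute.
  move=> /allP/(_ x xl)/or3P [].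
  - move=> /hasP [i +] /hasP [j +] /hasP [a _] /hasP [b _] /andP [ij /eqP E].
    by rewrite !mem_iota => i3 j3; apply: Or31; exists i, j, a, b.
  - move=> /hasP [i +] /hasP [a _] /eqP E.
    by rewrite mem_iota => i3; apply: Or32; exists i, a.
  - by move=> /hasP [a _ /eqP E]; apply: Or33; exists a.
case=> [[i [j [a [b [i3 j3 ij ->]]]]]|[i [a [i3 ->]]]|[a ->]].
- by move: i j i3 j3 ij => [|[|[|]]] // [|[|[|]]] // _ _ _; case: a; case: b; vm_compute.
- by move: i i3 => [|[|[|]]] // _; case: a; vm_compute.
- by case: a; vm_compute.
Qed.

Lemma f4_oddE (x : Z4) : x \in f4_odd <-> exists a b c d : bool,
  x = (sgz a, sgz b, sgz c, sgz d).
Proof.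
split=> [xl|[a [b [c [d ->]]]]]; last by case: a; case: b; case: c; case: d; vm_compute.
have : all (fun x => has (fun a => has (fun b => has (fun c => has (fun d =>
    x == (sgz a, sgz b, sgz c, sgz d)) [:: true; false]) [:: true; false])
    [:: true; false]) [:: true; false]) f4_odd by vm_compute.
move=> /allP/(_ x xl)/hasP [a _] /hasP [b _] /hasP [c _] /hasP [d _] /eqP E.
by exists a, b, c, d.
Qed.

Lemma I3E (i : 'I_3) : [\/ i = 0, i = 1 | i = 2%:R].
Proof.
case: i => [[|[|[|]]] //= lt]; [apply: Or31|apply: Or32|apply: Or33]; exact: val_inj.
Qed.

Lemma half_signed_sum (C : numClosedFieldType) (V : lmodType C) (e : 'I_3 -> V) d
    (a : 'I_3 -> bool) (b : bool) :
  2^-1 *: (\sum_i (-1) ^+ a i *: e i + (-1) ^+ b *: d) =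
  p4 (2^-1 *: e 0) (2^-1 *: e 1) (2^-1 *: e 2%:R) (2^-1 *: d)
    (sgz (a 0), sgz (a 1), sgz (a 2%:R), sgz b).
Proof.
rewrite signZ; under eq_bigr do rewrite signZ.
have -> F : \sum_(i < 3) F i = F 0 + F 1 + F 2%:R :> V.
  rewrite !big_ord_recl big_ord0 addr0 addrA.
  by congr (_ + F _ + F _); apply: val_inj.
by rewrite !scalerDr -!scalerMzr.
Qed.

Section F4.
Variables (C : numClosedFieldType) (gd : quadLSA C).
Local Notation Hs := 'Hom(q_H gd, C^o).
Local Notation io := (@q_io _ gd).
Local Notation form := (dform (@q_hform _ gd)).
Local Notation Rt := (@q_roots _ gd).

Lemma F4_supersystem : is_F4 gd -> (exists2 a, Rt a & @q_sqlen _ gd a = 2) ->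
  supersystem form Rt.
Proof.
move=> [_ _ [e [d [bas evE odE]]]] norm.
have h2 : (2 : C) != 0 by rewrite pnatr_eq0.
pose u i := 2^-1 *: e i; pose v : Hs := 2^-1 *: d.
pose p : {additive Z4 -> Hs} := p4 (u 0) (u 1) (u 2%:R) v.
have u2 i : u i *~ 2 = e i by rewrite -scaler_int scalerA mulfV ?scale1r.
have v2 : v *~ 2 = d by rewrite -scaler_int scalerA mulfV ?scale1r.
have pe (i : 'I_3) : p (f4_e i) = e i.
  by case: (I3E i) => ->; rewrite /p /= /p4 /= !mulr0z ?addr0 ?add0r u2.
have pd : p (0, 0, 0, 2) = d by rewrite /p /= /p4 /= !mulr0z !add0r v2.
have pinj x : p x = 0 -> x = 0.
  move=> px; apply: (p4_inj (basis_free bas)); rewrite -!u2 -v2.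
  by rewrite p4_mulz [p4 _ _ _ _ _]px mul0rz.
have evp : roots_of_parity io false = p @` [set x | x \in f4_even].
  rewrite evE; apply/seteqP; split=> al /=.
    case=> [[i [j [a [b [ij ->]]]]]|[i [a ->]]|[a ->]].
    - exists (f4_e i *~ sgz a + f4_e j *~ sgz b).
        by apply/f4_evenE/Or31; exists i, j, a, b; rewrite !ltn_ord.
      by rewrite raddfD !raddfMz !pe !signZ.
    - exists (f4_e i *~ sgz a); last by rewrite raddfMz pe signZ.
      by apply/f4_evenE/Or32; exists i, a; rewrite ltn_ord.
    - exists ((0, 0, 0, 2) *~ sgz a); last by rewrite raddfMz pd signZ.
      by apply/f4_evenE/Or33; exists a.
  move=> [x /f4_evenE xe <-].
  case: xe => [[i [j [a [b [i3 j3 ij ->]]]]]|[i [a [i3 ->]]]|[a ->]].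
  - apply: Or31; exists (Ordinal i3), (Ordinal j3), a, b; split=> //.
    by rewrite raddfD !raddfMz (pe (Ordinal i3)) (pe (Ordinal j3)) !signZ.
  - by apply: Or32; exists (Ordinal i3), a; rewrite raddfMz (pe (Ordinal i3)) signZ.
  - by apply: Or33; exists a; rewrite raddfMz pd signZ.
have odp : roots_of_parity io true = p @` [set x | x \in f4_odd].
  rewrite odE; apply/seteqP; split=> al /=.
    move=> [a [b ->]]; exists (sgz (a 0), sgz (a 1), sgz (a 2%:R), sgz b).
      by apply/f4_oddE; exists (a 0), (a 1), (a 2%:R), b.
    by rewrite half_signed_sum.
  move=> [x /f4_oddE [a [b [c [t ->]]]] <-].
  by exists (fun i => nth false [:: a; b; c] i), t; rewrite half_signed_sum.
have DE : Rt = p @` [set x | x \in f4_roots].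
  apply/seteqP; split=> [al /q_rootsP [[]]|_ [x xl <-]].
  - by rewrite odp => -[x xl <-]; exists x => //=; rewrite mem_cat; apply/orP; left.
  - by rewrite evp => -[x xl <-]; exists x => //=; rewrite mem_cat; apply/orP; right.
  apply/q_rootsP; move: xl; rewrite /= mem_cat => /orP [xl|xl].
    by exists true; rewrite odp; exists x.
  by exists false; rewrite evp; exists x.
have orth (x y : Z4) : [&& x \in f4_roots, y \in f4_roots, x + y \notin f4_roots,
    x + y != 0, y - x \notin f4_roots & y - x != 0] -> form (p x) (p y) = 0.
  move=> /and5P [Dx Dy /negP n1 /eqP z1 /andP [/negP n2 /eqP z2]].
  by apply: (model_orth (Lz := setT) _ _ _ _ DE) => // t _; exact: pinj.
have iso (x : Z4) : (x \in f4_odd) && (x + x \notin f4_roots) -> form (p x) (p x) = 0.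
  move=> /andP [Dx /negP n1].
  apply: (model_isotropic (Lz := setT) _ _ _ _ DE) => //.
  - by move=> t _; exact: pinj.
  - by rewrite /= mem_cat Dx.
  - by rewrite odp; exists x.
apply: (model_super (fm := f4_form) (Lz := setT) (ka := form (u 0) (u 0)) _ _ _ _ DE) => //.
- by move=> t _; exact: pinj.
- exact: f4_supersystem.
(* Orthogonality separates [d] from the [e i] and makes the [e i] equally long; four isotropic odd
   roots give the remaining products. *)
have o14 := orth (2, 0, 0, 0) (0, 0, 0, 2) isT.
have o24 := orth (0, 2, 0, 0) (0, 0, 0, 2) isT.
have o34 := orth (0, 0, 2, 0) (0, 0, 0, 2) isT.
have o12 := orth (2, 2, 0, 0) (2, -2, 0, 0) isT.
have o13 := orth (2, 0, 2, 0) (2, 0, -2, 0) isT.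
have i1 := iso (1, 1, 1, 1) isT; have i2 := iso (-1, 1, 1, 1) isT.
have i3 := iso (1, -1, 1, 1) isT; have i4 := iso (1, 1, -1, 1) isT.
rewrite !p4_form in o14 o24 o34 o12 o13 i1 i2 i3 i4.
have c4 (t : C) : 4 * t = 0 -> t = 0.
  by move/eqP; rewrite mulf_eq0 pnatr_eq0 => /eqP.
have q14 : form (u 0) v = 0 by apply: c4; rewrite -[RHS]o14; ring.
have q24 : form (u 1) v = 0 by apply: c4; rewrite -[RHS]o24; ring.
have q34 : form (u 2%:R) v = 0 by apply: c4; rewrite -[RHS]o34; ring.
have q2 : form (u 1) (u 1) = form (u 0) (u 0).
  by apply/esym/eqP; rewrite -subr_eq0; apply/eqP/c4; rewrite -[RHS]o12; ring.
have q3 : form (u 2%:R) (u 2%:R) = form (u 0) (u 0).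
  by apply/esym/eqP; rewrite -subr_eq0; apply/eqP/c4; rewrite -[RHS]o13; ring.
rewrite q14 q24 q34 q2 q3 in i1 i2 i3 i4.
have add0 (s t : C) : s = 0 -> t = 0 -> s + t = 0 by move=> -> ->; rewrite addr0.
(* Summed over the four sign patterns, the mixed products cancel. *)
have q4 : form v v = - 3 * form (u 0) (u 0).
  apply/eqP; rewrite -subr_eq0; apply/eqP/c4.
  by rewrite -[RHS](add0 _ _ (add0 _ _ i1 i2) (add0 _ _ i3 i4)); ring.
rewrite q4 in i1 i2 i3 i4.
have q12 : form (u 0) (u 1) = 0 by apply: c4; rewrite -[RHS](add0 _ _ i1 i4); ring.
have q13 : form (u 0) (u 2%:R) = 0 by apply: c4; rewrite -[RHS](add0 _ _ i1 i3); ring.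
have q23 : form (u 1) (u 2%:R) = 0 by apply: c4; rewrite -[RHS](add0 _ _ i1 i2); ring.
move=> [[[x1 x2] x3] x4] [[[y1 y2] y3] y4] _ _.
rewrite [form (p _) (p _)]p4_form q12 q13 q23 q14 q24 q34 q2 q3 q4 /f4_form /dot4 /=.
ring.
Qed.
End F4.


Definition g3e (i : nat) : Z4 := nth 0 g3_e i.
Definition g3_even := g3_short ++ g3_2d ++ g3_long.
Definition g3_odd := g3_d ++ g3_iso.

(** Stated for arbitrary lists, so that the concrete ones stay folded. *)
Lemma mem_cat_interleave (T : eqType) (a b c d e : seq T) x :
  (x \in a ++ b ++ c ++ d ++ e) = (x \in a ++ c) || (x \in b ++ d ++ e).
Proof. by rewrite !mem_cat; do ![case: (x \in _)]. Qed.

Lemma g3_rootsE (x : Z4) : (x \in g3_roots) = (x \in g3_odd) || (x \in g3_even).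
Proof. exact: mem_cat_interleave. Qed.

Lemma g3_evenE (x : Z4) : x \in g3_even <->
  [\/ exists i j, [/\ (i < 3)%N, (j < 3)%N, i != j & x = g3e i - g3e j],
      exists i (a : bool), (i < 3)%N /\ x = g3e i *~ sgz a |
      exists a : bool, x = (0, 0, 2, 0) *~ sgz a].
Proof.
split=> [xl|].
  have : all (fun x => [|| has (fun i => has (fun j =>
      (i != j) && (x == g3e i - g3e j)) (iota 0 3)) (iota 0 3),
    has (fun i => has (fun a => x == g3e i *~ sgz a) [:: true; false]) (iota 0 3) |
    has (fun a => x == (0, 0, 2, 0) *~ sgz a) [:: true; false]]) g3_even by vm_compute.
  move=> /allP/(_ x xl)/or3P [].
  - move=> /hasP [i +] /hasP [j +] /andP [ij /eqP E].
    by rewrite !mem_iota => i3 j3; apply: Or31; exists i, j.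
  - move=> /hasP [i +] /hasP [a _] /eqP E.
    by rewrite mem_iota => i3; apply: Or32; exists i, a.
  - by move=> /hasP [a _ /eqP E]; apply: Or33; exists a.
case=> [[i [j [i3 j3 ij ->]]]|[i [a [i3 ->]]]|[a ->]].
- by move: i j i3 j3 ij => [|[|[|]]] // [|[|[|]]] // _ _ _; vm_compute.
- by move: i i3 => [|[|[|]]] // _; case: a; vm_compute.
- by case: a; vm_compute.
Qed.

Lemma g3_oddE (x : Z4) : x \in g3_odd <->
  (exists i (a b : bool), (i < 3)%N /\ x = g3e i *~ sgz a + (0, 0, 1, 0) *~ sgz b) \/
  exists a : bool, x = (0, 0, 1, 0) *~ sgz a.
Proof.
split=> [xl|].
  have : all (fun x => has (fun i => has (fun a => has (fun b =>
      x == g3e i *~ sgz a + (0, 0, 1, 0) *~ sgz b) [:: true; false]) [:: true; false])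
      (iota 0 3) || has (fun a => x == (0, 0, 1, 0) *~ sgz a) [:: true; false]) g3_odd.
    by vm_compute.
  move=> /allP/(_ x xl)/orP [].
    move=> /hasP [i +] /hasP [a _] /hasP [b _] /eqP E; rewrite mem_iota => i3.
    by left; exists i, a, b.
  by move=> /hasP [a _ /eqP E]; right; exists a.
case=> [[i [a [b [i3 ->]]]]|[a ->]]; last by case: a; vm_compute.
by move: i i3 => [|[|[|]]] // _; case: a; case: b; vm_compute.
Qed.

Section G3.
Variables (C : numClosedFieldType) (gd : quadLSA C).
Local Notation Hs := 'Hom(q_H gd, C^o).
Local Notation io := (@q_io _ gd).
Local Notation form := (dform (@q_hform _ gd)).
Local Notation Rt := (@q_roots _ gd).

Lemma G3_supersystem : is_G3 gd -> (exists2 a, Rt a & @q_sqlen _ gd a = 2) ->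
  supersystem form Rt.
Proof.
move=> [_ _ [e [d [[e0 bas] evE odE]]]] norm.
pose p : {additive Z4 -> Hs} := p4 (e 0) (e 1) d 0.
have e2 : e 2%:R = - e 0 - e 1.
  move: e0; rewrite !big_ord_recl big_ord0 addr0 addrA => /eqP.
  rewrite addrC addr_eq0 => /eqP; rewrite opprD => E.
  have <- : lift ord0 (lift ord0 ord0) = 2%:R :> 'I_3 by apply: val_inj.
  have -> : (1 : 'I_3) = lift ord0 ord0 by apply: val_inj.
  by rewrite E.
have pe (i : 'I_3) : p (g3e i) = e i.
  case: (I3E i) => ->; rewrite /p /= /p4 /= ?e2 ?mul0rz ?mulr0z ?addr0 ?add0r //.
have pd : p (0, 0, 1, 0) = d by rewrite /p /= /p4 /= !mulr0z addr0 !add0r.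
(* The dummy coordinate is sent to 0, so [p] is injective only where that coordinate vanishes. *)
pose Lz := [set x : Z4 | x.2 = 0].
have pinj x : Lz x -> p x = 0 -> x = 0.
  case: x => [[[x1 x2] x3] x4] /= x40 px.
  have /(freeP (X := [tuple e 0; e 1; d])) H := basis_free bas.
  have /H k0 : \sum_(i < 3) ((nth 0 [:: x1; x2; x3] i)%:~R : C) *: [tuple e 0; e 1;
    d]`_i = 0.
    rewrite !big_ord_recl big_ord0 addr0 !scaler_int -[RHS]px /p /= /p4 /=.
    by rewrite mul0rz addr0 !addrA.
  have := k0 (@Ordinal 3 0 isT); have := k0 (@Ordinal 3 1 isT).
  have := k0 (@Ordinal 3 2 isT).
  move=> /= /eqP + /eqP + /eqP; rewrite !intr_eq0 => /eqP + /eqP + /eqP.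
  by rewrite /Lz /= in x40; rewrite x40 => -> -> ->.
have evp : roots_of_parity io false = p @` [set x | x \in g3_even].
  rewrite evE; apply/seteqP; split=> al /=.
    case=> [[i [j [ij ->]]]|[i [a ->]]|[a ->]].
    - exists (g3e i - g3e j).
        by apply/g3_evenE/Or31; exists i, j; rewrite !ltn_ord.
      by rewrite raddfB !pe.
    - exists (g3e i *~ sgz a); last by rewrite raddfMz pe signZ.
      by apply/g3_evenE/Or32; exists i, a; rewrite ltn_ord.
    - exists ((0, 0, 1, 0) *~ 2 *~ sgz a); last first.
        by rewrite !raddfMz pd signZ -(scaler_int 2 d).
      by apply/g3_evenE/Or33; exists a; case: (a).
  move=> [x /g3_evenE xe <-].
  case: xe => [[i [j [i3 j3 ij ->]]]|[i [a [i3 ->]]]|[a ->]].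
  - apply: Or31; exists (Ordinal i3), (Ordinal j3); split=> //.
    by rewrite raddfB (pe (Ordinal i3)) (pe (Ordinal j3)).
  - by apply: Or32; exists (Ordinal i3), a; rewrite raddfMz (pe (Ordinal i3)) signZ.
  - apply: Or33; exists a; rewrite signZ.
    have -> : (0, 0, 2, 0) = (0, 0, 1, 0) *~ 2 :> Z4 by [].
    by rewrite !raddfMz pd -(scaler_int 2 d).
have odp : roots_of_parity io true = p @` [set x | x \in g3_odd].
  rewrite odE; apply/seteqP; split=> al /=.
    case=> [[i [a [b ->]]]|[a ->]].
      exists (g3e i *~ sgz a + (0, 0, 1, 0) *~ sgz b).
        by apply/g3_oddE; left; exists i, a, b; rewrite ltn_ord.
      by rewrite raddfD !raddfMz pe pd !signZ.
    exists ((0, 0, 1, 0) *~ sgz a); last by rewrite raddfMz pd signZ.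
    by apply/g3_oddE; right; exists a.
  move=> [x /g3_oddE xo <-]; case: xo => [[i [a [b [i3 ->]]]]|[a ->]].
    left; exists (Ordinal i3), a, b.
    by rewrite raddfD !raddfMz (pe (Ordinal i3)) pd !signZ.
  by right; exists a; rewrite raddfMz pd signZ.
have DE : Rt = p @` [set x | x \in g3_roots].
  apply/seteqP; split=> [al /q_rootsP [[]]|_ [x xl <-]].
  - by rewrite odp => -[x xl <-]; exists x => //=; rewrite g3_rootsE; apply/orP; left.
  - by rewrite evp => -[x xl <-]; exists x => //=; rewrite g3_rootsE; apply/orP; right.
  apply/q_rootsP; move: xl; rewrite /= g3_rootsE => /orP [xl|xl].
    by exists true; rewrite odp; exists x.
  by exists false; rewrite evp; exists x.
have LzD (x y : Z4) : Lz x -> Lz y -> Lz (x + y) by rewrite /Lz /= => -> ->.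
have LzN (x : Z4) : Lz x -> Lz (- x) by rewrite /Lz /= => ->.
have Lzr (x : Z4) : x \in g3_roots -> Lz x.
  have : all (fun x : Z4 => x.2 == 0) g3_roots by vm_compute.
  by move=> /allP H /H /eqP.
have orth (x y : Z4) : [&& x \in g3_roots, y \in g3_roots, x + y \notin g3_roots,
    x + y != 0, y - x \notin g3_roots & y - x != 0] -> form (p x) (p y) = 0.
  move=> /and5P [Dx Dy /negP n1 /eqP z1 /andP [/negP n2 /eqP z2]].
  exact: (model_orth LzD LzN Lzr pinj DE).
have iso (x : Z4) : (x \in g3_odd) && (x + x \notin g3_roots) -> form (p x) (p x) = 0.
  move=> /andP [Dx /negP n1].
  apply: (model_isotropic LzD LzN Lzr pinj DE) => //.
  - by rewrite /= g3_rootsE Dx.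
  - by rewrite odp; exists x.
apply: (model_super (fm := g3_form) (ka := 2^-1 * form (e 0) (e 0)) LzD LzN Lzr pinj DE)
  => //.
  exact: g3_supersystem.
(* Orthogonality of [e i] and [2 d] and isotropy of the three [e i + d] suffice; the relation for
   [e 2] yields the product of [e 0] and [e 1]. *)
have o13 := orth (1, 0, 0, 0) (0, 0, 2, 0) isT.
have o23 := orth (0, 1, 0, 0) (0, 0, 2, 0) isT.
have i1 := iso (1, 0, 1, 0) isT; have i2 := iso (0, 1, 1, 0) isT.
have i3 := iso (-1, -1, 1, 0) isT.
rewrite !p4_form in o13 o23 i1 i2 i3.
have c2 (t : C) : 2 * t = 0 -> t = 0.
  by move/eqP; rewrite mulf_eq0 pnatr_eq0 => /eqP.
have q13 : form (e 0) d = 0 by apply: c2; rewrite -[RHS]o13; ring.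
have q23 : form (e 1) d = 0 by apply: c2; rewrite -[RHS]o23; ring.
rewrite q13 q23 in i1 i2 i3.
have q3 : form d d = - form (e 0) (e 0).
  by apply/eqP; rewrite -addr_eq0; apply/eqP; rewrite -[RHS]i1; ring.
rewrite q3 in i1 i2 i3.
have q2 : form (e 1) (e 1) = form (e 0) (e 0).
  by apply/eqP; rewrite -subr_eq0; apply/eqP; rewrite -[RHS]i2; ring.
rewrite q2 in i3.
have q12 : form (e 0) (e 1) = - (2^-1 * form (e 0) (e 0)).
  apply/eqP; rewrite -addr_eq0; apply/eqP/c2.
  by rewrite mulrDr mulVKf ?pnatr_eq0 // -[RHS]i3; ring.
move=> [[[x1 x2] x3] x4] [[[y1 y2] y3] y4] /Lzr + /Lzr; rewrite /Lz /= => -> ->.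
rewrite [form (p _) (p _)]p4_form q12 q13 q23 q2 q3 /g3_form /=.
set k := 2^-1 * _; have -> : form (e 0) (e 0) = 2 * k by rewrite mulVKf ?pnatr_eq0.
ring.
Qed.
End G3.

(** * Weights and roots of matrix superalgebras *)

Section MatrixModel.
Variables (C : numClosedFieldType) (gd : quadLSA C) (p q : nat).
Local Notation Hs := 'Hom(q_H gd, C^o).
Local Notation io := (@q_io _ gd).
Variables (X : set 'M[C]_(p + q)) (phi : gd -> 'M[C]_(p + q)).
Hypothesis mm : matrix_model X phi.
Implicit Types (x y : gd) (a b : 'I_(p + q)).

Let phi_lin : linear phi. Proof. by case: mm => [[]]. Qed.

Lemma phiD x y : phi (x + y) = phi x + phi y.
Proof. by have := phi_lin 1 x y; rewrite !scale1r. Qed.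
Lemma phi0 : phi 0 = 0.
Proof. by apply: (addrI (phi 0)); rewrite -phiD !addr0. Qed.
Lemma phiZ c x : phi (c *: x) = c *: phi x.
Proof. by have := phi_lin c x 0; rewrite !addr0 phi0 addr0. Qed.
Lemma phi_sum n (y : 'I_n -> gd) : phi (\sum_i y i) = \sum_i phi (y i).
Proof. by apply: (big_morph phi phiD phi0). Qed.
Lemma phi_inj : injective phi. Proof. by case: mm => [[]]. Qed.
Lemma phi_neq0 x : x <> 0 -> exists a b, phi x a b <> 0.
Proof.
move=> x0; apply: contrapT => H; apply/x0/phi_inj; rewrite phi0.
apply/matrixP => a b; rewrite mxE; apply: contrapT => nz; apply: H.
by exists a, b.
Qed.
Lemma phi_surj M : X M -> exists x, phi x = M.
Proof. by have [_ <- _ _ _] := mm => -[x _ <-]; exists x. Qed.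
Lemma phi_in x : X (phi x). Proof. by have [_ <- _ _ _] := mm; exists x. Qed.
Lemma phi_diag h a b : a != b -> phi (io h) a b = 0.
Proof.
have [_ _ _ _ H] := mm; have /H /is_diag_mxP D : exists h', io h = io h' by exists h.
by move=> ab; exact: D.
Qed.
Lemma diag_io M : X M -> is_diag_mx M -> exists h, phi (io h) = M.
Proof.
move=> /phi_surj [x <-]; have [_ _ _ _ H] := mm.
by move=> /H [h ->]; exists h.
Qed.

Definition dwt a : Hs := linfun (fun h => phi (io h) a a : C^o).
Lemma dwtE a h : dwt a h = phi (io h) a a.
Proof.
pose f h : C^o := phi (io h) a a.
have lin_f : linear f by move=> c u v; rewrite /f ioD ioZ phiD phiZ !mxE.
pose F := GRing.isLinear.Build _ _ _ _ f lin_f.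
pose fL : {linear q_H gd -> C^o} := HB.pack f F.
exact: (lfunE fL h).
Qed.

Lemma phi_br h x : phi \[io h, x\] = phi (io h) *m phi x - phi x *m phi (io h).
Proof.
have [_ _ _ H _] := mm; have [x0 [x1 [p0 p1 ->]]] := part_decomp x.
rewrite brDr !phiD (H _ _ _ _ (io_even h) p0) (H _ _ _ _ (io_even h) p1) /= !scale1r.
by rewrite mulmxDr mulmxDl opprD addrACA.
Qed.

Lemma phi_br_entry h x a b : phi \[io h, x\] a b = (dwt a h - dwt b h) * phi x a b.
Proof.
rewrite phi_br !dwtE !mxE (bigD1 a) //= big1 => [|c ca]; last first.
  by rewrite phi_diag 1?eq_sym // mul0r.
rewrite (bigD1 b) //= big1 => [|c cb]; last by rewrite phi_diag // mulr0.
by rewrite !addr0 mulrBl [in X in _ - X]mulrC.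
Qed.

Lemma matrix_root_space al x : root_space io al x <->
  forall a b, phi x a b <> 0 -> al = dwt a - dwt b.
Proof.
split=> [rx a b nz|H h].
  apply/lfunP => h; rewrite add_lfunE opp_lfunE.
  apply: (mulIf (introN eqP nz)); rewrite -phi_br_entry rx.
  by rewrite phiZ mxE.
apply: phi_inj; rewrite phiZ; apply/matrixP => a b; rewrite phi_br_entry mxE.
have [->|nz] := EM (phi x a b = 0); first by rewrite !mulr0.
by rewrite (H _ _ nz) add_lfunE opp_lfunE.
Qed.

Definition mx_par a := (p <= a)%N.

Lemma mx_part_entry c (M : 'M[C]_(p + q)) a b : mx_part c M -> M a b <> 0 -> c
  = mx_par a (+) mx_par b.
Proof.
rewrite /mx_part => H; have -> : M a b = block_mx (ulsubmx M) (ursubmx M) (dlsubmx M)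
  (drsubmx M) a b.
  by rewrite submxK.
rewrite /mx_par.
case: (split_ordP a) => i ->; case: (split_ordP b) => j -> /=; rewrite ?leq_addr;
  rewrite ?(block_mxEul, block_mxEur, block_mxEdl, block_mxEdr) ?(leqNgt p) ?ltn_ord /=;
  by case: c H => // -[E1 E2]; rewrite ?E1 ?E2 mxE.
Qed.

(** No explicit root vector is needed. Among the weight components of the preimage of [M], one has a
    nonzero entry at [(a, b)]; this entry forces its weight, and then the parity of a homogeneous
    part. *)
Lemma matrix_root M a b : X M -> M a b <> 0 -> dwt a <> dwt b ->
  roots_of_parity io (mx_par a (+) mx_par b) (dwt a - dwt b).
Proof.
move=> /phi_surj [x <-] nz ab; split; first by move=> /eqP; rewrite subr_eq0 => /eqP.
have [n [y [al [ry Ex]]]] := q_diag x.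
have [i nzi] : exists i, phi (y i) a b <> 0.
  apply: contrapT => H; apply: nz; rewrite Ex phi_sum summxE big1 // => i _.
  by apply: contrapT => nz; apply: H; exists i.
have Ei : al i = dwt a - dwt b by exact: (proj1 (matrix_root_space _ _) (ry i) _ _ nzi).
have [y0 [y1 [p0 p1 E]]] := part_decomp (y i).
have R h : \[io h, y0\] = al i h *: y0 /\ \[io h, y1\] = al i h *: y1.
  apply: part_direct; try exact: partZ.
  - by have := lsa_br_part (io_even h) p0.
  - by have := lsa_br_part (io_even h) p1.
  by rewrite -scalerDr -brDr -E; exact: ry.
have [_ _ Hp _ _] := mm.
have use c z : lsa_part c z -> root_space io (al i) z -> phi z a b <> 0 ->
    exists z, [/\ z <> 0, lsa_part (mx_par a (+) mx_par b) z & root_space io (dwt a - dwt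
      b) z].
  move=> pz rz nzz; exists z; split; first by move=> z0; rewrite z0 phi0 mxE in nzz.
    by rewrite -(mx_part_entry (proj1 (Hp _ _) pz) nzz).
  by rewrite -Ei.
have [z0|z0] := EM (phi y0 a b = 0); last by apply: use p0 _ z0 => h; case: (R h).
apply: (use true y1) => // [h|z1]; first by case: (R h).
by apply: nzi; rewrite E phiD mxE z0 z1 addr0.
Qed.

Lemma matrix_root_inv al : q_roots al -> exists M a b,
  [/\ X M, M a b <> 0 & al = dwt a - dwt b].
Proof.
move=> [_ [x [x0 rx]]]; have [a [b nz]] := phi_neq0 x0.
exists (phi x), a, b; split=> //; first exact: phi_in.
exact: (proj1 (matrix_root_space _ _) rx).
Qed.

End MatrixModel.

Lemma classical_supersystem_ord N (odd : 'I_N -> bool) (zs : bool) (a b : 'I_N) :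
  a = 0%N :> nat -> b.+1 = N -> odd a -> ~~ odd b -> (zs -> (2 < N)%N) ->
  supersystem (cform odd) (croot odd zs).
Proof.
case: N odd a b => [|[|n]] odd a b a0 bN oa ob zn; first by case: (a).
  have ab : a = b by apply: val_inj; rewrite /= a0; case: bN.
  by rewrite -ab oa in ob.
apply: classical_supersystem; last by move=> /zn; rewrite !ltnS.
- by rewrite -(_ : a = ord0) //; apply: val_inj.
- by rewrite -(_ : b = ord_max) //; apply: val_inj => /=; case: bN.
Qed.

Lemma croot_disjoint N (odd : 'I_N -> bool) zs (x y : {ffun 'I_N -> int}) :
  croot odd zs x -> croot odd zs y -> (forall c, x c = 0 \/ y c = 0) ->
  ~ croot odd zs (x + y) /\ x + y <> 0.
Proof.
move=> [nx _ _] [ny _ _] xy; have E : cnorm (x + y) = 4%N.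
  transitivity (cnorm x + cnorm y)%N; last by rewrite nx ny.
  rewrite /cnorm -big_split; apply: eq_bigr => c _ /=.
  by rewrite ffunE; case: (xy c) => ->; rewrite ?addr0 ?add0r ?addn0.
split=> [[nxy _ _]|xy0]; first by rewrite E in nxy.
by move: E; rewrite xy0 /cnorm big1 // => c _; rewrite ffunE.
Qed.

Section WeightMap.
Variables (V : zmodType) (N : nat) (w : 'I_N -> V).
Definition wmap (x : {ffun 'I_N -> int}) : V := \sum_a w a *~ x a.
Lemma wmap_morph : GRing.zmod_morphism wmap.
Proof.
move=> x y; rewrite /wmap -sumrB; apply: eq_bigr => a _.
by rewrite !ffunE mulrzBr.
Qed.
HB.instance Definition _ := GRing.isZmodMorphism.Build _ _ wmap wmap_morph.
Lemma wmap_csv s a : wmap (csv s a) = if s then - w a else w a.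
Proof.
rewrite /wmap (bigD1 a) //= big1 ?addr0 => [|b /negbTE ba].
  by rewrite ffunE eqxx; case: s; rewrite ?mulrN1z.
by rewrite ffunE ba mulr0z.
Qed.
End WeightMap.

Section FourPoint.
Variables (F : numFieldType) (N : nat) (odd : 'I_N -> bool) (q : 'I_N -> 'I_N -> F).
Hypothesis qsym : forall a b, q a b = q b a.
Hypothesis q0 : forall a, q a a = 0.
Hypothesis qmix : forall a b, odd a != odd b -> q a b = 0.
Hypothesis q4 : forall a b c d, uniq [:: a; b; c; d] -> q a d + q b c = q a c + q b d.
Variables o l : 'I_N.
Hypotheses (oo : odd o) (ol : ~~ odd l) (N2 : (2 < N)%N).

(* With [q a b = (e_a - e_b, e_a - e_b)], condition [q4] says that disjoint roots
   of gl are orthogonal. *)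
Lemma four_point : exists ka, forall a b,
  q a b = ka * (csg odd a + csg odd b - csg odd a * (a == b)%:R * 2)%:~R.
Proof.
have no : o != l by apply: contraNneq ol => <-.
have [r [ro rl]] := ord_third o l N2.
have qol : q o l = 0 by apply: qmix; rewrite oo (negbTE ol).
have odd_o a : ~~ odd a -> q o a = 0 by move=> oa; apply: qmix; rewrite oo (negbTE oa).
have even_l a : odd a -> q l a = 0 by move=> oa; apply: qmix; rewrite oa (negbTE ol).
(* The difference [q o a - q l a] does not depend on [a], and by [U2] the values at [o] and [l]
   determine all others. *)
have U1 a b : a != o -> a != l -> b != o -> b != l -> a != b ->
    q o b + q l a = q o a + q l b.
  move=> ao al bo bl ab.
  by apply: q4; rewrite /= !inE !negb_or no ab !(eq_sym o) !(eq_sym l) ao al bo bl.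
have U2 a b : a != o -> a != l -> b != o -> b != l -> a != b -> q o b + q l a = q a b.
  move=> ao al bo bl ab; rewrite -[RHS]add0r -qol (qsym l); apply: q4.
  by rewrite /= !inE !negb_or no ab (eq_sym o a) (eq_sym o b) (eq_sym l b) ao bo bl al.
(* The value of [ka] is read from a third index [r]: the formula wants [q o r = - 2 ka] for odd [r]
   and [q l r = 2 ka] for even [r]. *)
pose ka := if odd r then - q o r / 2 else q l r / 2.
have two : (2 : F) != 0 by rewrite pnatr_eq0.
have Ho a : a != o -> odd a -> q o a = - (ka * 2).
  move=> ao oa; have al : a != l by apply: contraTneq oa => ->.
  have [ra|ra] := eqVneq r a; first by rewrite /ka ra oa !mulNr divfK ?opprK.
  have := U1 r a ro rl ao al ra; rewrite /ka (even_l a) // addr0.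
  case: ifPn => or; first by rewrite (even_l r) // addr0 !mulNr divfK ?opprK.
  by rewrite (odd_o r) // divfK // => /eqP; rewrite addr_eq0 => /eqP.
have He a : a != l -> ~~ odd a -> q l a = ka * 2.
  move=> al oa; have ao : a != o by apply: contraNneq oa => ->.
  have [ra|ra] := eqVneq r a; first by rewrite /ka ra (negbTE oa) divfK.
  have := U1 r a ro rl ao al ra; rewrite /ka (odd_o a) // add0r.
  case: ifPn => or; last by rewrite (odd_o r) // add0r divfK.
  by rewrite (even_l r) // !mulNr divfK // => /esym/eqP; rewrite addrC addr_eq0 => /eqP.
exists ka => a b; have [->|ab] := eqVneq a b.
  by rewrite q0 mulr1 -mulr2n mulr_natr subrr mulr0.
rewrite mulr0 mul0r subr0 /csg; case oa : (odd a); case ob : (odd b).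
- rewrite (_ : -1 + -1 = - 2) // rmorphN mulrN.
  have [a0|ao] := eqVneq a o; first by rewrite a0; apply: Ho => //; rewrite -a0 eq_sym.
  have [b0|bo] := eqVneq b o; first by rewrite b0 qsym; exact: Ho.
  have al : a != l by apply: contraTneq oa => ->.
  have bl : b != l by apply: contraTneq ob => ->.
  by rewrite -U2 // even_l // addr0; exact: Ho.
- by rewrite addNr mulr0; apply: qmix; rewrite oa ob.
- by rewrite subrr mulr0; apply: qmix; rewrite oa ob.
- rewrite (_ : 1 + 1 = 2) //.
  have [a0|al] := eqVneq a l; first by rewrite a0; apply: He; rewrite ?ob // -a0 eq_sym.
  have [b0|bl] := eqVneq b l; first by rewrite b0 qsym; apply: He; rewrite ?oa.
  have ao : a != o by apply: contraFneq oa => ->.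
  have bo : b != o by apply: contraFneq ob => ->.
  by rewrite -U2 // odd_o ?ob // add0r; apply: He; rewrite ?oa.
Qed.
End FourPoint.

(** * The general and special linear cases *)

Section GeneralLinear.
Variables (C : numClosedFieldType) (gd : quadLSA C) (p q : nat).
Local Notation io := (@q_io _ gd).
Local Notation form := (dform (@q_hform _ gd)).
Local Notation Rt := (@q_roots _ gd).
Variables (X : set 'M[C]_(p + q)) (phi : gd -> 'M[C]_(p + q)).
Hypothesis mm : matrix_model X phi.
Hypothesis HX : forall a b, a != b -> X (delta_mx a b).
Let w := dwt phi.
Hypothesis w_inj : forall x, csum x = 0 -> wmap w x = 0 -> x = 0.
Hypotheses (p0 : (0 < p)%N) (q0 : (0 < q)%N) (pq2 : (2 < p + q)%N).
(** The classical model wants an odd first and an even last index, so the upper block counts as odd;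
    the sign of the form goes into [ka]. *)
Let odd (a : 'I_(p + q)) := ~~ mx_par a.
Local Notation D := (croot odd true).

Let diff (a b : 'I_(p + q)) : {ffun 'I_(p + q) -> int} := csv false a + csv true b.

Let diff_root a b : a != b -> D (diff a b).
Proof. by move=> ab; apply: croot_pair => // E; rewrite E eqxx in ab. Qed.

Let wmap_diff a b : wmap w (diff a b) = w a - w b.
Proof. by rewrite raddfD /= !wmap_csv. Qed.

Let rootE x : D x -> exists a b, a != b /\ x = diff a b.
Proof.
move=> /croot_pairE [s [a [t [b [ab st ->]]]]]; have {}st := st isT.
have nab : a != b by apply/eqP => /ab [_ E]; rewrite E in st; case: (t) st.
rewrite st; case: (t); first by exists a, b.
by exists b, a; rewrite eq_sym addrC.
Qed.

Let w_neq a b : a != b -> w a <> w b.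
Proof.
move=> ab E; apply: (croot_neq0 (diff_root ab)); apply: w_inj.
  by have [_ _ ->] := diff_root ab.
by rewrite wmap_diff E subrr.
Qed.

Let w_root a b : a != b -> roots_of_parity io (mx_par a (+) mx_par b) (w a - w b).
Proof.
move=> ab; apply: (matrix_root mm (HX ab)); last exact: w_neq.
by rewrite mxE !eqxx; apply/eqP; rewrite oner_eq0.
Qed.

Lemma gl_supersystem : (exists2 a, Rt a & @q_sqlen _ gd a = 2) -> supersystem form Rt.
Proof.
move=> norm.
have DE : Rt = wmap w @` D.
  apply/seteqP; split=> [al Ral|_ [x /rootE [a [b [ab ->]]] <-]].
    have [M [a [b [_ _ E]]]] := matrix_root_inv mm Ral.
    exists (diff a b); last by rewrite wmap_diff.
    apply: diff_root; apply/eqP => ab; have [al0 _] := Ral.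
    by apply: al0; rewrite E ab subrr.
  rewrite wmap_diff; apply/q_rootsP; eexists; exact: w_root.
pose Lz := [set x : {ffun 'I_(p + q) -> int} | csum x = 0].
have LzD x y : Lz x -> Lz y -> Lz (x + y) by rewrite /Lz /= csumD => -> ->; rewrite addr0.
have LzN x : Lz x -> Lz (- x) by rewrite /Lz /= csumN => ->; rewrite oppr0.
have Lzr x : D x -> Lz x by case=> _ _; exact.
have pinj x : Lz x -> wmap w x = 0 -> x = 0 by exact: w_inj.
have fl := @qform_linear _ gd; have fs := @qform_sym _ gd.
have orth a b c d : uniq [:: a; b; c; d] -> form (w a - w b) (w c - w d) = 0.
  rewrite /= !inE !negb_or => /and4P [/and3P [ab ac ad] /andP [bc bd] cd _].
  have Dx := diff_root ab; have Dy := diff_root cd; have DNx := croot_opp Dx.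
  have xy e : diff a b e = 0 \/ diff c d e = 0.
    rewrite !ffunE; have [->|ea] := eqVneq e a; first by right;
      rewrite (negbTE ac) (negbTE ad).
    by have [->|eb] := eqVneq e b; [right; rewrite (negbTE bc) (negbTE bd)|left].
  have [|n1 z1] := croot_disjoint Dx Dy; first exact: xy.
  have [|n2 z2] := croot_disjoint Dy DNx.
    by move=> e; case: (xy e); [right; rewrite ffunE; apply/eqP; rewrite oppr_eq0;
      apply/eqP|left].
  by rewrite -!wmap_diff; apply: (model_orth LzD LzN Lzr pinj DE).
(* Roots control only differences of weights, so the form is recovered from square lengths by
   polarisation. *)
pose Q a b := form (w a - w b) (w a - w b).
have polar a b c d : 2 * form (w a - w b) (w c - w d) = Q a d + Q b c - Q a c - Q b d.
  have ex u v x y : form (u - v) (x - y) = form u x - form u y - (form v x - form v y).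
    by rewrite (fDl fl) (fNl fl) !(fDr fl fs) !(fNr fl fs).
  rewrite /Q !ex.
  rewrite (fs (w c) (w a)) (fs (w c) (w b)) (fs (w d) (w a)) (fs (w d) (w b)).
  by ring.
have [ka Hka] : exists ka, forall a b,
    Q a b = ka * (csg odd a + csg odd b - csg odd a * (a == b)%:R * 2)%:~R.
  have lp : (p + q).-1.+1 = (p + q)%N by lia.
  have e0 : (0 < p + q)%N by lia.
  have el : ((p + q).-1 < p + q)%N by lia.
  apply: (@four_point _ _ _ _ _ _ _ _ (Ordinal e0) (Ordinal el)) => //.
  - by move=> a b; rewrite /Q -opprB (fNl fl) (fNr fl fs) opprK.
  - by move=> a; rewrite /Q subrr (f0l fl).
  - move=> a b oab; rewrite /Q -wmap_diff.
    have ab : a != b by apply: contraNneq oab => ->.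
    have Dab := diff_root ab.
    apply: (model_isotropic LzD LzN Lzr pinj DE Dab).
      have := w_root ab; rewrite -wmap_diff.
      by move: oab; rewrite /odd; case: (mx_par a); case: (mx_par b).
    by rewrite -mulr2n => /(croot_mul (n := 2) isT Dab).
  - move=> a b c d U; apply/eqP; rewrite -subr_eq0 opprD addrA.
    by rewrite -polar orth ?mulr0.
  - by rewrite /odd /mx_par /= -ltnNge.
  - by rewrite /odd /mx_par negbK /=; lia.
apply: (model_super LzD LzN Lzr pinj DE (ka := ka)) norm.
  have e0 : (0 < p + q)%N by lia.
  have el : ((p + q).-1 < p + q)%N by lia.
  apply: (@classical_supersystem_ord _ odd true (Ordinal e0) (Ordinal el)) => //=.
  - lia.
  - by rewrite /odd /mx_par /= -ltnNge.
  - by rewrite /odd /mx_par negbK /=; lia.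
move=> x y /rootE [a [b [ab ->]]] /rootE [c [d [cd ->]]].
have two : (2 : C) != 0 by rewrite pnatr_eq0.
apply: (mulfI two).
rewrite (_ : form _ _ = form (w a - w b) (w c - w d)); last by rewrite -!wmap_diff.
rewrite polar !Hka cformDr !cform_csv /diff !ffunE !(eq_sym _ a) !(eq_sym _ b).
have e (u v : 'I_(p + q)) : csg odd u * (u == v)%:R = csg odd v * (u == v)%:R
  by case: eqP => [->|_] //; rewrite !mulr0.
rewrite (e a d) (e b c) (e a c) (e b d).
by do 4 case: (_ == _); rewrite /=; ring.
Qed.

End GeneralLinear.

(** * The orthosymplectic case *)

Section OspMatrices.
Variables (C : numClosedFieldType) (m n : nat).
Local Notation J := (@osp_sym C m).
Local Notation K := (@osp_skew C n).
Local Notation X := (@osp_set C m n).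

Lemma osp_sym_tr : J^T = J.
Proof. by rewrite /osp_sym tr_block_mx !trmx0 !trmx1. Qed.
Lemma osp_sym_sq : J *m J = 1%:M.
Proof.
by rewrite /osp_sym mulmx_block !mul0mx !mul1mx !add0r !addr0 -scalar_mx_block.
Qed.
Lemma osp_skew_tr : K^T = - K.
Proof. by rewrite /osp_skew tr_block_mx !trmx0 linearN /= !trmx1 opp_block_mx !oppr0
  opprK. Qed.
Lemma osp_skew_sq : K *m K = - 1%:M.
Proof.
rewrite /osp_skew mulmx_block !mul0mx !mulmx0 !mul1mx !add0r !addr0 mulmx1.
by rewrite scalar_mx_block opp_block_mx !oppr0.
Qed.

Lemma osp_even A D : A^T *m J + J *m A = 0 -> D^T *m K + K *m D = 0 ->
  X (block_mx A 0 0 D).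
Proof.
by move=> HA HD; split; rewrite ?block_mxKul ?block_mxKdr ?block_mxKur ?block_mxKdl //
  trmx0 mul0mx mulmx0.
Qed.

Lemma osp_odd (B : 'M[C]_(m + m, n + n)) : X (block_mx 0 B (- (K *m B^T *m J)) 0).
Proof.
split; rewrite ?block_mxKul ?block_mxKdr ?block_mxKur ?block_mxKdl;
  rewrite ?trmx0 ?mul0mx ?mulmx0 ?addr0 //.
by rewrite mulmxN !mulmxA osp_skew_sq !mulNmx opprK mul1mx.
Qed.

(* [A - J A^T J], and [A + K A^T K] in the symplectic case, is twice the
   projection of [A] to the even part. *)
Lemma osp_sym_proj A : (A - J *m A^T *m J)^T *m J + J *m (A - J *m A^T *m J) = 0.
Proof.
rewrite linearB /= !trmx_mul trmxK osp_sym_tr mulmxBl mulmxBr.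
rewrite -!mulmxA osp_sym_sq mulmx1 !mulmxA osp_sym_sq mul1mx.
by rewrite addrA subrK subrr.
Qed.
Lemma osp_skew_proj A : (A + K *m A^T *m K)^T *m K + K *m (A + K *m A^T *m K) = 0.
Proof.
rewrite linearD /=; have -> : (K *m A^T *m K)^T = K *m A *m K.
  by rewrite !trmx_mul trmxK osp_skew_tr !(mulNmx, mulmxN) opprK mulmxA.
have e1 : K *m A *m K *m K = - (K *m A) by rewrite -mulmxA osp_skew_sq mulmxN mulmx1.
have e2 : K *m (K *m A^T *m K) = - (A^T *m K).
  by rewrite !mulmxA osp_skew_sq !mulNmx mul1mx.
by rewrite mulmxDl mulmxDr e1 e2 -[K *m A - _]opprB subrr.
Qed.

(** It computes the [(i, j)] entry of the projections of [delta_mx i j]: 1 minus a square of an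
    entry of [J], or 1 plus a square of an entry of [K]. The first vanishes only for a pair of
    opposite weights. *)
Lemma mx_delta_entry k (P Q : 'M[C]_k) i j :
  (P *m (delta_mx i j)^T *m Q) i j = P i j * Q i j.
Proof.
rewrite trmx_delta -(mul_delta_mx (0 : 'I_1)) mulmxA -mulmxA -rowE -colE.
by rewrite mxE big_ord1 !mxE.
Qed.

Lemma osp_ul (A : 'M[C]_(m + m)) : A^T *m J + J *m A = 0 ->
  (forall i, A (lshift m i) (rshift m i) = 0 /\ A (rshift m i) (lshift m i) = 0) /\
  (forall i, A (rshift m i) (rshift m i) = - A (lshift m i) (lshift m i)).
Proof.
rewrite -[A]submxK; set A1 := ulsubmx A; set A2 := ursubmx A; set A3 := dlsubmx A.
set A4 := drsubmx A.
rewrite /osp_sym tr_block_mx !mulmx_block !mul0mx !mulmx0 !mul1mx !mulmx1 !add0r !addr0.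
rewrite add_block_mx -block_mx0 => /eq_block_mx [E1 E2 E3 E4].
have two : (2 : C) != 0 by rewrite pnatr_eq0.
split=> i; last first.
  rewrite block_mxEdr block_mxEul; apply/eqP; rewrite -addr_eq0 addrC.
  by move/matrixP/(_ i i): E2; rewrite !mxE => ->.
rewrite block_mxEur block_mxEdl; split.
  move/matrixP/(_ i i): E4; rewrite !mxE -mulr2n -mulr_natl => /eqP.
  by rewrite mulf_eq0 (negbTE two) => /eqP.
move/matrixP/(_ i i): E1; rewrite !mxE -mulr2n -mulr_natl => /eqP.
by rewrite mulf_eq0 (negbTE two) => /eqP.
Qed.

Lemma osp_dr (A : 'M[C]_(n + n)) : A^T *m K + K *m A = 0 ->
  forall i, A (rshift n i) (rshift n i) = - A (lshift n i) (lshift n i).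
Proof.
rewrite -[A]submxK; set A1 := ulsubmx A; set A2 := ursubmx A; set A3 := dlsubmx A.
set A4 := drsubmx A.
rewrite /osp_skew tr_block_mx !mulmx_block !mul0mx !mulmx0 !mul1mx !mulmx1 !add0r !addr0.
rewrite add_block_mx -block_mx0 => /eq_block_mx [E1 E2 E3 E4] i.
rewrite block_mxEdr block_mxEul; apply/eqP; rewrite -addr_eq0 addrC.
by move/matrixP/(_ i i): E2; rewrite !mxE => ->.
Qed.

(* The rows are indexed by a sign and a weight; the weights of the symplectic
   part come first. *)
Definition osp_pos (s : bool) (k : 'I_(n + m)) : 'I_((m + m) + (n + n)) :=
  match fintype.split k with
  | inl j => rshift (m + m) (if s then rshift n j else lshift n j)
  | inr i => lshift (n + n) (if s then rshift m i else lshift m i)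
  end.

Lemma osp_posl s j : osp_pos s (lshift m j) =
  rshift (m + m) (if s then rshift n j else lshift n j).
Proof. by rewrite /osp_pos (unsplitK (inl _ j)). Qed.
Lemma osp_posr s i : osp_pos s (rshift n i) =
  lshift (n + n) (if s then rshift m i else lshift m i).
Proof. by rewrite /osp_pos (unsplitK (inr _ i)). Qed.

Lemma osp_posP a : exists s k, a = osp_pos s k.
Proof.
case: (split_ordP a) => b ->; case: (split_ordP b) => i ->.
- by exists false, (rshift n i); rewrite osp_posr.
- by exists true, (rshift n i); rewrite osp_posr.
- by exists false, (lshift m i); rewrite osp_posl.
- by exists true, (lshift m i); rewrite osp_posl.
Qed.

Definition osp_odd_index (k : 'I_(n + m)) := (k < n)%N.

Lemma osp_par s k : mx_par (osp_pos s k) = osp_odd_index k.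
Proof.
rewrite /mx_par /osp_odd_index; case: (split_ordP k) => i ->.
  by rewrite osp_posl leq_addr.
by rewrite osp_posr /= leqNgt ltn_ord.
Qed.

(** The first hypothesis leaves out the entries that vanish by [osp_ul], the second one the lower
    left block, which the upper right block determines. *)
Lemma osp_entry s k t l : (k = l -> osp_odd_index k \/ s = t) ->
  ~~ osp_odd_index k \/ osp_odd_index l ->
  exists M, X M /\ M (osp_pos s k) (osp_pos t l) <> 0.
Proof.
have two : (2 : C) <> 0 by apply/eqP; rewrite pnatr_eq0.
have one : (1 : C) <> 0 by apply/eqP; rewrite oner_eq0.
rewrite /osp_odd_index; case: (split_ordP k) => i ->; case: (split_ordP l) => j -> /=;
  rewrite ?ltn_ord ?ltnNge ?leq_addr /= => kl par.
- set i' := if s then rshift n i else lshift n i.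
  set j' := if t then rshift n j else lshift n j.
  exists (block_mx 0 0 0 (delta_mx i' j' + K *m (delta_mx i' j')^T *m K)); split.
    by apply: osp_even; [rewrite trmx0 mul0mx mulmx0 addr0|exact: osp_skew_proj].
  rewrite !osp_posl block_mxEdr mxE mx_delta_entry mxE !eqxx /osp_skew /i' /j'.
  case: (s); case: (t); rewrite ?(block_mxEul, block_mxEur, block_mxEdl, block_mxEdr) !mxE;
    try case: eqP => _; rewrite ?mulr0n ?mulr1n ?oppr0 ?mulrNN ?mulr0 ?mulr1 ?addr0 //.
- by case: par.
- exists (block_mx 0 (delta_mx (if s then rshift m i else lshift m i)
    (if t then rshift n j else lshift n j)) (- (K *m (delta_mx (if s then rshift m i else
      lshift m i)
    (if t then rshift n j else lshift n j))^T *m J)) 0); split; first exact: osp_odd.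
  by rewrite osp_posl osp_posr block_mxEur mxE !eqxx.
- set i' := if s then rshift m i else lshift m i.
  set j' := if t then rshift m j else lshift m j.
  exists (block_mx (delta_mx i' j' - J *m (delta_mx i' j')^T *m J) 0 0 0); split.
    by apply: osp_even; [exact: osp_sym_proj|rewrite trmx0 mul0mx mulmx0 addr0].
  rewrite !osp_posr block_mxEul [X in X <> 0]mxE [X in _ + X <> 0]mxE mx_delta_entry mxE
    !eqxx /osp_sym /i' /j'.
  have ij : s != t -> (i == j) = false.
    move=> st; apply/eqP => ij; rewrite ij in kl; case: (kl erefl) => // e.
    by rewrite e eqxx in st.
  move: ij; case: (s); case: (t) => ij;
    rewrite ?(block_mxEul, block_mxEur, block_mxEdl, block_mxEdr) !mxE ?ij //
      ?mulr0 ?subr0 //.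
Qed.

Lemma osp_diag (c : 'I_(n + m) -> C) : exists M, [/\ X M, is_diag_mx M &
  forall k, M (osp_pos false k) (osp_pos false k) = c k].
Proof.
pose c1 := diag_mx (\row_j c (lshift m j)); pose c2 := diag_mx (\row_i c (rshift n i)).
exists (block_mx (block_mx c2 0 0 (- c2)) 0 0 (block_mx c1 0 0 (- c1))); split.
- have tr k (v : 'rV[C]_k) : (diag_mx v)^T = diag_mx v by exact: tr_diag_mx.
  apply: osp_even; rewrite /osp_sym /osp_skew tr_block_mx linearN /= !trmx0 tr;
  rewrite !mulmx_block !(mul0mx, mulmx0, mul1mx, mulmx1, mulNmx, mulmxN) !(add0r, addr0);
  by rewrite add_block_mx !(addr0, oppr0, opprK, addNr, subrr) block_mx0.
- rewrite !is_diag_block_mx // !eqxx /= !diag_mx_is_diag /=.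
  have dN k (v : 'rV[C]_k) : is_diag_mx (- diag_mx v).
    by apply/is_diag_mxP => i j ij; rewrite !mxE -(inj_eq val_inj) (negbTE ij) oppr0.
  by rewrite !dN.
- move=> k; case: (split_ordP k) => i ->; rewrite ?osp_posl ?osp_posr.
    by rewrite block_mxEdr block_mxEul !mxE eqxx mulr1n.
  by rewrite !block_mxEul !mxE eqxx mulr1n.
Qed.

End OspMatrices.

Lemma ord_fourth N (a b c : 'I_N) : (3 < N)%N -> exists r, [/\ r != a, r != b & r != c].
Proof.
move=> n3; apply: contrapT => H.
have : (size (enum 'I_N) <= size [:: a; b; c])%N.
  apply: uniq_leq_size (enum_uniq _) _ => r _; rewrite !inE.
  apply: contrapT => /negP; rewrite !negb_or => /and3P [ra rb rc].
  by apply: H; exists r.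
by rewrite size_enum_ord /= leqNgt n3.
Qed.

Section Orthosymplectic.
Variables (C : numClosedFieldType) (gd : quadLSA C) (m n : nat).
Local Notation Hs := 'Hom(q_H gd, C^o).
Local Notation io := (@q_io _ gd).
Local Notation form := (dform (@q_hform _ gd)).
Local Notation Rt := (@q_roots _ gd).
Variable phi : gd -> 'M[C]_((m + m) + (n + n)).
Hypothesis mm : matrix_model (osp_set (m := m) (n := n)) phi.
Hypotheses (m0 : (0 < m)%N) (n0 : (0 < n)%N) (mn : (m, n) <> (2, 1)%N).
Let odd := @osp_odd_index m n.
Let w k := dwt phi (osp_pos false k).
Local Notation D := (croot odd false).

Let w_neg k : dwt phi (osp_pos true k) = - w k.
Proof.
apply/lfunP => h; rewrite opp_lfunE !(dwtE mm).
have [Hul Hdr _] := phi_in mm (io h); case: (split_ordP k) => i ->.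
  by rewrite !osp_posl; have := osp_dr Hdr i; rewrite !mxE.
by rewrite !osp_posr; have [_ /(_ i)] := osp_ul Hul; rewrite !mxE.
Qed.

Let dwt_pos s k : dwt phi (osp_pos s k) = wmap w (csv s k).
Proof. by rewrite wmap_csv; case: s; rewrite ?w_neg. Qed.

Let dwt_diff s k t l : dwt phi (osp_pos s k) - dwt phi (osp_pos t l) =
  wmap w (csv s k + csv (~~ t) l).
Proof. by rewrite !dwt_pos -csvN raddfB. Qed.

Let w_inj x : wmap w x = 0 -> x = 0.
Proof.
move=> x0; apply/ffunP => k; rewrite ffunE; apply/eqP; rewrite -(intr_eq0 C).
have [M [XM dM HM]] := osp_diag (fun l => (l == k)%:R : C).
have [h Eh] := diag_io mm XM dM.
have := congr1 (fun f : Hs => f h) x0; rewrite /wmap sum_lfunE lfunE /= => <-.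
rewrite (bigD1 k) //= big1 ?addr0 => [|l /negbTE lk].
  by rewrite -scaler_int scale_lfunE (dwtE mm) Eh HM eqxx /GRing.scale /= mulr1.
by rewrite -scaler_int scale_lfunE (dwtE mm) Eh HM lk scaler0.
Qed.

Let pair_root s k t l : (k = l -> odd k /\ s = t) ->
  roots_of_parity io (odd k (+) odd l) (wmap w (csv s k + csv t l)).
Proof.
(* The weight is symmetric in its two terms, so the lower left block can be avoided. *)
wlog kl : s k t l / ~~ odd k || odd l.
  move=> H E; case: (boolP (~~ odd k || odd l)) => [/H|]; first exact.
  rewrite negb_or negbK => /andP [ok ol]; rewrite addrC addbC; apply: H => [|e].
    by rewrite ol.
  by rewrite e ok in ol.
move=> E; have [M [XM nz]] : exists M, osp_set M
  /\ M (osp_pos s k) (osp_pos (~~ t) l) <> 0 :> C.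
  by apply: osp_entry (orP kl) => /E [ok _]; left.
have := matrix_root mm XM nz; rewrite !osp_par dwt_diff negbK; apply=> /eqP.
rewrite -subr_eq0 dwt_diff negbK => /eqP /w_inj.
by apply/(@croot_neq0 _ odd false)/croot_pair.
Qed.

Lemma osp_supersystem : (exists2 a, Rt a & @q_sqlen _ gd a = 2) -> supersystem form Rt.
Proof.
move=> norm; have two : (2 : C) != 0 by rewrite pnatr_eq0.
have DE : Rt = wmap w @` D.
  apply/seteqP; split=> [al Ral|_ [x Dx <-]]; last first.
    have [s [k [t [l [kl _ ->]]]]] := croot_pairE Dx.
    by apply/q_rootsP; eexists; exact: pair_root.
  have [M [a [b [XM nz E]]]] := matrix_root_inv mm Ral; have [al0 _] := Ral.
  move: nz E; have [s [k ->]] := osp_posP a; have [t [l ->]] := osp_posP b.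
  rewrite dwt_diff => nz E; exists (csv s k + csv (~~ t) l) => //.
  apply: croot_pair => // kl; subst l; have st : s = ~~ t.
    apply: contrapT => st; apply: al0; rewrite E; have -> : s = t by case: (s) st;
      case: (t).
    by rewrite -csvN subrr raddf0.
  split=> //; apply: contraT => ok; case: nz; move: ok; rewrite st.
  have [Hul _ _] := XM; rewrite /odd /osp_odd_index.
  case: (split_ordP k) => i -> // _.
  have [/(_ i) [e1 e2] _] := osp_ul Hul.
  by rewrite !osp_posr !mxE in e1 e2 *; case: (t).
have LD (x y : {ffun 'I_(n + m) -> int}) : setT x -> setT y -> setT (x + y) by [].
have LN (x : {ffun 'I_(n + m) -> int}) : setT x -> setT (- x) by [].
have Lr x : D x -> setT x by [].
have pinj x : setT x -> wmap w x = 0 -> x = 0 by move=> _; exact: w_inj.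
have fl := @qform_linear _ gd; have fs := @qform_sym _ gd.
have pr s k t l : (k = l -> odd k /\ s = t) -> D (csv s k + csv t l).
  by move=> H; exact: croot_pair.
have pm s k : wmap w (csv s k) = w k *~ (if s then -1 else 1).
  by rewrite wmap_csv; case: s; rewrite ?mulrN1z.
have orth x y : D x -> D y -> (forall c, x c = 0 \/ y c = 0) ->
    form (wmap w x) (wmap w y) = 0.
  move=> Dx Dy xy; have [n1 z1] := croot_disjoint Dx Dy xy.
  have [|n2 z2] := croot_disjoint Dy (croot_opp Dx).
    by move=> c; case: (xy c) => e; [right; rewrite ffunE e oppr0|left].
  exact: (model_orth LD LN Lr pinj DE).
have mixed k l : odd k -> ~~ odd l -> form (w k) (w l) = 0 /\ form (w l) (w l)
  = - form (w k) (w k).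
  move=> ok ol; have kl : k <> l by move=> e; rewrite e (negbTE ol) in ok.
  (* Both signs give isotropic roots; comparing the two equations gives orthogonality and opposite
     squares. *)
  have iso t : form (w k + w l *~ (if t then -1 else 1)) (w k + w l *~ (if t then -1 else
    1)) = 0.
    have Dkl := pr false k t l (fun e => False_ind _ (kl e)).
    have := model_isotropic LD LN Lr pinj DE Dkl; rewrite raddfD /= !pm mulr1z; apply.
      have := @pair_root false k t l (fun e => False_ind _ (kl e)).
      by rewrite ok (negbTE ol) raddfD /= !pm mulr1z.
    by rewrite -mulr2n => /(croot_mul (n := 2) isT Dkl).
  have := iso true; have := iso false; rewrite mulr1z mulrN1z !(fE fl fs) (fs (w l) (w
    k)) => i1 i2.
  have four : (4 : C) != 0 by rewrite pnatr_eq0.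
  have kl0 : form (w k) (w l) = 0.
    by apply: (mulfI four); rewrite mulr0 -[RHS]subr0 -{2}i2 -i1; ring.
  split=> //; apply/eqP; rewrite -addr_eq0; apply/eqP; rewrite -[RHS]i1 kl0; ring.
have lm : (m.-1 < m)%N by rewrite ltn_predL.
pose o : 'I_(n + m) := lshift m (Ordinal n0); pose l : 'I_(n + m) := rshift n (Ordinal lm).
have oo : odd o by rewrite /odd /osp_odd_index /=.
have ol : ~~ odd l by rewrite /odd /osp_odd_index /= -leqNgt leq_addr.
have off k j : k != j -> form (w k) (w j) = 0.
  move=> kj; case ok : (odd k); case oj : (odd j).
  - have := orth _ _ (pr false k false k (fun=> conj ok erefl)) (pr false j false j
    (fun=> conj oj erefl)).
    rewrite !raddfD /= !pm !mulr1z !(fE fl fs) => H.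
    have four : (4 : C) != 0 by rewrite pnatr_eq0.
    apply: (mulfI four); rewrite mulr0 -[RHS]H; first ring.
    move=> c; rewrite !ffunE; have [->|ck] := eqVneq c k; last by left.
    by right; rewrite (negbTE kj).
  - by have [] := mixed k j ok (negbT oj).
  - by rewrite fs; have [] := mixed j k oj (negbT ok).
  (* This is where [D(2|1)] is excluded. *)
  have N3 : (3 < n + m)%N.
    have kj' : (k : nat) <> j by move=> e; move/eqP: kj; apply; exact: val_inj.
    move: (ltn_ord k) (ltn_ord j) kj' ok oj; rewrite /odd /osp_odd_index.
    move: (k : nat) (j : nat) => a b; move: mn m0 n0; clear; move: m n => m' n' mn m0 n0.
    move=> ? ? ? ? ?; rewrite ltnNge; apply/negP => N3; apply: mn.
    have -> : m' = 2%N by lia.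
    by have -> : n' = 1%N by lia.
  (* Doubles of even weights are not roots, so four distinct indices are needed: [w k + w r] and
     [w k - w r] are both orthogonal to [w j + w o], and adding the two equations removes [w r]. *)
  have [r [rk rj ro]] := ord_fourth k j o N3.
  have jo : j != o by apply: contraFneq oj => ->.
  have ko : k != o by apply: contraFneq ok => ->.
  have H s : form (w k + w r *~ (if s then -1 else 1)) (w j + w o) = 0.
    have := orth (csv false k + csv s r) (csv false j + csv false o).
    rewrite !raddfD /= !pm !mulr1z; apply.
    - by apply: pr => e; rewrite e eqxx in rk.
    - by apply: pr => e; rewrite e eqxx in jo.
    move=> c; rewrite !ffunE; have [->|ck] := eqVneq c k.
      by right; rewrite (negbTE kj) (negbTE ko).
    have [->|cr] := eqVneq c r; last by left.
    by right; rewrite (negbTE rj) (negbTE ro).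
  have := H true; have := H false; rewrite mulr1z mulrN1z !(fE fl fs).
  have [-> _] : form (w k) (w o) = 0 /\ True.
    by split=> //; rewrite fs; have [] := mixed o k oo (negbT ok).
  move=> h1 h2; have h := f_equal2 (@GRing.add C) h1 h2; rewrite [in RHS]addr0 in h.
  by apply: (mulfI two); rewrite mulr0 -[RHS]h; ring.
have sq k : form (w k) (w k) = form (w l) (w l) * (csg odd k)%:~R.
  have [_ e1] := mixed o l oo ol; rewrite /csg; case ok : (odd k).
    by have [_ ->] := mixed k l ok ol; rewrite rmorphN1 mulrN1 opprK.
  by have [_ ->] := mixed o k oo (negbT ok); rewrite e1 mulr1.
apply: (model_super (fm := cform odd) LD LN Lr pinj DE (ka := form (w l) (w l))) norm.
  apply: (@classical_supersystem_ord _ odd false o l) => //=.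
  by rewrite -addnS prednK.
move=> x y _ _; rewrite /= /wmap.
have suml (F : 'I_(n + m) -> Hs) u : form (\sum_a F a) u = \sum_a form (F a) u.
  by apply: (big_morph (form^~ u)) => [? ?|]; rewrite ?(fDl fl) ?(f0l fl).
rewrite suml /cform rmorph_sum mulr_sumr; apply: eq_bigr => a _.
rewrite fs suml (bigD1 a) //= big1 ?addr0 => [|b ba].
  rewrite -!scaler_int (fZl fl) (fZr fl fs) sq !rmorphM /=; ring.
by rewrite -!scaler_int (fZl fl) (fZr fl fs) off // !mulr0.
Qed.
End Orthosymplectic.

(** * Loop data, and injectivity of the weight map *)

Section LoopData.
Variables (C : numClosedFieldType) (gd : quadLSA C).

Lemma trivial_loop_data : loop_data (@setT gd) [set 0].
Proof.
split=> //.
- by move=> u ->; exists 0; rewrite io0.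
- by move=> c u ->; rewrite /= scaler0.
Qed.

Section Supertrace.
Variables p q : nat.
Implicit Types (M : 'M[C]_(p + q)) (a b : 'I_(p + q)).

Definition ssign a : int := if mx_par a then -1 else 1.

Lemma straceE M : strace M = \sum_a (ssign a)%:~R * M a a.
Proof.
rewrite /strace /mxtrace big_split_ord /= -sumrN; congr (_ + _); apply: eq_bigr => i _.
  by rewrite !mxE /ssign /mx_par /= leqNgt ltn_ord mul1r.
by rewrite !mxE /ssign /mx_par /= leq_addr mulN1r.
Qed.

Lemma strace_zero_diag M : (forall a, M a a = 0) -> strace M = 0.
Proof. by move=> H; rewrite straceE big1 // => a _; rewrite H mulr0. Qed.

Lemma ssign_sq a : ssign a * ssign a = 1.
Proof. by rewrite /ssign; case: ifP. Qed.

Lemma sum_ssign : \sum_a ssign a = p%:Z - q%:Z.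
Proof.
rewrite big_split_ord /=; congr (_ + _).
  rewrite (eq_bigr (fun=> 1)) => [|i _]; first by rewrite sumr_const card_ord natz.
  by rewrite /ssign /mx_par /= leqNgt ltn_ord.
rewrite (eq_bigr (fun=> -1)) => [|i _]; first by rewrite sumr_const card_ord mulNrn natz.
by rewrite /ssign /mx_par /= leq_addr.
Qed.

Variables (X : set 'M[C]_(p + q)) (phi : gd -> 'M[C]_(p + q)).
Hypothesis mm : matrix_model X phi.

(** A linear relation between weights is tested on the diagonal matrices of the algebra. *)
Lemma wmap_dwt_diag (v : 'rV[C]_(p + q)) x : X (diag_mx v) -> wmap (dwt phi) x = 0 ->
  \sum_a (x a)%:~R * v 0 a = 0.
Proof.
move=> Xv x0; have [h Eh] := diag_io mm Xv (diag_mx_is_diag v).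
have := congr1 (fun f : 'Hom(q_H gd, C^o) => f h) x0.
rewrite /wmap sum_lfunE lfunE /= => E; rewrite -[RHS]E; apply: eq_bigr => a _.
by rewrite -scaler_int scale_lfunE (dwtE mm) Eh mxE eqxx mulr1n.
Qed.

Lemma sl_loop_data : loop_data [set x | sl_set (phi x)] [set x | is_scalar_mx (phi x)].
Proof.
split.
- split=> [|c u v]; rewrite /= /sl_set /= !straceE.
    by rewrite big1 // => a _; rewrite (phi0 mm) mxE mulr0.
  set su := \sum_a _ => Hu; set sv := \sum_a _ => Hv.
  transitivity (c * su + sv); last by rewrite Hu Hv mulr0 addr0.
  rewrite mulr_sumr -big_split.
  by apply: eq_bigr => a _ /=; rewrite (phiD mm) (phiZ mm) !mxE; ring.
- move=> h x _; apply: strace_zero_diag => a.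
  by rewrite (phi_br_entry mm) subrr mul0r.
- move=> al x al0 rx; apply: strace_zero_diag => a; apply: contrapT => nz.
  by apply: al0; rewrite ((matrix_root_space mm al x).1 rx a a nz) subrr.
- move=> u /is_scalar_mxP [c E]; have [_ _ _ _ H] := mm; apply/H.
  by rewrite E scalar_mx_is_diag.
- move=> c u /is_scalar_mxP [d E]; apply/is_scalar_mxP; exists (c * d).
  by rewrite (phiZ mm) E scale_scalar_mx.
Qed.

End Supertrace.
End LoopData.

Section Types.
Variables (C : numClosedFieldType) (gd : quadLSA C).
Local Notation form := (dform (@q_hform _ gd)).
Local Notation Rt := (@q_roots _ gd).

Lemma gl_equal_supersystem n (phi : gd -> 'M[C]_(n.+1 + n.+1)) : (0 < n)%N ->
  matrix_model setT phi -> (exists2 a, Rt a & @q_sqlen _ gd a = 2) ->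
  supersystem form Rt.
Proof.
move=> n0 mm; apply: (gl_supersystem mm) => //; last by lia.
move=> x _ x0; apply/ffunP => a; rewrite ffunE; apply/eqP; rewrite -(intr_eq0 C).
have := wmap_dwt_diag mm (v := delta_mx 0 a) I x0.
rewrite (bigD1 a) //= big1 => [|b /negbTE ba]; last by rewrite mxE ba mulr0.
by rewrite mxE !eqxx mulr1 addr0 => ->.
Qed.

Lemma sl_supersystem m n (phi : gd -> 'M[C]_(m.+1 + n.+1)) : (n < m)%N ->
  matrix_model (sl_set (p := m.+1) (q := n.+1)) phi ->
  (exists2 a, Rt a & @q_sqlen _ gd a = 2) -> supersystem form Rt.
Proof.
move=> nm mm; apply: (gl_supersystem mm) => //; last by lia.
  move=> a b ab; apply: strace_zero_diag => c; rewrite mxE.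
  by have [->|] := eqVneq c a; rewrite ?(negbTE ab).
move=> x sx x0; pose s (a : 'I_(m.+1 + n.+1)) : C := (ssign a)%:~R.
(* Evaluating at a diagonal matrix of supertrace zero supported on [a] and [b] shows that [x] is
   proportional to the signs. *)
have xs a b : x a * ssign b = x b * ssign a.
  have [->//|ab] := eqVneq a b.
  pose v : 'rV[C]_(m.+1 + n.+1) := s b *: delta_mx 0 a - s a *: delta_mx 0 b.
  have Xv : sl_set (diag_mx v).
    rewrite /sl_set /= straceE (bigD1 a) //= (bigD1 b) 1?eq_sym //= big1 => [|c /andP
      [/negbTE ca /negbTE cb]].
      rewrite !mxE !eqxx (negbTE ab) (eq_sym b) (negbTE ab) /= /s; ring.
    by rewrite !mxE ca cb !mulr0 subrr mul0rn mulr0.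
  have := wmap_dwt_diag mm Xv x0.
  rewrite (bigD1 a) //= (bigD1 b) 1?eq_sym //= big1 => [|c /andP [/negbTE ca /negbTE
    cb]]; last first.
    by rewrite !mxE ca cb !mulr0 subrr mulr0.
  rewrite !mxE !eqxx (negbTE ab) (eq_sym b) (negbTE ab) /= /s => E.
  apply/eqP; rewrite -subr_eq0 -(intr_eq0 C) -[X in _ == X]E rmorphB !rmorphM /=;
    apply/eqP; ring.
pose o : 'I_(m.+1 + n.+1) := lshift n.+1 ord0.
have xE a : x a = x o * ssign o * ssign a
  by rewrite -mulrA (mulrC (ssign o)) mulrA xs -mulrA ssign_sq mulr1.
(* The signs add up to [m - n], which is not 0, so a multiple of the sign vector with coordinate sum
   0 vanishes. *)
have la : x o * ssign o = 0.
  move: sx; rewrite /csum; under eq_bigr do rewrite xE.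
  rewrite -mulr_sumr sum_ssign => /eqP; rewrite mulf_eq0 => /orP [/eqP //|].
  by lia.
by apply/ffunP => a; rewrite xE la mul0r ffunE.
Qed.

Lemma nontwisted_supersystem (D N : set gd) : nontwisted D N ->
  loop_data D N /\ supersystem form Rt.
Proof.
case=> [m n phi nm mm|n phi c n0 mm _|m n phi m0 n0 mn mm|F|G] [_ nrm _]; split;
  try exact: trivial_loop_data.
- exact: sl_supersystem nm mm nrm.
- exact: sl_loop_data mm.
- exact: gl_equal_supersystem n0 mm nrm.
- exact: (osp_supersystem mm).
- exact: F4_supersystem.
- exact: G3_supersystem.
Qed.

Lemma nontwisted_long (D N : set gd) : nontwisted D N ->
  exists2 a, Rt a & @q_sqlen _ gd a = 2.
Proof. by case=> [m n phi nm mm|n phi c n0 mm _|m n phi m0 n0 mn mm|F|G] []. Qed.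

End Types.


Theorem corollary6p4p4 (R : realType) (gd : quadLSA R[i]) (D N : set gd)
    (g : lieSuperalgebra R[i]) (af : affinisation D N g)
    (Sdot : set 'Hom(q_H gd, R[i]^o)) (S : set 'Hom(aff_H gd, R[i]^o))
    (rho rhos Lambda0 : 'Hom(aff_H gd, R[i]^o)) (k : R[i]) :
  nontwisted D N ->
  is_base (@q_io _ gd) Sdot ->
  is_base (aff_io af) S ->
  (@ext_weight _ gd) @` Sdot `<=` S ->
  natcone S (delta gd) ->
  is_rho (@aff_hform _ gd) S rho ->
  is_rho (@aff_hform _ gd) (pi_sharp af S) rhos ->
  is_Lambda0 Lambda0 ->
  admissible_level af S rho rhos Lambda0 k ->
  principal_admissible_level af S rho rhos Lambda0 k.
Proof.
move=> nt bdot bS SdS dS Hrho _ HL adm; have [ld ssD] := nontwisted_supersystem nt.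
exact: (principal_of_supersystem ld ssD (nontwisted_long nt) bdot bS SdS dS Hrho HL adm).
Qed.
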